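(* Suppose that $\|X\|_2^2=\int_{\mathcal O}X^2(x)\,dx<\infty$ almost surely, and let $\varphi\in L_{1,loc}(\mathcal O)$ satisfy $q<\infty$. If $\alpha\in\mathbb R$, $\alpha\ne\frac1q$, then, as $\varepsilon\to0^+$, $$\mathbb P\{\|\mathcal X_{\varphi,\alpha}\|_2\le\varepsilon\}\sim\frac1{|1-\alpha q|}\cdot\mathbb P\{\|X\|_2\le\varepsilon\},$$ where $\sim$ means that the ratio of the two sides tends to $1$.
   Context: Let $\mathcal O\subset\mathbb R^n$ be a bounded domain and let $X(x)$, $x\in\overline{\mathcal O}$, be a zero mean-value Gaussian random function with covariance $G_X(x,y)=\mathbb E X(x)X(y)$, $x,y\in\overline{\mathcal O}$. Let $\varphi$ be a locally summable function in $\mathcal O$. It is assumed that the function $$\psi(x)=\int_{\mathcal O}G_X(x,y)\varphi(y)\,dy$$ is well defined a.e. in $\mathcal O$ and that $\psi\not\equiv0$. Put $$q=\int_{\mathcal O}\psi(u)\varphi(u)\,du=\int_{\mathcal O}\int_{\mathcal O}G_X(u,v)\varphi(u)\varphi(v)\,du\,dv .$$ For $\alpha\in\mathbb R$ define $$\mathcal X_{\varphi,\alpha}(x)=X(x)-\alpha\,\psi(x)\int_{\mathcal O}X(u)\varphi(u)\,du,\qquad x\in\overline{\mathcal O}.$$ $\|\cdot\|_2$ denotes the norm in $L_2(\mathcal O)$. *)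

(* Defs.v *)
From HB Require Import structures.
From mathcomp Require Import all_boot all_order all_algebra.
From mathcomp Require Import all_classical all_reals all_analysis.

Set Implicit Arguments.
Unset Strict Implicit.
Unset Printing Implicit Defensive.
Import Order.TTheory GRing.Theory Num.Theory.
Import numFieldNormedType.Exports.
Local Open Scope classical_set_scope.
Local Open Scope ring_scope.

(* The sigma-algebra on R^n generated by the coordinates, as the library does
   for n.-tuple; it is the Borel sigma-algebra. *)
Section measurable_rV.
Context {R : realType} (n : nat).

Let coors : 'I_n -> 'rV[R]_n -> R := fun i x => x ord0 i.

Let rV_set0 : g_sigma_preimage coors set0.
Proof. exact: sigma_algebra0. Qed.

Let rV_setC A : g_sigma_preimage coors A -> g_sigma_preimage coors (~` A).
Proof. exact: sigma_algebraC. Qed.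

Let rV_bigcup (F : _^nat) : (forall i, g_sigma_preimage coors (F i)) ->
  g_sigma_preimage coors (\bigcup_i (F i)).
Proof. exact: sigma_algebra_bigcup. Qed.

HB.instance Definition _ :=
  @isMeasurable.Build (measure_tuple_display default_measure_display)
    'rV[R]_n (g_sigma_preimage coors) rV_set0 rV_setC rV_bigcup.

End measurable_rV.

Section measurable_coordinates.
Context {R : realType}.

Lemma measurable_coord n (i : 'I_n) :
  measurable_fun [set: 'rV[R]_n] (fun x : 'rV[R]_n => x ord0 i).
Proof.
move=> _ Y mY; rewrite setTI; apply: sub_sigma_algebra => /=.
rewrite -bigcup_seq/=; exists i => /=; first by rewrite mem_index_enum.
by exists Y => //; rewrite setTI.
Qed.

Lemma measurable_fun_rV d (T : measurableType d) n (f : T -> 'rV[R]_n) :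
  (forall i, measurable_fun [set: T] (fun t => f t ord0 i)) ->
  measurable_fun [set: T] f.
Proof.
move=> mf; have : g_sigma_preimage (fun i t => f t ord0 i) `<=` measurable.
  apply: smallest_sub; first exact: sigma_algebra_measurable.
  case: n => [|n] in f mf *; first by rewrite big_ord0.
  rewrite -bigcup_mkord_ord; apply: bigcup_sub => i Ii.
  by move=> A [B mB <-]; exact: mf.
rewrite (g_sigma_preimage_comp (fun i (x : 'rV[R]_n) => x ord0 i) f).
by move=> fS _ A mA; apply: fS; exists A.
Qed.

Definition rV_cons n (p : R * 'rV[R]_n) : 'rV[R]_n.+1 :=
  \row_(i < n.+1) oapp (fun j => p.2 ord0 j) p.1 (unlift ord0 i).

Definition rV_tail n (x : 'rV[R]_n.+1) : 'rV[R]_n :=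
  \row_(j < n) x ord0 (lift ord0 j).

Lemma measurable_rV_cons n : measurable_fun [set: R * 'rV[R]_n] (@rV_cons n).
Proof.
apply: measurable_fun_rV => i; rewrite /rV_cons.
under eq_fun do rewrite mxE.
case: (unlift ord0 i) => [j|] /=; last exact: measurable_fst.
exact: (measurableT_comp (measurable_coord j) measurable_snd).
Qed.

Lemma measurable_rV_tail n : measurable_fun [set: 'rV[R]_n.+1] (@rV_tail n).
Proof.
apply: measurable_fun_rV => i; rewrite /rV_tail.
under eq_fun do rewrite mxE.
exact: measurable_coord.
Qed.

Lemma rV_consK n (p : R * 'rV[R]_n) :
  (rV_cons p ord0 ord0, rV_tail (rV_cons p)) = p.
Proof.
case: p => a v; congr pair; first by rewrite mxE unlift_none.
by apply/rowP => j; rewrite !mxE liftK.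
Qed.

End measurable_coordinates.


Section lebesgue_rV.
Context {R : realType}.

Section step.
Context n (m : {sigma_finite_measure set 'rV[R]_n -> \bar R}).

Definition lebesgue_rV_step : set 'rV[R]_n.+1 -> \bar R :=
  pushforward (@lebesgue_measure R \x m)%E (@rV_cons R n).

Let mcons : measurable_fun [set: measurableTypeR R * 'rV[R]_n] (@rV_cons R n).
Proof. exact: measurable_rV_cons. Qed.

Let step_measure : {measure set 'rV[R]_n.+1 -> \bar R} :=
  measure_function_pushforward__canonical__measure_function_Measure
    (@lebesgue_measure R \x m)%E mcons.

Let step0 : lebesgue_rV_step set0 = 0%E.
Proof. exact: (measure0 step_measure). Qed.

Let step_ge0 A : (0 <= lebesgue_rV_step A)%E.
Proof. exact: (measure_ge0 step_measure). Qed.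

Let step_sigma_additive : semi_sigma_additive lebesgue_rV_step.
Proof. exact: (@measure_semi_sigma_additive _ _ _ step_measure). Qed.

HB.instance Definition _ := isMeasure.Build _ _ _ lebesgue_rV_step
  step0 step_ge0 step_sigma_additive.

Let step_sigma_finite : sigma_finite setT lebesgue_rV_step.
Proof.
have [F UF mF] : sigma_finite setT (@lebesgue_measure R \x m)%E.
  have /sigma_finiteP[F [TF ndF Foo]] := sigma_finiteT (@lebesgue_measure R).
  have /sigma_finiteP[G [TG ndG Goo]] := sigma_finiteT m.
  exists (fun k => F k `*` G k).
    rewrite -setXTT TF TG predeqE => -[x y]; split.
      move=> [/= [a _ Fax] [b _ Gby]]; exists (maxn a b) => //; split.
      - by move: x Fax; exact/subsetPset/ndF/leq_maxl.
      - by move: y Gby; exact/subsetPset/ndG/leq_maxr.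
    by move=> [k _ []/= ? ?]; split; exists k.
  move=> k; have [? ?] := Foo k; have [? ?] := Goo k.
  split; first exact: measurableX.
  by rewrite product_measure1E// lte_mul_pinfty// ge0_fin_numE.
pose g (x : 'rV[R]_n.+1) : measurableTypeR R * 'rV[R]_n :=
  (x ord0 ord0, rV_tail x).
have mg : measurable_fun setT g.
  apply: measurable_fun_pair; last exact: measurable_rV_tail.
  exact: measurable_coord.
exists (fun k => g @^-1` F k).
  by rewrite -preimage_bigcup -UF preimage_setT.
move=> k; have [mFk Fk] := mF k; split.
  by rewrite -[X in measurable X]setTI; exact: mg.
rewrite /lebesgue_rV_step /pushforward -comp_preimage.
rewrite (_ : g \o _ = id) ?preimage_id//.
by apply/funext => p; exact: rV_consK.
Qed.

HB.instance Definition _ := Measure_isSigmaFinite.Build _ _ _ lebesgue_rV_step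
  step_sigma_finite.

End step.

(* n-dimensional Lebesgue measure, as the n-fold product of the
   one-dimensional one; R^0 is a point of mass 1. *)
Fixpoint lebesgue_rV n : {sigma_finite_measure set 'rV[R]_n -> \bar R} :=
  match n with
  | 0 => dirac (0 : 'rV[R]_0)
  | k.+1 => lebesgue_rV_step (lebesgue_rV k)
  end.


Lemma lebesgue_rV_box n (a b : 'I_n -> R) : (forall i, a i <= b i) ->
  lebesgue_rV n [set x | forall i, x ord0 i \in `]a i, b i]] =
  (\prod_(i < n) (b i - a i))%:E.
Proof.
elim: n a b => [|n IHn] a b ab.
  by rewrite big_ord0 /= diracE mem_set// => -[].
rewrite /= /lebesgue_rV_step /pushforward.
rewrite (_ : _ @^-1` _ = `]a ord0, b ord0]%classic `*`
    [set x : 'rV[R]_n | forall i,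
      x ord0 i \in `]a (lift ord0 i), b (lift ord0 i)]]); last first.
  apply/seteqP; split => [[t x] /= h|[t x] /= [ht hx] i].
    split; first by have := h ord0; rewrite mxE unlift_none.
    by move=> i; have := h (lift ord0 i); rewrite mxE liftK.
  rewrite mxE; case: unliftP => [j ->|->] //=; exact: hx.
rewrite product_measure1E//=.
- rewrite IHn// big_ord_recl EFinM; congr (_ * _)%E.
  rewrite lebesgue_measure_itv/= lte_fin; case: ltgtP (ab ord0) => // -> _.
  by rewrite subrr.
- rewrite (_ : [set _ | _] = \big[setI/setT]_(i < n)
    ((fun x : 'rV[R]_n => x ord0 i) @^-1`
       `]a (lift ord0 i), b (lift ord0 i)]%classic)); last first.
    rewrite -bigcap_seq.
    apply/seteqP; split => [x /= h i _|x /= h i]; first exact: h.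
    by apply: h; rewrite /= mem_index_enum.
  apply: bigsetI_measurable => i _.
  rewrite -[X in measurable X]setTI; exact: measurable_coord.
Qed.

End lebesgue_rV.

Section gaussian.
Context d (T : measurableType d) {R : realType} (P : probability T R).

(* [normal_prob m 0] is not the Dirac mass at m, whence the case distinction:
   degenerate Gaussian variables must be allowed. *)
Definition centered_gaussian (Y : T -> R) :=
  measurable_fun [set: T] Y /\
  exists s : R, forall A : set R, measurable A ->
    pushforward P Y A = if s == 0 then \d_(0 : R) A else normal_prob 0 s A.

Definition centered_gaussian_function (U : Type) (D : set U) (X : U -> T -> R) :=
  forall (k : nat) (x : 'I_k -> U) (c : 'I_k -> R), (forall i, D (x i)) ->
    centered_gaussian (fun w => \sum_(i < k) c i * X (x i) w).

Definition cov_fun (U : Type) (X : U -> T -> R) (x y : U) : R :=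
  fine 'E_P[fun w => (X x w * X y w)%R]%E.

End gaussian.

Section euclidean.
Context {R : realType} (n : nat).
Implicit Types (D : set 'rV[R]_n) (f : 'rV[R]_n -> R).

Definition is_domain D := [/\ open D, connected D & D !=set0].

(* [locally_integrable] of the library, on R^n instead of R. *)
Definition locally_summable D f := [/\ measurable_fun D f, open D &
  forall K, K `<=` D -> compact K ->
    (\int[lebesgue_rV n]_(x in K) `|f x|%:E < +oo)%E].

Definition L2norm D f : \bar R := ('N[lebesgue_rV n]_2%:E [EFin \o (f \_ D)])%E.

End euclidean.

Section transformation.
Context d (T : measurableType d) {R : realType} (P : probability T R).
Context (n : nat) (D : set 'rV[R]_n).
Context (X : 'rV[R]_n -> T -> R) (phi : 'rV[R]_n -> R).

Local Notation mu := (lebesgue_rV n).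

Definition psi (x : 'rV[R]_n) : R :=
  \int[mu]_(y in D) (cov_fun P X x y * phi y).

Definition q : R := \int[mu]_(u in D) (psi u * phi u).

(* [I] is a version of the random variable \int_D X(u) phi(u) du. As [phi] is
   only locally summable, X(., w) phi need not be Lebesgue integrable on D, even
   when q is finite; the integral is the mean-square limit of the pathwise
   Lebesgue integrals along an exhaustion of D. When X(., w) phi is almost
   surely Lebesgue integrable on D, the constant exhaustion E k = D gives the
   pathwise Lebesgue integral. *)
Definition is_random_integral (I : T -> R) :=
  exists E : (set 'rV[R]_n)^nat,
    [/\ forall k, measurable (E k),
        forall j k, (j <= k)%N -> E j `<=` E k,
        \bigcup_k E k = D,
        forall k, {ae P, forall w,
          mu.-integrable (E k) (fun u => (X u w * phi u)%:E)}
      & (fun k => 'E_P[fun w =>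
          ((\int[mu]_(u in E k) (X u w * phi u) - I w) ^+ 2)%R]%E) @ \oo --> 0%E].

Definition transformed (I : T -> R) (alpha : R) (x : 'rV[R]_n) (w : T) : R :=
  X x w - alpha * psi x * I w.

End transformation.

Definition small_ball d (T : measurableType d) (R : realType)
    (P : probability T R) n (D : set 'rV[R]_n) (Y : 'rV[R]_n -> T -> R)
    (e : R) : R :=
  fine (P [set w | (L2norm D (fun x => Y x w) <= e%:E)%E]).

(* Main.v *)
Require Import Defs.
From HB Require Import structures.
From mathcomp Require Import all_boot all_order all_algebra.
From mathcomp Require Import all_classical all_reals all_analysis.
From mathcomp Require Import measurable_realfun ring lra.
From mathcomp Require spectral complex.

Set Implicit Arguments.
Unset Strict Implicit.
Unset Printing Implicit Defensive.
Import Order.TTheory GRing.Theory Num.Theory.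
Import numFieldNormedType.Exports.
Local Open Scope classical_set_scope.
Local Open Scope ring_scope.


Section real_spectral.
Import mathcomp.algebra_tactics.ring.
Import spectral complex.
Variable R : rcfType.

Let dotE n (x y : 'rV[R]_n) : (x *m y^T) 0 0 = \sum_j x 0 j * y 0 j.
Proof. by rewrite mxE; apply: eq_bigr => j _; rewrite mxE. Qed.

Let dot_gt0 n (x : 'rV[R]_n) : x != 0 -> 0 < (x *m x^T) 0 0.
Proof.
move=> x0; rewrite dotE lt_neqAle eq_sym sumr_ge0 ?andbT => [|j _]; last by rewrite -expr2 sqr_ge0.
apply: contra x0 => /eqP s0; apply/eqP/rowP => j; rewrite mxE; apply/eqP.
have h i : true -> 0 <= x 0 i * x 0 i by rewrite -expr2 sqr_ge0.
have /psumr_eq0P : forall i, true -> 0 <= x 0 i * x 0 i by [].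
by move=> /(_ s0 j isT)/eqP; rewrite mulf_eq0 orbb.
Qed.

Lemma symmetric_eigenvector n (A : 'M[R]_n.+1) : A^T = A ->
  exists2 v : 'rV[R]_n.+1, v != 0 & exists r, v *m A = r *: v.
Proof.
move=> AT; pose Ac := map_mx (real_complex R) A.
have [l /eigenvalueP[w wA w0]] := @eigenvalue_closed _ _ Ac (ltn0Sn n).
pose x := map_mx (@complex.Re R) w; pose y := map_mx (@complex.Im R) w.
pose a := complex.Re l; pose b := complex.Im l.
have entry k : \sum_j w 0 j * (A j k)%:C%C = l * w 0 k.
  have := congr1 (fun M : 'rV_n.+1 => M 0 k) wA; rewrite !mxE => <-.
  by apply: eq_bigr => j _; rewrite mxE.
have ReM (z : R[i]) (r : R) : complex.Re (z * r%:C%C) = complex.Re z * r.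
  by case: z => u v /=; rewrite mulr0 subr0.
have ImM (z : R[i]) (r : R) : complex.Im (z * r%:C%C) = complex.Im z * r.
  by case: z => u v /=; rewrite mulr0 add0r.
have xA : x *m A = a *: x - b *: y.
  apply/rowP => k; rewrite !mxE.
  have := congr1 (@complex.Re R) (entry k); rewrite raddf_sum /= => e.
  transitivity (complex.Re (l * w 0 k)).
    by rewrite -e; apply: eq_bigr => j _; rewrite ReM mxE.
  by rewrite /a /b; case: l {e wA entry a b} => l1 l2; case: (w 0 k).
have yA : y *m A = a *: y + b *: x.
  apply/rowP => k; rewrite !mxE.
  have := congr1 (@complex.Im R) (entry k); rewrite raddf_sum /= => e.
  transitivity (complex.Im (l * w 0 k)).
    by rewrite -e; apply: eq_bigr => j _; rewrite ImM mxE.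
  rewrite /a /b; case: l {e wA entry xA a b} => l1 l2; case: (w 0 k) => w1 w2 /=.
  by rewrite addrC; congr (_ + _); rewrite mulrC.
have xy0 : (x != 0) || (y != 0).
  apply: contraR w0; rewrite negb_or !negbK => /andP[/eqP x0 /eqP y0].
  apply/eqP/rowP => k; rewrite mxE; apply/eqP; rewrite eq_complex.
  have := congr1 (fun M : 'rV_n.+1 => M 0 k) x0; rewrite !mxE => ->.
  by have := congr1 (fun M : 'rV_n.+1 => M 0 k) y0; rewrite !mxE => ->; rewrite eqxx.
have sym : (x *m A) *m y^T = ((y *m A) *m x^T)^T.
  by rewrite trmx_mul trmxK trmx_mul AT mulmxA.
have b0 : b = 0.
  have := congr1 (fun M : 'M[R]_1 => M 0 0) sym.
  rewrite xA yA mulmxBl mulmxDl -!scalemxAl.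
  rewrite [RHS]mxE; do 4 try rewrite [LHS]mxE.
  move=> e.
  have {}e : a * (x *m y^T) 0 0 - b * (y *m y^T) 0 0 = a * (y *m x^T) 0 0 + b * (x *m x^T) 0 0.
    by move: e; rewrite !mxE.
  have c : (y *m x^T) 0 0 = (x *m y^T) 0 0.
    by rewrite !dotE; apply: eq_bigr => j _; rewrite mulrC.
  have {}e : b * ((x *m x^T) 0 0 + (y *m y^T) 0 0) = 0.
    rewrite c in e; rewrite -(subrr (a * (x *m y^T) 0 0 + b * (x *m x^T) 0 0)) -{2}e.
    by ring.
  have p : 0 < (x *m x^T) 0 0 + (y *m y^T) 0 0.
    have ge (z : 'rV[R]_n.+1) : 0 <= (z *m z^T) 0 0.
      by rewrite dotE sumr_ge0// => j _; rewrite -expr2 sqr_ge0.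
    by case/orP: xy0 => h; [rewrite ltr_pwDl// dot_gt0|rewrite ltr_wpDl// dot_gt0].
  by move/eqP: e; rewrite mulf_eq0 (gt_eqF p) orbF => /eqP.
case/orP: xy0 => h; [exists x => //|exists y => //]; exists a.
  by rewrite xA b0 scale0r subr0.
by rewrite yA b0 scale0r addr0.
Qed.

(* Householder reflection *)
Lemma orthogonal_with_first_row n (v : 'rV[R]_(1 + n)) : (v *m v^T) 0 0 = 1 ->
  exists H : 'M[R]_(1 + n), H *m H^T = 1%:M /\ usubmx H = v.
Proof.
move=> v1; pose e : 'rV[R]_(1 + n) := row_mx 1%:M 0.
have ee : (e *m e^T) 0 0 = 1.
  by rewrite /e tr_row_mx mul_row_col trmx1 mulmx1 trmx0 mulmx0 addr0 mxE.
have usub1 : usubmx (1%:M : 'M[R]_(1 + n)) = e.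
  by rewrite scalar_mx_block block_mxEv col_mxKu.
have [ve|ve] := eqVneq v e.
  by exists 1%:M; rewrite trmx1 mulmx1 ve usub1.
pose u := v - e; have u0 : u != 0 by rewrite subr_eq0.
pose c := (u *m u^T) 0 0; have c0 : c != 0 by rewrite gt_eqF// dot_gt0.
have uu : u *m u^T = c%:M by rewrite [LHS]mx11_scalar.
pose H := 1%:M - (2 / c) *: (u^T *m u).
have HT : H^T = H by rewrite /H linearB/= trmx1 linearZ/= trmx_mul trmxK.
exists H; split.
  rewrite HT; pose K := u^T *m u.
  have KK : K *m K = c *: K.
    by rewrite /K mulmxA -[_ *m u *m u^T]mulmxA uu mul_mx_scalar -scalemxAl.
  rewrite /H -/K mulmxBl !mulmxBr !mul1mx mulmx1 -scalemxAl -scalemxAr KK !scalerA.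
  rewrite (_ : 2 / c * (2 / c) * c = 2 / c + 2 / c); last by field.
  by rewrite scalerDl opprB addrK subrK.
have -> : usubmx H = e *m H.
  have E : H = col_mx (e *m H) (dsubmx (1%:M : 'M[R]_(1 + n)) *m H).
    by rewrite -mul_col_mx -usub1 vsubmxK mul1mx.
  by rewrite [in LHS]E col_mxKu.
rewrite /H mulmxBr mulmx1 -scalemxAr mulmxA.
have ve1 : (e *m v^T) 0 0 = (v *m e^T) 0 0.
  by rewrite !dotE; apply: eq_bigr => j _; rewrite mulrC.
have eu : (e *m u^T) 0 0 = - c / 2.
  rewrite /c /u linearB/= !mulmxBr !mulmxBl.
  have Bm (M N : 'M[R]_1) : (M - N) 0 0 = M 0 0 - N 0 0 by rewrite !mxE.
  by rewrite !Bm v1 ee ve1; field.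
rewrite [e *m u^T]mx11_scalar eu mul_scalar_mx scalerA.
have -> : 2 / c * (- c / 2) = -1 by field.
by rewrite scaleN1r opprK /u addrC subrK.
Qed.

Theorem real_spectral n (A : 'M[R]_n) : A^T = A ->
  exists2 O : 'M[R]_n, O *m O^T = 1%:M &
    forall i j, i != j -> (O *m A *m O^T) i j = 0.
Proof.
elim: n A => [|n IH] A AT.
  by exists 1%:M; [rewrite trmx1 mulmx1|case].
have [v0 v0N [r v0A]] := symmetric_eigenvector AT.
pose c := Num.sqrt ((v0 *m v0^T) 0 0).
have c0 : c != 0 by rewrite gt_eqF// sqrtr_gt0 dot_gt0.
pose v : 'rV[R]_(1 + n) := c^-1 *: v0.
have vA : v *m A = r *: v by rewrite /v -scalemxAl v0A !scalerA mulrC.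
have v1 : (v *m v^T) 0 0 = 1.
  rewrite /v linearZ/= -scalemxAl -scalemxAr scalerA mxE.
  by rewrite -invfM -expr2 sqr_sqrtr ?mulVf ?gt_eqF ?dot_gt0// ltW// dot_gt0.
have [H [HH Hv]] := orthogonal_with_first_row v1.
pose B : 'M[R]_(1 + n) := H *m A *m H^T.
have BT : B^T = B by rewrite /B !trmx_mul trmxK AT mulmxA.
have uB : usubmx B = row_mx r%:M 0.
  have -> : usubmx B = r *: (v *m H^T).
    have := vsubmxK H; rewrite Hv => HE.
    by rewrite /B -{1}HE !mul_col_mx col_mxKu vA scalemxAl.
  have e1 : v *m H^T = usubmx (1%:M : 'M[R]_(1 + n)).
    have := vsubmxK H; rewrite Hv => HE.
    by rewrite -HH -{2}HE mul_col_mx col_mxKu.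
  rewrite e1 scalar_mx_block block_mxEv col_mxKu scale_row_mx scaler0.
  by rewrite scale_scalar_mx mulr1.
have Bul : ulsubmx B = r%:M by rewrite /ulsubmx uB row_mxKl.
have Bur : ursubmx B = 0 by rewrite /ursubmx uB row_mxKr.
have Bdl : dlsubmx B = 0 by rewrite -[LHS]trmxK trmx_dlsub BT Bur trmx0.
have BE : B = block_mx r%:M 0 0 (drsubmx B) by rewrite -[LHS]submxK Bul Bur Bdl.
have [|O' OO' dO'] := IH (drsubmx B); first by rewrite trmx_drsub BT.
pose Q : 'M[R]_(1 + n) := block_mx 1%:M 0 0 O'.
have QT : Q^T = block_mx 1%:M 0 0 O'^T by rewrite /Q tr_block_mx trmx1 !trmx0.
have QQ : Q *m Q^T = 1%:M.
  rewrite QT /Q mulmx_block !mulmx0 !mul0mx !mulmx1 !addr0 !add0r OO'.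
  by rewrite -scalar_mx_block.
have dQ i j : i != j -> (Q *m B *m Q^T) i j = 0.
  rewrite BE QT /Q !mulmx_block !mulmx0 !mul0mx !mulmx1 !mul1mx ?mul0mx ?mulmx0 !addr0 !add0r.
  rewrite -(fintype.splitK i) -(fintype.splitK j).
  case: (fintype.split i) => i'; case: (fintype.split j) => j' /=;
    rewrite ?block_mxEul ?block_mxEur ?block_mxEdl ?block_mxEdr.
  - by rewrite !ord1 eqxx.
  - by rewrite mul0mx mxE.
  - by rewrite mxE.
  - by rewrite (inj_eq (@rshift_inj _ _)); exact: dO'.
exists (Q *m H).
  by rewrite trmx_mul mulmxA -[Q *m H *m H^T]mulmxA HH mulmx1.
have -> : Q *m H *m A *m (Q *m H)^T = Q *m B *m Q^T.
  by rewrite trmx_mul /B !mulmxA.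
exact: dQ.
Qed.

End real_spectral.


Section square_integrable.
Context d (T : measurableType d) {R : realType}.
Variable m : {measure set T -> \bar R}.
Implicit Types f g : T -> R.

Definition intg f := m.-integrable [set: T] (EFin \o f).

Definition L2 f := measurable_fun [set: T] f /\ intg (fun x => f x ^+ 2).

Lemma intgP f : intg f -> measurable_fun [set: T] f.
Proof. by move=> /measurable_int /measurable_EFinP. Qed.

Lemma intg_le f g : measurable_fun [set: T] f -> intg g ->
  (forall x, `|f x| <= g x) -> intg f.
Proof.
move=> mf ig fg; apply: (le_integrable measurableT) ig => //.
  exact/measurable_EFinP.
by move=> x _ /=; rewrite lee_fin (le_trans (fg x))// ler_norm.
Qed.

Lemma intgD f g : intg f -> intg g -> intg (fun x => f x + g x).
Proof. by move=> h k; exact: (integrableD measurableT h k). Qed.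

Lemma intgB f g : intg f -> intg g -> intg (fun x => f x - g x).
Proof. by move=> h k; exact: (integrableB measurableT h k). Qed.

Lemma intgZ k f : intg f -> intg (fun x => k * f x).
Proof. by move=> h; exact: (integrableZl measurableT k h). Qed.

Lemma intg0 : intg (fun=> 0).
Proof. exact: integrable0. Qed.

Lemma L2_mul f g : L2 f -> L2 g -> intg (fun x => f x * g x).
Proof.
move=> [mf if2] [mg ig2]; apply: (intg_le _ (intgD if2 ig2)).
  exact: measurable_funM.
move=> x; rewrite normrM -(real_normK (num_real (f x))).
rewrite -(real_normK (num_real (g x))).
have := sqr_ge0 (`|f x| - `|g x|); have := normr_ge0 (f x); have := normr_ge0 (g x).
nra.
Qed.

Lemma L2Z k f : L2 f -> L2 (fun x => k * f x).
Proof.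
move=> [mf if2]; split; first exact: measurable_funM.
by under eq_fun do rewrite exprMn; exact: intgZ.
Qed.

Lemma L2D f g : L2 f -> L2 g -> L2 (fun x => f x + g x).
Proof.
move=> lf lg; have fg := L2_mul lf lg; case: lf lg => [mf if2] [mg ig2].
split; first exact: measurable_funD.
have -> : (fun x => (f x + g x) ^+ 2) =
   (fun x => (f x ^+ 2 + g x ^+ 2) + 2 * (f x * g x)).
  by apply/funext => x; ring.
by apply: intgD; [exact: intgD|exact: intgZ].
Qed.

Lemma L2B f g : L2 f -> L2 g -> L2 (fun x => f x - g x).
Proof.
move=> lf /(L2Z (-1)) lg; have := L2D lf lg.
by under eq_fun do rewrite mulN1r.
Qed.

Lemma L2_0 : L2 (fun=> 0).
Proof.
split; first exact: measurable_cst.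
by under eq_fun do rewrite expr0n; exact: intg0.
Qed.

Lemma L2_sum (I : Type) (s : seq I) (F : I -> T -> R) : (forall i, L2 (F i)) ->
  L2 (fun x => \sum_(i <- s) F i x).
Proof.
move=> LF; elim: s => [|i s IH].
  by under eq_fun do rewrite big_nil; exact: L2_0.
by under eq_fun do rewrite big_cons; exact: L2D.
Qed.

Lemma L2_le f g : measurable_fun [set: T] f -> L2 g ->
  (forall x, `|f x| <= `|g x|) -> L2 f.
Proof.
move=> mf [mg ig] fg; split => //; apply: intg_le ig _.
  exact: measurable_funX.
move=> x; rewrite ger0_norm ?sqr_ge0//.
by rewrite -(real_normK (num_real (f x))) -(real_normK (num_real (g x))) lerXn2r ?nnegrE.
Qed.

Lemma RintD f g : intg f -> intg g ->
  \int[m]_x (f x + g x) = \int[m]_x f x + \int[m]_x g x.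
Proof. by move=> ? ?; exact: RintegralD. Qed.

Lemma RintB f g : intg f -> intg g ->
  \int[m]_x (f x - g x) = \int[m]_x f x - \int[m]_x g x.
Proof. by move=> ? ?; exact: RintegralB. Qed.

Lemma RintZ k f : intg f -> \int[m]_x (k * f x) = k * \int[m]_x f x.
Proof. by move=> ?; exact: RintegralZl. Qed.

Lemma Rint_le f g : intg f -> intg g -> (forall x, f x <= g x) ->
  \int[m]_x f x <= \int[m]_x g x.
Proof. by move=> ? ? fg; apply: le_Rintegral. Qed.

Lemma Rint_ge0 f : (forall x, 0 <= f x) -> 0 <= \int[m]_x f x.
Proof. by move=> fg; apply: Rintegral_ge0. Qed.

Lemma Rint_sum (I : Type) (s : seq I) (F : I -> T -> R) :
  (forall i, intg (F i)) ->
  \int[m]_x (\sum_(i <- s) F i x) = \sum_(i <- s) \int[m]_x F i x.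
Proof.
move=> iF; elim: s => [|i s IH].
  rewrite big_nil; under eq_Rintegral do rewrite big_nil.
  by rewrite /Rintegral integral0.
rewrite big_cons -IH -RintD//; first by under eq_Rintegral do rewrite big_cons.
elim: s {IH} => [|j s IH]; first by under eq_fun do rewrite big_nil; exact: intg0.
by under eq_fun do rewrite big_cons; exact: intgD.
Qed.

Lemma intg_sum (I : Type) (s : seq I) (F : I -> T -> R) :
  (forall i, intg (F i)) -> intg (fun x => \sum_(i <- s) F i x).
Proof.
move=> iF; elim: s => [|j s IH]; first by under eq_fun do rewrite big_nil; exact: intg0.
by under eq_fun do rewrite big_cons; exact: intgD.
Qed.

Lemma EFin_Rint f : intg f -> (\int[m]_x f x)%:E = (\int[m]_x (f x)%:E)%E.
Proof. by move=> fi; rewrite /Rintegral fineK// (integrable_fin_num measurableT). Qed.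

Lemma Rint_abs f : intg f -> `|\int[m]_x f x| <= \int[m]_x `|f x|.
Proof. by move=> fi; exact: le_normr_Rintegral. Qed.

Lemma intg_abs f : intg f -> intg (fun x => `|f x|).
Proof. by move=> fi; exact: integrable_norm. Qed.

Lemma Rint_sqrB (f g : T -> R) k : L2 f -> L2 g ->
  \int[m]_x ((f x - k * g x) ^+ 2) =
  \int[m]_x (f x ^+ 2) - 2 * k * \int[m]_x (f x * g x) + k ^+ 2 * \int[m]_x (g x ^+ 2).
Proof.
move=> lf lg; have fg := L2_mul lf lg.
rewrite -RintZ// -RintZ//; last by case: lg.
rewrite -RintB//; last 2 first.
- by case: lf.
- exact: intgZ.
rewrite -RintD//; last 2 first.
- by apply: intgB; [case: lf|exact: intgZ].
- by apply: intgZ; case: lg.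
by apply: eq_Rintegral => x _; ring.
Qed.

Lemma discr_le (a b c eta : R) : 0 <= c ->
  (forall t, 0 <= eta + a - 2 * t * b + t ^+ 2 * c) -> b ^+ 2 <= (eta + a) * c.
Proof.
rewrite le_eqVlt => /predU1P[<-|c0] h.
  suff -> : b = 0 by rewrite expr0n mulr0.
  apply/eqP/negP => /negP b0; have := h ((eta + a + 1) / (2 * b)).
  rewrite mulr0 addr0 (_ : 2 * _ * b = eta + a + 1); last by field.
  lra.
have := h (b / c).
have -> : eta + a - 2 * (b / c) * b + (b / c) ^+ 2 * c = (eta + a) - b ^+ 2 / c.
  by field; rewrite gt_eqF.
by rewrite subr_ge0 ler_pdivrMr.
Qed.

Lemma CauchySchwarz f g : L2 f -> L2 g ->
  (\int[m]_x (f x * g x)) ^+ 2 <= (\int[m]_x (f x ^+ 2)) * (\int[m]_x (g x ^+ 2)).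
Proof.
move=> lf lg; rewrite -[X in X * _]add0r; apply: discr_le.
  by apply: Rint_ge0 => x; exact: sqr_ge0.
move=> t; rewrite add0r -Rint_sqrB//.
by apply: Rint_ge0 => x; exact: sqr_ge0.
Qed.

Lemma L2_sqrD_le f g : L2 f -> L2 g ->
  \int[m]_x ((f x + g x) ^+ 2) <= 2 * \int[m]_x (f x ^+ 2) + 2 * \int[m]_x (g x ^+ 2).
Proof.
move=> lf lg; have fg := L2D lf lg.
rewrite -RintZ//; last by case: lf.
rewrite -RintZ//; last by case: lg.
rewrite -RintD//; last 2 first.
- by apply: intgZ; case: lf.
- by apply: intgZ; case: lg.
apply: Rint_le; first by case: fg.
  by apply: intgD; apply: intgZ; [case: lf|case: lg].
by move=> x; have := sqr_ge0 (f x - g x); nra.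
Qed.

Lemma eq0_Rint_sqr f : L2 f -> \int[m]_x (f x ^+ 2) = 0 -> ae_eq m setT f (cst 0).
Proof.
move=> [mf fi] f0.
have : (\int[m]_x (f x ^+ 2)%:E = 0)%E by rewrite -EFin_Rint// f0.
have -> : (\int[m]_x (f x ^+ 2)%:E = \int[m]_x `|(f x ^+ 2)%:E|)%E.
  by apply: eq_integral => x _; rewrite /= ger0_norm// sqr_ge0.
move=> /ae_eq_integral_abs => /(_ measurableT).
have mff : measurable_fun setT (fun x => (f x ^+ 2)%:E).
  by apply/measurable_EFinP; exact: measurable_funX.
move=> /(_ mff); apply: filterS => x /= /(_ I) [] /eqP.
by rewrite sqrf_eq0 => /eqP.
Qed.

Lemma ae_eq_Rint f g : measurable_fun setT f -> measurable_fun setT g ->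
  ae_eq m setT f g -> \int[m]_x f x = \int[m]_x g x.
Proof.
move=> mf mg fg; rewrite /Rintegral; congr fine.
apply: ae_eq_integral => //; [exact/measurable_EFinP|exact/measurable_EFinP|].
by apply: filterS fg => x /= /(_ I) ->.
Qed.

Lemma Rint_dct (F : nat -> T -> R) f g :
  (forall k, measurable_fun setT (F k)) -> measurable_fun setT f -> intg g ->
  {ae m, forall x, F ^~ x @ \oo --> f x} ->
  (forall k x, `|F k x| <= g x) ->
  (fun k => \int[m]_x F k x) @ \oo --> \int[m]_x f x.
Proof.
move=> mF mf ig Ff Fg.
have [] := @dominated_convergence _ _ _ m setT measurableT
  (fun k => EFin \o F k) (EFin \o f) (EFin \o g).
- by move=> k; exact/measurable_EFinP.
- exact/measurable_EFinP.
- by apply: filterS Ff => x /= h _; apply/cvg_EFin => //; exact: nearW.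
- exact: ig.
- by apply: aeW => x k _ /=; rewrite lee_fin.
move=> fi _ h.
apply: fine_cvg; rewrite fineK; first exact: h.
exact: (integrable_fin_num measurableT).
Qed.

End square_integrable.

Section finite_measure_tools.
Context d (T : measurableType d) {R : realType}.
Variable m : {finite_measure set T -> \bar R}.

Lemma intg_bounded (f : T -> R) M : measurable_fun setT f ->
  (forall x, `|f x| <= M) -> intg m f.
Proof.
move=> mf fM; apply: (intg_le mf _ fM).
exact: finite_measure_integrable_cst.
Qed.

Lemma L2_bounded (f : T -> R) M : measurable_fun setT f ->
  (forall x, `|f x| <= M) -> L2 m f.
Proof.
move=> mf fM; split => //; apply: (@intg_bounded _ (M ^+ 2)).
  exact: measurable_funX.
by move=> x; rewrite normrX lerXn2r ?nnegrE// (le_trans _ (fM x)).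
Qed.

Lemma L2_intg (f : T -> R) : L2 m f -> intg m f.
Proof.
move=> lf; have l1 : L2 m (cst 1) by apply: (@L2_bounded _ 1) => //= x; rewrite normr1.
by have := L2_mul lf l1; under eq_fun do rewrite mulr1.
Qed.

Lemma L2_int1_le (f : T -> R) : L2 m f ->
  (\int[m]_x `|f x|) ^+ 2 <= fine (m setT) * \int[m]_x (f x ^+ 2).
Proof.
move=> lf; have l1 : L2 m (cst 1) by apply: (@L2_bounded _ 1) => //= x; rewrite normr1.
have laf : L2 m (fun x => `|f x|).
  by apply: (L2_le _ lf) => [|x]; [apply: measurableT_comp => //; case: lf|rewrite normr_id].
have := CauchySchwarz l1 laf.
have -> : \int[m]_x (cst 1 x * `|f x|) = \int[m]_x `|f x|.
  by apply: eq_Rintegral => x _; rewrite mul1r.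
have -> : \int[m]_x (`|f x| ^+ 2) = \int[m]_x (f x ^+ 2).
  by apply: eq_Rintegral => x _; rewrite real_normK// num_real.
suff -> : \int[m]_x (cst 1 x ^+ 2) = fine (m setT) by [].
by under eq_Rintegral do rewrite expr1n; rewrite Rintegral_cst// mul1r.
Qed.

End finite_measure_tools.


Section density.
Import HBNNSimple.
Context d (T : measurableType d) {R : realType}.
Variables (mu nu : {measure set T -> \bar R}) (p : T -> R).
Hypothesis p0 : forall x, 0 <= p x.
Hypothesis mp : measurable_fun [set: T] p.
Hypothesis nuE : forall A, measurable A -> nu A = (\int[mu]_(x in A) (p x)%:E)%E.

Lemma ge0_integral_density (f : T -> \bar R) : (forall x, 0 <= f x)%E ->
  measurable_fun setT f ->
  (\int[nu]_x f x = \int[mu]_x (f x * (p x)%:E))%E.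
Proof.
move=> f0 mf.
have mpE : measurable_fun setT (EFin \o p) by exact/measurable_EFinP.
pose g := nnsfun_approx measurableT mf.
have gf x : (g n x)%:E @[n --> \oo] --> f x.
  by apply: cvg_nnsfun_approx => // y _.
have ndg x : {homo (fun n => (g n x)%:E) : a b / (a <= b)%N >-> (a <= b)%E}.
  by move=> a b ab; rewrite lee_fin; exact/lefP/nd_nnsfun_approx.
have h0 n r x : (0 <= (r * \1_(g n @^-1` [set r]) x)%:E)%E.
  by rewrite EFinM; exact: nnfun_muleindic_ge0.
have sE n : (\int[nu]_x (g n x)%:E = \int[mu]_x ((g n x)%:E * (p x)%:E))%E.
  rewrite integralT_nnsfun sintegralE.
  transitivity (\int[mu]_x (\sum_(r \in range (g n))
      ((r * \1_(g n @^-1` [set r]) x)%:E * (p x)%:E)))%E; last first.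
    apply: eq_integral => x _; rewrite [in RHS]fimfunE -fsumEFin//.
    by rewrite ge0_mule_fsuml// => r; exact: h0.
  rewrite ge0_integral_fsum//; last 2 first.
  - move=> r; apply: emeasurable_funM.
      apply/measurable_EFinP; apply: measurable_funM => //.
    exact/measurable_EFinP.
  - by move=> r x _; rewrite mule_ge0 ?lee_fin ?h0 ?p0//; exact: h0.
  apply: eq_fsbigr => r _; have [r0|r0] := ltP r 0.
    rewrite preimage_nnfun0// measure0 mule0 integral0_eq// => x _.
    by rewrite indic0 mulr0 mul0e.
  under eq_integral do rewrite EFinM -muleA.
  rewrite ge0_integralZl//; last 2 first.
  - by apply: emeasurable_funM => //; exact/measurable_EFinP.
  - by move=> x _; rewrite mule_ge0 ?lee_fin.
  congr (_ * _)%E; rewrite nuE// integral_mkcond; apply: eq_integral => x _.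
  by rewrite restrict_EFin /= /patch indicE; case: ifPn; rewrite ?mul1e ?mul0e.
have cl : (\int[nu]_x (g n x)%:E)%E @[n --> \oo] --> (\int[nu]_x f x)%E.
  under eq_integral => x _ do rewrite -(cvg_lim _ (gf x))//.
  apply: cvg_monotone_convergence => //.
  - by move=> n; exact/measurable_EFinP.
  - by move=> n x _; rewrite lee_fin.
have cr : (\int[mu]_x ((g n x)%:E * (p x)%:E))%E @[n --> \oo] -->
    (\int[mu]_x (f x * (p x)%:E))%E.
  have gfp x : ((g n x)%:E * (p x)%:E)%E @[n --> \oo] --> (f x * (p x)%:E)%E.
    exact: cvgeZr.
  under eq_integral => x _ do rewrite -(cvg_lim _ (gfp x))//.
  apply: cvg_monotone_convergence => //.
  - by move=> n; apply: emeasurable_funM => //; exact/measurable_EFinP.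
  - by move=> n x _; rewrite mule_ge0 ?lee_fin.
  - move=> x _ a b ab; apply: lee_pmul => //; rewrite ?lee_fin//.
    exact: (ndg x).
move: cl; rewrite (funext sE) => cl.
exact: (cvg_unique _ cl cr).
Qed.

Lemma intg_density (f : T -> R) : measurable_fun setT f ->
  intg mu (fun x => f x * p x) -> intg nu f.
Proof.
move=> mf fi; apply/integrableP; split; first exact/measurable_EFinP.
rewrite ge0_integral_density//; last first.
  by do 2 apply: measurableT_comp => //.
have /integrableP[_] := fi; apply: le_lt_trans.
rewrite le_eqVlt; apply/orP; left; apply/eqP; apply: eq_integral => x _.
by rewrite /= normrM (ger0_norm (p0 x)).
Qed.

Lemma Rint_density (f : T -> R) : measurable_fun setT f ->
  intg mu (fun x => f x * p x) ->
  \int[nu]_x f x = \int[mu]_x (f x * p x).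
Proof.
move=> mf fi; rewrite /Rintegral; congr fine.
rewrite integralE [in RHS]integralE; congr (_ - _)%E.
- rewrite ge0_integral_density//; last exact/measurable_funepos/measurable_EFinP.
  apply: eq_integral => x _; rewrite !funeposE/= -!EFin_max -EFinM.
  by congr EFin; rewrite maxr_pMl// mul0r.
- rewrite ge0_integral_density//; last exact/measurable_funeneg/measurable_EFinP.
  apply: eq_integral => x _; rewrite !funenegE/= -!EFin_max -EFinM.
  by congr EFin; rewrite maxr_pMl// mul0r mulNr.
Qed.

End density.


Section normal_integrals.
Context {R : realType}.
Local Notation mu := (@lebesgue_measure R).

Lemma Rint_deriv_eq0 (F f : R -> R) (M : R) :
  (forall x : R, is_derive x 1 F (f x)) -> continuous f -> intg mu f ->
  (forall x, `|x| * `|F x| <= M) -> \int[mu]_x f x = 0.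
Proof.
move=> dF cf fi FM.
have mf := intgP fi.
have cF : continuous F.
  by move=> x; apply/differentiable_continuous/derivable1_diffP; case: (dF x).
pose g n x := f x * \1_(`[- n%:R, n%:R]%classic) x.
have gE n : \int[mu]_x g n.+1 x = F n.+1%:R - F (- n.+1%:R).
  have -> : \int[mu]_x g n.+1 x = \int[mu]_(x in `[- n.+1%:R, n.+1%:R]) f x.
    rewrite [in RHS]Rintegral_mkcond; apply: eq_Rintegral => x _.
    by rewrite /= /patch /g indicE; case: ifPn; rewrite ?mulr1 ?mulr0.
  rewrite /Rintegral (@continuous_FTC2 _ _ F)//.
  - by rewrite (lt_trans (_ : _ < 0))// oppr_lt0.
  - exact: continuous_subspaceT.
  - split.
    + by move=> x _; case: (dF x).
    + by apply: cvg_at_right_filter; exact: cF.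
    + by apply: cvg_at_left_filter; exact: cF.
  - by move=> x _; rewrite derive1E; case: (dF x) => _ ->.
have M0 : 0 <= M by apply: le_trans (FM 0); rewrite normr0 mul0r.
have c1 : (fun n => \int[mu]_x g n.+1 x) @ \oo --> \int[mu]_x f x.
  apply: (@Rint_dct _ _ _ mu (fun n => g n.+1) f (fun x => `|f x|)) => //.
  - by move=> k; apply: measurable_funM => //.
  - exact: intg_abs.
  - apply: aeW => x; apply: cvg_near_cst.
    near=> n; rewrite /g indicE mem_set ?mulr1//= in_itv/= -ler_norml.
    rewrite (@le_trans _ _ n%:R)// ?ler_nat//.
    by near: n; exact: nbhs_infty_ger.
  - by move=> k x; rewrite /g normrM ler_piMr// indicE; case: (_ \in _); rewrite ?normr0 ?normr1.
have c2 : (fun n => \int[mu]_x g n.+1 x) @ \oo --> (0 : R).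
  apply/cvgrPdist_le => e e0; near=> n.
  rewrite sub0r normrN gE (le_trans (ler_normB _ _))//.
  have h (y : R) : `|y| = n.+1%:R -> `|F y| <= M / n.+1%:R.
    by move=> yn; rewrite ler_pdivlMr// mulrC -{1}yn.
  rewrite (le_trans (lerD (h _ _) (h _ _)))// ?normrN ?ger0_norm//.
  rewrite -mulrDl ler_pdivrMr// mulrC -ler_pdivrMr//.
  rewrite (@le_trans _ _ n%:R)// ?ler_nat//.
  by near: n; exact: nbhs_infty_ger.
exact: (cvg_unique _ c1 c2).
Unshelve. all: by end_near. Qed.

Variable s : R.
Hypothesis s0 : s != 0.
Local Notation p := (normal_pdf 0 s).
Local Notation pk := (normal_peak s).

Let s2 : 0 < s ^+ 2.
Proof. by rewrite exprn_even_gt0. Qed.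

Let pE x : p x = pk * expR (- x ^+ 2 / (s ^+ 2 *+ 2)).
Proof. by rewrite normal_pdfE// /normal_fun subr0. Qed.

Let p0 x : 0 <= p x. Proof. exact: normal_pdf_ge0. Qed.

Let pk0 : 0 < pk. Proof. exact: normal_peak_gt0. Qed.

Let mp : measurable_fun setT p. Proof. exact: measurable_normal_pdf. Qed.

Let ip : intg mu p. Proof. exact: integrable_normal_pdf. Qed.

Lemma is_derive_normal_pdf (x : R) : is_derive x 1 p (- x / s ^+ 2 * p x).
Proof.
pose k := - (s ^+ 2 *+ 2)^-1.
have pE' : p = (fun y : R => pk * expR (k * y ^+ 2)).
  by apply/funext => y; rewrite pE; congr (_ * expR _); rewrite /k; field.
rewrite pE'; apply: is_derive_eq.
rewrite /GRing.scale /= /k.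
by field.
Qed.

Let le_expR (y : R) : y <= expR y.
Proof. by have := expR_ge1Dx y; lra. Qed.

Let sqr_expR_le (c x : R) : 0 < c -> x ^+ 2 * expR (- x ^+ 2 / c) <= c.
Proof.
move=> c0; rewrite mulNr expRN ler_pdivrMr ?expR_gt0//.
by rewrite -ler_pdivrMl// mulrC le_expR.
Qed.

Lemma sqr_normal_pdf_le x : x ^+ 2 * p x <= pk * (s ^+ 2 *+ 2).
Proof.
rewrite pE mulrCA ler_pM2l//; apply: sqr_expR_le.
by rewrite mulrn_wgt0.
Qed.

Lemma normal_pdf_le x : p x <= pk.
Proof.
rewrite pE ler_piMr ?(ltW pk0)//; apply: (@le_trans _ _ (expR 0)); last by rewrite expR0.
by rewrite ler_expR mulNr oppr_le0 divr_ge0 ?sqr_ge0// mulrn_wge0// sqr_ge0.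
Qed.

Lemma intg_sqr_normal_pdf : intg mu (fun x => x ^+ 2 * p x).
Proof.
have s20 : s * 2 != 0 by rewrite mulf_neq0.
pose C := s ^+ 2 * 8 / 3 * pk / normal_peak (s * 2).
have := @integrable_normal_pdf R 0 (s * 2).
move=> /(@intgZ _ _ _ _ C) H; apply: (intg_le _ H).
  by apply: measurable_funM => //; exact: measurable_funX.
move=> x; rewrite ger0_norm ?(mulr_ge0 (sqr_ge0 x) (p0 x))// pE (normal_pdfE _ s20).
rewrite /normal_fun subr0 [leRHS]mulrA.
have -> : C * normal_peak (s * 2) = s ^+ 2 * 8 / 3 * pk.
  by rewrite /C divfK// gt_eqF// normal_peak_gt0.
rewrite mulrCA -mulrA [leRHS]mulrCA ler_pM2l//.
have -> : - x ^+ 2 / (s ^+ 2 *+ 2) =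
    - x ^+ 2 / (s ^+ 2 * 8 / 3) + - x ^+ 2 / ((s * 2) ^+ 2 *+ 2) by field.
rewrite expRD mulrA ler_wpM2r ?expR_ge0//; apply: sqr_expR_le.
by rewrite divr_gt0// mulr_gt0.
Qed.

Lemma intg_id_normal_pdf : intg mu (fun x => x * p x).
Proof.
have H := intgD intg_sqr_normal_pdf ip; apply: (intg_le _ H).
  by apply: measurable_funM.
move=> x; rewrite normrM (ger0_norm (p0 x)) -[X in _ <= _ + X]mul1r -mulrDl.
rewrite ler_wpM2r// ler_norml; apply/andP; split; have := sqr_ge0 x; nra.
Qed.

Lemma normal_variance_pdf : \int[mu]_x (x ^+ 2 * p x) = s ^+ 2.
Proof.
have dF (x : R) : is_derive x 1 (fun x : R => x * p x) (p x - (s ^+ 2)^-1 * (x ^+ 2 * p x)).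
  have := is_derive_normal_pdf x => dp.
  apply: is_derive_eq; rewrite /GRing.scale/= mulr1; field.
  exact: s0.
have ip2 : intg mu (fun x => p x - (s ^+ 2)^-1 * (x ^+ 2 * p x)).
  by apply: intgB => //; apply: intgZ; exact: intg_sqr_normal_pdf.
have := @Rint_deriv_eq0 _ _ (pk * (s ^+ 2 *+ 2)) dF _ ip2 _.
rewrite RintB//; last by apply: intgZ; exact: intg_sqr_normal_pdf.
rewrite RintZ; last exact: intg_sqr_normal_pdf.
have -> : \int[mu]_x p x = 1 by rewrite /Rintegral integral_normal_pdf.
move=> h; apply/eqP; rewrite -subr_eq0; apply/eqP.
have cp := @continuous_normal_pdf R 0 s s0.
have {}h : 1 - (s ^+ 2)^-1 * \int[mu]_x (x ^+ 2 * p x) = 0.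
  apply: h.
    move=> x; apply: cvgB; first exact: cp.
    apply: cvgM; first exact: cvg_cst.
    apply: cvgM; last exact: cp.
    exact: exprn_continuous.
  move=> x; rewrite -normrM mulrA -expr2 ger0_norm ?(mulr_ge0 (sqr_ge0 x) (p0 x))//.
  exact: sqr_normal_pdf_le.
have -> : \int[mu]_x (x ^+ 2 * p x) =
    s ^+ 2 - s ^+ 2 * (1 - (s ^+ 2)^-1 * \int[mu]_x (x ^+ 2 * p x)).
  by field.
by rewrite h mulr0 subr0 subrr.
Qed.

Variable th : R.

Let mcos (t : R) : measurable_fun setT (fun x : R => cos (th + t * x)).
Proof.
apply: measurableT_comp; last by apply: measurable_funD => //; exact: measurable_funM.
by apply: continuous_measurable_fun; exact: continuous_cos.
Qed.

Let msin (t : R) : measurable_fun setT (fun x : R => sin (th + t * x)).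
Proof.
apply: measurableT_comp; last by apply: measurable_funD => //; exact: measurable_funM.
by apply: continuous_measurable_fun; exact: continuous_sin.
Qed.

Let normcos (x : R) : `|cos x| <= 1.
Proof. by rewrite ler_norml cos_le1 cos_geN1. Qed.

Let normsin (x : R) : `|sin x| <= 1.
Proof. by rewrite ler_norml sin_le1 sin_geN1. Qed.

Let icos t : intg mu (fun x => cos (th + t * x) * p x).
Proof.
apply: intg_le ip _; first exact: (measurable_funM (mcos _) mp).
by move=> x; rewrite normrM (ger0_norm (p0 x)) ler_piMl ?normcos ?normsin ?normr_ge0 ?p0.
Qed.

Let isin t : intg mu (fun x => sin (th + t * x) * p x).
Proof.
apply: intg_le ip _; first exact: (measurable_funM (msin _) mp).
by move=> x; rewrite normrM (ger0_norm (p0 x)) ler_piMl ?normcos ?normsin ?normr_ge0 ?p0.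
Qed.

Let ixsin t : intg mu (fun x => sin (th + t * x) * (x * p x)).
Proof.
apply: intg_le (intg_abs intg_id_normal_pdf) _.
  by apply: (measurable_funM (msin _)); exact: measurable_funM.
by move=> x; rewrite normrM ler_piMl ?normcos ?normsin ?normr_ge0 ?p0.
Qed.

Let h t := \int[mu]_x (cos (th + t * x) * p x).

Let by_parts t : \int[mu]_x (sin (th + t * x) * (x * p x)) = s ^+ 2 * t * h t.
Proof.
have dF (x : R) : is_derive x 1 (fun x : R => sin (th + t * x) * p x)
    (t * (cos (th + t * x) * p x) - (s ^+ 2)^-1 * (sin (th + t * x) * (x * p x))).
  have := is_derive_normal_pdf x => dp.
  apply: is_derive_eq; rewrite /GRing.scale/= mulr1; field.
  exact: s0.
have ii : intg mu (fun x => t * (cos (th + t * x) * p x) - (s ^+ 2)^-1 * (sin (th + t * x) * (x * p x))).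
  by apply: intgB; exact: intgZ.
have := @Rint_deriv_eq0 _ _ (pk * (s ^+ 2 *+ 2) + pk) dF _ ii _.
rewrite RintB; [|exact: intgZ|exact: intgZ].
rewrite RintZ// RintZ//.
have cp := @continuous_normal_pdf R 0 s s0.
have ct : continuous (fun x : R => th + t * x).
  by move=> x; apply: cvgD; [exact: cvg_cst|exact: mulrl_continuous].
move=> H.
have {}H : t * h t - (s ^+ 2)^-1 * \int[mu]_x (sin (th + t * x) * (x * p x)) = 0.
  apply: H.
    move=> x; apply: cvgB.
      apply: cvgM; first exact: cvg_cst.
      apply: cvgM; last exact: cp.
      by apply: (continuous_comp (ct x)); exact: continuous_cos.
    apply: cvgM; first exact: cvg_cst.
    apply: cvgM; last by apply: cvgM; [exact: cvg_id|exact: cp].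
    by apply: (continuous_comp (ct x)); exact: continuous_sin.
  move=> x; rewrite normrM mulrCA; apply: (@le_trans _ _ (`|x| * `|p x|)).
    by rewrite ler_piMl ?normsin// mulr_ge0.
  rewrite (ger0_norm (p0 x)) (@le_trans _ _ ((x ^+ 2 + 1) * p x))//.
    rewrite ler_wpM2r// ler_norml; apply/andP; split; have := sqr_ge0 x; nra.
  by rewrite mulrDl mul1r lerD// ?sqr_normal_pdf_le// normal_pdf_le.
have -> : \int[mu]_x (sin (th + t * x) * (x * p x)) = s ^+ 2 * t * h t -
    s ^+ 2 * (t * h t - (s ^+ 2)^-1 * \int[mu]_x (sin (th + t * x) * (x * p x))).
  by field.
by rewrite H mulr0 subr0.
Qed.

Let dcos (a x : R) : is_derive a 1 (fun t : R => cos (th + t * x) * p x) (- (sin (th + a * x) * (x * p x))).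
Proof.
apply: is_derive_eq; rewrite /GRing.scale/=. ring.
Qed.

Let dh (a : R) : is_derive a 1 h (- (s ^+ 2 * a * h a)).
Proof.
have Ia : `]a - 1, a + 1[%classic a by rewrite /= in_itv/= ltrDl ltrBlDr ltrDl ltr01.
have H1 x : `]a - 1, a + 1[%classic x -> mu.-integrable setT (EFin \o (fun y => cos (th + x * y) * p y)).
  by move=> _; exact: icos.
have H2 (x y : R) : `]a - 1, a + 1[%classic x -> [set: R] y ->
    derivable ((fun t y : R => cos (th + t * y) * p y) ^~ y) x 1.
  by move=> _ _; case: (dcos x y).
have d1 (x y : R) : partial1of2 (fun t y : R => cos (th + t * y) * p y) x y = - (sin (th + x * y) * (y * p y)).
  by rewrite partial1of2E; case: (dcos x y).
have H3 (x y : R) : `]a - 1, a + 1[%classic x -> [set: R] y ->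
    `|partial1of2 (fun t y : R => cos (th + t * y) * p y) x y| <= `|y * p y|.
  by move=> _ _; rewrite d1 normrN normrM ler_piMl ?normcos ?normsin ?normr_ge0 ?p0.
have G0 (y : R) : 0 <= `|y * p y| by [].
have iG := intg_abs intg_id_normal_pdf.
split; first exact: (derivable_under_integral measurableT Ia H1 H2 G0 iG H3).
rewrite -derive1E (differentiation_under_integral measurableT Ia H1 H2 G0 iG H3).
rewrite -by_parts; under eq_Rintegral do rewrite d1 -mulN1r.
by rewrite RintZ// mulN1r.
Qed.

Lemma normal_cos_pdf t :
  \int[mu]_x (cos (th + t * x) * p x) = cos th * expR (- (t ^+ 2 * s ^+ 2 / 2)).
Proof.
have dk (a : R) : is_derive a 1 (fun t => h t * expR (t ^+ 2 * (s ^+ 2 / 2))) 0.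
  have := dh a => ?.
  apply: is_derive_eq; rewrite /GRing.scale/=. by field.
have := @is_derive_0_is_cst R _ t 0 dk.
rewrite expr0n mul0r expR0 mulr1.
have -> : h 0 = cos th.
  rewrite /h; under eq_Rintegral do rewrite mul0r addr0.
  rewrite RintZ//; by rewrite /Rintegral integral_normal_pdf mulr1.
move=> <-; rewrite -[RHS]mulrA -expRD.
rewrite (_ : t ^+ 2 * (s ^+ 2 / 2) + - (t ^+ 2 * s ^+ 2 / 2) = 0) ?expR0 ?mulr1//.
by field.
Qed.

End normal_integrals.

Section normal_prob_integrals.
Context {R : realType}.
Variables (s : R) (s0 : s != 0).
Local Notation N := (normal_prob 0 s).
Local Notation p := (normal_pdf 0 s).

Let p0 x : 0 <= p x. Proof. exact: normal_pdf_ge0. Qed.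

Lemma normal_cos th t :
  \int[N]_x cos (th + t * x) = cos th * expR (- (t ^+ 2 * s ^+ 2 / 2)).
Proof.
rewrite -normal_cos_pdf//.
have mc : measurable_fun setT (fun x : R => cos (th + t * x)).
  apply: measurableT_comp; last by apply: measurable_funD => //; exact: measurable_funM.
  by apply: continuous_measurable_fun; exact: continuous_cos.
apply: Rint_density => //.
  exact: measurable_normal_pdf.
apply: (@intg_le _ _ _ lebesgue_measure _ p).
- by apply: measurable_funM => //; exact: measurable_normal_pdf.
- exact: integrable_normal_pdf.
move=> x; rewrite normrM (ger0_norm (p0 x)) ler_piMl//.
by rewrite ler_norml cos_le1 cos_geN1.
Qed.

Lemma normal_sqr : intg N (fun x => x ^+ 2) /\ \int[N]_x (x ^+ 2) = s ^+ 2.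
Proof.
have i2 := intg_sqr_normal_pdf s0.
split.
  apply: (@intg_density _ _ _ lebesgue_measure _ p) => //; exact: measurable_normal_pdf.
rewrite -normal_variance_pdf//; apply: Rint_density => //.
exact: measurable_normal_pdf.
Qed.

End normal_prob_integrals.


Section Rint_fubini.
Context d1 d2 (T1 : measurableType d1) (T2 : measurableType d2) {R : realType}.
Variables (m1 : {sigma_finite_measure set T1 -> \bar R})
          (m2 : {sigma_finite_measure set T2 -> \bar R}).
Variable f : T1 * T2 -> R.
Hypothesis fi : intg (m1 \x m2)%E f.

Lemma intg_fubini1 : intg m1 (fun x => \int[m2]_y f (x, y)).
Proof.
have F : m1.-integrable setT (fun x => \int[m2]_y (f (x, y))%:E)%E.
  exact: (integrable_fubini_F fi).
apply: (@le_integrable _ _ _ m1 _ measurableT _ _ _ _ F).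
  apply/measurable_EFinP; apply: measurableT_comp (measurable_int _ F).
  exact: fine_measurable.
by move=> x _; rewrite /Rintegral/=; case: (\int[m2]_y _)%E => [r||]//=; rewrite normr0 leey.
Qed.

Let integrable_G : m2.-integrable setT (fun y => \int[m1]_x (f (x, y))%:E)%E.
Proof.
have mf := measurable_int _ fi.
apply/integrableP; split; first exact: (measurable_fubini_G fi).
apply: le_lt_trans ((integrable21ltyP _ _ mf).1 fi).
apply: ge0_le_integral => //.
- by apply: measurableT_comp => //; exact: (measurable_fubini_G fi).
- apply: (@measurable_fun_fubini_tonelli_G _ _ _ _ _ m1 (abse \o (EFin \o f))) => //.
    exact: (measurableT_comp _ mf).
  by move=> z /=.
- move=> y _; apply: le_abse_integral => //.
  exact: (measurableT_comp mf).
Qed.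

Lemma intg_fubini2 : intg m2 (fun y => \int[m1]_x f (x, y)).
Proof.
have F : m2.-integrable setT (fun y => \int[m1]_x (f (x, y))%:E)%E.
  exact: integrable_G.
apply: (@le_integrable _ _ _ m2 _ measurableT _ _ _ _ F).
  apply/measurable_EFinP; apply: measurableT_comp (measurable_int _ F).
  exact: fine_measurable.
by move=> x _; rewrite /Rintegral/=; case: (\int[m1]_y _)%E => [r||]//=; rewrite normr0 leey.
Qed.

Let fin_ae d (T : measurableType d) (m : {measure set T -> \bar R}) (F : T -> \bar R) :
  m.-integrable setT F -> (\int[m]_x F x = \int[m]_x (fine (F x))%:E)%E.
Proof.
move=> iF; apply: ae_eq_integral => //.
- exact: measurable_int iF.
- apply/measurable_EFinP; apply: measurableT_comp (measurable_int _ iF).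
  exact: fine_measurable.
- by have := integrable_ae measurableT iF; apply: filterS => x /= h _; rewrite fineK ?h.
Qed.

Lemma Rint_fubini1 : \int[m1]_x \int[m2]_y f (x, y) = \int[(m1 \x m2)%E]_z f z.
Proof.
rewrite [RHS]/Rintegral -(integral12_prod_meas1 fi) [LHS]/Rintegral; congr fine.
by rewrite [RHS]fin_ae//; exact: (integrable_fubini_F fi).
Qed.

Lemma Rint_fubini2 : \int[m2]_y \int[m1]_x f (x, y) = \int[(m1 \x m2)%E]_z f z.
Proof.
rewrite [RHS]/Rintegral -(integral21_prod_meas1 fi) [LHS]/Rintegral; congr fine.
by rewrite [RHS]fin_ae//; exact: integrable_G.
Qed.

Lemma Rint_fubini :
  \int[m1]_x \int[m2]_y f (x, y) = \int[m2]_y \int[m1]_x f (x, y).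
Proof. by rewrite Rint_fubini1 -Rint_fubini2. Qed.

End Rint_fubini.

Lemma intg_prod_bounded d1 d2 (T1 : measurableType d1) (T2 : measurableType d2)
    {R : realType} (m1 : {finite_measure set T1 -> \bar R})
    (m2 : {finite_measure set T2 -> \bar R}) (f : T1 * T2 -> R) (K : R) :
  measurable_fun setT f -> (forall z, `|f z| <= K) -> intg (m1 \x m2)%E f.
Proof.
move=> mf fK; apply: (@intg_le _ _ _ _ _ (cst K)) => //.
apply/integrableP; split; first exact/measurable_EFinP.
rewrite /= integral_cst//= -setXTT product_measure1E//.
by rewrite lte_mul_pinfty// ?lte_mul_pinfty ?ge0_fin_numE// fin_num_fun_lty//; exact: fin_num_measure.
Qed.

Section restricted_measure.
Context d (T : measurableType d) {R : realType}.
Variables (mu : {measure set T -> \bar R}) (D : set T).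
Hypotheses (mD : measurable D) (Doo : (mu D < +oo)%E).
Local Notation muD := (mfrestr mD Doo).

Let muDE A : measurable A -> muD A = (\int[mu]_(x in A) (\1_D x)%:E)%E.
Proof. by move=> mA; rewrite integral_indic//= setIC. Qed.

Lemma ge0_integral_mfrestr (f : T -> \bar R) : (forall x, 0 <= f x)%E ->
  measurable_fun setT f -> (\int[muD]_x f x = \int[mu]_(x in D) f x)%E.
Proof.
move=> f0 mf; rewrite (@ge0_integral_density _ _ _ mu muD \1_D)//.
rewrite [RHS]integral_mkcond; apply: eq_integral => x _.
by rewrite /= /patch indicE; case: ifPn; rewrite ?mule1 ?mule0.
Qed.

Lemma intg_mfrestr (f : T -> R) : measurable_fun setT f ->
  mu.-integrable D (EFin \o f) -> intg muD f.
Proof.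
move=> mf /integrableP[_ fi]; apply/integrableP; split.
  exact/measurable_EFinP.
rewrite ge0_integral_mfrestr//.
by apply: measurableT_comp => //; exact/measurable_EFinP.
Qed.

Lemma Rint_mfrestr (f : T -> R) : measurable_fun setT f ->
  \int[muD]_x f x = \int[mu]_(x in D) f x.
Proof.
move=> mf; have mfE : measurable_fun setT (EFin \o f) by exact/measurable_EFinP.
rewrite /Rintegral; congr fine; rewrite integralE [RHS]integralE.
congr (_ - _)%E; rewrite ge0_integral_mfrestr//.
  exact: measurable_funepos.
exact: measurable_funeneg.
Qed.

End restricted_measure.

Definition wmean {R : realType} d (T : measurableType d) (P : probability T R)
    d' (U : measurableType d') (C : T -> R) (Y : T -> U) (f : U -> R) : R :=
  \int[P]_w (C w * f (Y w)).

Section uniqueness_steps.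
Context {R : realType} d (T : measurableType d) (P : probability T R).
Variables (C Y : T -> R) (K : R).
Hypotheses (mC : measurable_fun setT C) (mY : measurable_fun setT Y).
Hypothesis CK : forall w, `|C w| <= K.

Local Notation wmean := (wmean P C Y).

Hypothesis K0 : 0 <= K.

Let ind_le (A : set R) x : `|\1_A x| <= 1 :> R.
Proof. by rewrite indicE; case: (_ \in _); rewrite ?normr0 ?normr1. Qed.

Lemma intg_wmean (f : R -> R) M : measurable_fun setT f -> (forall x, `|f x| <= M) ->
  intg P (fun w => C w * f (Y w)).
Proof.
move=> mf fM; apply: (@intg_bounded _ _ _ P _ (K * M)).
  by apply: measurable_funM => //; exact: measurableT_comp.
by move=> w; rewrite normrM ler_pM.
Qed.

Lemma wmean_bump s a : s != 0 ->
  wmean (fun y => expR (- ((y - a) ^+ 2 * s ^+ 2 / 2))) =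
  \int[normal_prob 0 s]_t wmean (fun y => cos (- (t * a) + t * y)).
Proof.
move=> s0.
pose f z := C z.1 * cos (- (z.2 * a) + z.2 * Y z.1) : R.
have fi : intg (P \x normal_prob 0 s)%E f.
  apply: (@intg_prod_bounded _ _ _ _ _ P (normal_prob 0 s) _ K).
    apply: measurable_funM; first exact: measurableT_comp.
    apply: (measurableT_comp (continuous_measurable_fun (@continuous_cos R))).
    apply: measurable_funD.
      by apply: measurable_funN; exact: measurable_funM.
    by apply: measurable_funM => //; exact: measurableT_comp.
  by move=> z; rewrite normrM -[K]mulr1 ler_pM// ler_norml cos_le1 cos_geN1.
have := Rint_fubini fi; rewrite /wmean => <-.
apply: eq_Rintegral => w _; rewrite /f/=.
rewrite RintZ; last first.
  apply: (@intg_bounded _ _ _ (normal_prob 0 s) _ 1).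
    apply: (measurableT_comp (continuous_measurable_fun (@continuous_cos R))).
    apply: measurable_funD; last exact: measurable_funM.
    by apply: measurable_funN; exact: measurable_funM.
  by move=> x; rewrite ler_norml cos_le1 cos_geN1.
congr (_ * _).
transitivity (\int[normal_prob 0 s]_t cos (0 + (Y w - a) * t)).
  by rewrite normal_cos// cos0 mul1r.
by apply: eq_Rintegral => t _; congr cos; ring.
Qed.

Lemma wmean_set1 a :
  (fun n => wmean (fun y => expR (- ((y - a) ^+ 2 * n.+1%:R ^+ 2 / 2)))) @ \oo -->
  wmean \1_([set a]).
Proof.
apply: (@Rint_dct _ _ _ P (fun n w => C w * expR (- ((Y w - a) ^+ 2 * n.+1%:R ^+ 2 / 2))) _
   (fun w => K)).
- move=> n; apply: measurable_funM => //; apply: measurableT_comp => //.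
  apply: measurable_funN; apply: measurable_funM => //; apply: measurable_funM => //.
  by apply: measurable_funX; exact: measurable_funB.
- apply: measurable_funM => //.
  by apply: (measurableT_comp (measurable_indic _)) => //; exact: measurable_set1.
- exact: finite_measure_integrable_cst.
- apply: aeW => w; apply: cvgM; first exact: cvg_cst.
  have [ya|ya] := eqVneq (Y w) a.
    rewrite ya indicE mem_set//=.
    under eq_fun do rewrite subrr expr0n !mul0r oppr0 expR0.
    exact: cvg_cst.
  rewrite indicE memNset//=; last by move=> /eqP; rewrite (negbTE ya).
  set c := (Y w - a) ^+ 2 / 2.
  have c0 : 0 < c by rewrite divr_gt0// exprn_even_gt0//= subr_eq0.
  have : (fun n => c^-1 * n.+1%:R^-1) @ \oo --> c^-1 * (0 : R).
    by apply: cvgM; [exact: cvg_cst|exact: cvg_harmonic].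
  rewrite mulr0; apply: squeeze_cvgr (cvg_cst 0).
  near=> n; have cn : 0 < c * n.+1%:R by rewrite mulr_gt0.
  rewrite expR_ge0/= expRN -invfM lef_pV2 ?posrE ?expR_gt0//.
  have -> : (Y w - a) ^+ 2 * n.+1%:R ^+ 2 / 2 = c * n.+1%:R ^+ 2 by rewrite /c; ring.
  apply: (@le_trans _ _ (c * n.+1%:R ^+ 2)).
    by rewrite ler_pM2l// expr2 ler_peMr// ler1n.
  by have := expR_ge1Dx (c * n.+1%:R ^+ 2); lra.
- move=> n w; rewrite normrM -[K]mulr1 ler_pM// ger0_norm ?expR_ge0//.
  by rewrite -[leRHS]expR0 ler_expR oppr_le0 divr_ge0// mulr_ge0// sqr_ge0.
Unshelve. all: by end_near. Qed.


Section window.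
Variables a b : R.
Hypothesis ab : a < b.
Local Notation mu := (@lebesgue_measure R).
Let I : set (measurableTypeR R) := `]a, b[%classic.
Let mI : measurable I. Proof. exact: measurable_itv. Qed.
Let Ioo : (mu I < +oo)%E.
Proof. by rewrite /I lebesgue_measure_itv/=; case: ifP; rewrite ?ltry. Qed.
Local Notation muI := (mfrestr mI Ioo).

Definition window s y : R := fine (normal_prob y s I).

Lemma windowE s y : window s y = \int[muI]_t normal_pdf y s t.
Proof. by rewrite Rint_mfrestr//; exact: measurable_normal_pdf. Qed.

Let pdfE (s y t : R) : s != 0 ->
  normal_pdf y s t = normal_peak s * expR (- ((y - t) ^+ 2 * s^-1 ^+ 2 / 2)).
Proof.
by move=> s0; rewrite normal_pdfE// /normal_fun; congr (_ * expR _); field.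
Qed.

Let bump_le1 (y s t : R) : `|expR (- ((y - t) ^+ 2 * s ^+ 2 / 2))| <= 1 :> R.
Proof.
rewrite ger0_norm ?expR_ge0// -[leRHS]expR0 ler_expR oppr_le0 divr_ge0//.
by rewrite mulr_ge0// sqr_ge0.
Qed.

Let mbump2 d1 (T1 : measurableType d1) (u v : T1 -> R) (s : R) :
  measurable_fun setT u -> measurable_fun setT v ->
  measurable_fun setT (fun z => expR (- ((u z - v z) ^+ 2 * s ^+ 2 / 2))).
Proof.
move=> mu' mv; apply: measurableT_comp => //.
apply: measurable_funN; apply: measurable_funM => //; apply: measurable_funM => //.
by apply: measurable_funX; exact: measurable_funB.
Qed.

Lemma measurable_window s : s != 0 -> measurable_fun setT (window s).
Proof.
move=> s0; pose f (z : R * R) := normal_peak s * expR (- ((z.1 - z.2) ^+ 2 * s^-1 ^+ 2 / 2)).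
have h : intg (normal_prob 0 1 \x muI)%E f.
  apply: (@intg_prod_bounded _ _ _ _ _ _ _ _ (normal_peak s)).
    by apply: measurable_funM => //; exact: mbump2.
  by move=> z; rewrite normrM ger0_norm ?normal_peak_ge0// ler_piMr// normal_peak_ge0.
have := intgP (intg_fubini1 h); congr measurable_fun; apply/funext => y.
by rewrite windowE; apply: eq_Rintegral => t _; rewrite /f pdfE.
Qed.

Lemma wmean_window s : s != 0 -> wmean (window s) =
  \int[muI]_t (normal_peak s * wmean (fun y => expR (- ((y - t) ^+ 2 * s^-1 ^+ 2 / 2)))).
Proof.
move=> s0; pose f z := normal_peak s * (C z.1 * expR (- ((Y z.1 - z.2) ^+ 2 * s^-1 ^+ 2 / 2))) : R.
have fi : intg (P \x muI)%E f.
  apply: (@intg_prod_bounded _ _ _ _ _ P muI _ (normal_peak s * K)).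
    apply: measurable_funM => //; apply: measurable_funM.
      exact: measurableT_comp.
    by apply: mbump2 => //; exact: measurableT_comp.
  move=> z; rewrite normrM (ger0_norm (normal_peak_ge0 _)) ler_wpM2l ?normal_peak_ge0//.
  by rewrite normrM -[K]mulr1 ler_pM.
have mb w : measurable_fun setT (fun t : R => expR (- ((Y w - t) ^+ 2 * s^-1 ^+ 2 / 2))).
  exact: mbump2.
transitivity (\int[P]_w \int[muI]_t f (w, t)).
  apply: eq_Rintegral => w _; rewrite windowE -RintZ; last first.
    apply: (@intg_bounded _ _ _ muI _ (normal_peak s)).
      exact: measurable_normal_pdf.
    by move=> x; rewrite pdfE// normrM ger0_norm ?normal_peak_ge0// ler_piMr// normal_peak_ge0.
  by apply: eq_Rintegral => t _; rewrite /f/= pdfE// mulrCA.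
rewrite (Rint_fubini fi); apply: eq_Rintegral => t _.
rewrite -RintZ//.
apply: (@intg_wmean (fun y => expR (- ((y - t) ^+ 2 * s^-1 ^+ 2 / 2))) 1) => //.
exact: mbump2.
Qed.

Let peak2 (s : R) : normal_peak (s * 2) = normal_peak s / 2.
Proof.
rewrite /normal_peak -invfM; congr (_^-1).
have -> : (s * 2) ^+ 2 * pi *+ 2 = (s ^+ 2 * pi *+ 2) * 2 ^+ 2 :> R by ring.
have h : 0 <= s ^+ 2 * pi *+ 2 by rewrite mulrn_wge0// mulr_ge0 ?sqr_ge0 ?pi_ge0.
by rewrite sqrtrM// sqrtr_sqr ger0_norm.
Qed.

Let normal_tail (s y : R) (A : set (measurableTypeR R)) (del : R) : s != 0 -> 0 < del -> measurable A ->
  (forall t, A t -> del <= `|t - y|) ->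
  fine (normal_prob y s A) <= 2 / (1 + 3 * del ^+ 2 / (8 * s ^+ 2)).
Proof.
move=> s0 d0 mA Ad.
have s20 : s * 2 != 0 by rewrite mulf_neq0.
have ss : 0 < s ^+ 2 by rewrite exprn_even_gt0.
set u := 3 * _ / _.
have u0 : 0 < u by apply: divr_gt0; apply: mulr_gt0 => //; exact: exprn_gt0.
set c := 2 / _.
have c0 : 0 <= c by rewrite divr_ge0// addr_ge0// ltW.
have h t : A t -> normal_pdf y s t <= c * normal_pdf y (s * 2) t.
  move=> At; rewrite normal_pdfE// (normal_pdfE _ s20)/= peak2 [leRHS]mulrA [c * _]mulrCA.
  have -> : normal_peak s * (c / 2) = normal_peak s * (1 + u)^-1.
    by rewrite /c; field; rewrite gt_eqF// addr_gt0.
  rewrite /normal_fun -[leRHS]mulrA ler_pM2l ?normal_peak_gt0//.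
  have -> : - (t - y) ^+ 2 / (s ^+ 2 *+ 2) =
     - (3 * (t - y) ^+ 2 / (8 * s ^+ 2)) + - (t - y) ^+ 2 / ((s * 2) ^+ 2 *+ 2) by field.
  rewrite expRD ler_wpM2r ?expR_ge0// expRN lef_pV2 ?posrE ?expR_gt0 ?addr_gt0//.
  apply: le_trans (expR_ge1Dx _); rewrite lerD2l /u ler_pM2r; last by rewrite invr_gt0 mulr_gt0.
  rewrite ler_pM2l// -[leRHS](real_normK (num_real _)).
  by apply: lerXn2r; rewrite ?nnegrE ?(ltW d0)//; exact: Ad.
have fn : normal_prob y s A \is a fin_num by exact: fin_num_measure.
rewrite -lee_fin fineK//.
apply: (@le_trans _ _ (\int[mu]_(t in A) (c%:E * (normal_pdf y (s * 2) t)%:E))%E).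
  apply: ge0_le_integral => //.
  - by move=> t _; rewrite lee_fin normal_pdf_ge0.
  - by apply/measurable_EFinP; apply: measurable_funTS; exact: measurable_normal_pdf.
  - apply/measurable_EFinP; apply: measurable_funTS; apply: measurable_funM => //.
    exact: measurable_normal_pdf.
rewrite ge0_integralZl//; last 2 first.
- by apply/measurable_EFinP; apply: measurable_funTS; exact: measurable_normal_pdf.
- by move=> t _; rewrite lee_fin normal_pdf_ge0.
rewrite -[leRHS]mule1; apply: lee_wpmul2l; first by rewrite lee_fin.
exact: (@probability_le1 _ _ _ (normal_prob y (s * 2))).
Qed.

Let tail_cvg (del : R) : 0 < del ->
  (fun n : nat => 2 / (1 + 3 * del ^+ 2 / (8 * n.+1%:R^-1 ^+ 2))) @ \oo --> (0 : R).
Proof.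
move=> d0; pose k := 3 * del ^+ 2 / 8.
have k0 : 0 < k by apply: divr_gt0 => //; apply: mulr_gt0 => //; exact: exprn_gt0.
have : (fun n => 2 / k * n.+1%:R^-1) @ \oo --> 2 / k * (0 : R).
  by apply: cvgM; [exact: cvg_cst|exact: cvg_harmonic].
rewrite mulr0; apply: squeeze_cvgr (cvg_cst 0).
near=> n.
have -> : 3 * del ^+ 2 / (8 * n.+1%:R^-1 ^+ 2) = k * n.+1%:R ^+ 2 by rewrite /k; field.
have n0 : 0 < n.+1%:R :> R by [].
have kn : 0 < k * n.+1%:R by rewrite mulr_gt0.
have kn2 : k * n.+1%:R <= k * n.+1%:R ^+ 2 by rewrite ler_pM2l// expr2 ler_peMr// ler1n.
rewrite divr_ge0//=; last by lra.
rewrite -mulrA ler_pM2l// -invfM lef_pV2 ?posrE//; lra.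
Unshelve. all: by end_near. Qed.

Lemma cvg_window y : y != a -> y != b ->
  (fun n => window n.+1%:R^-1 y) @ \oo --> (\1_I y : R).
Proof.
move=> ya yb.
have s0 (n : nat) : n.+1%:R^-1 != 0 :> R by [].
pose del := Num.min `|y - a| `|y - b|.
have d0 : 0 < del by rewrite lt_min !normr_gt0 !subr_eq0 ya.
have [yI|yI] := boolP (y \in I).
- rewrite indicE yI /=; have {yI} := set_mem yI; rewrite /I /= in_itv/= => /andP[ay yb'].
  have : (fun n : nat => 1 - 2 / (1 + 3 * del ^+ 2 / (8 * n.+1%:R^-1 ^+ 2))) @ \oo --> (1 - 0 : R).
    by apply: cvgB; [exact: cvg_cst|exact: tail_cvg].
  rewrite subr0 => h. apply: (squeeze_cvgr _ h); last exact: cvg_cst.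
  near=> n; apply/andP; split; last first.
    rewrite -lee_fin /window fineK ?fin_num_measure//.
    exact: (@probability_le1 _ _ _ (normal_prob y _)).
  have mCI : measurable (~` I) by exact: measurableC.
  rewrite lerBlDr -lerBlDl.
  apply: le_trans (@normal_tail _ y _ _ (s0 n) d0 mCI _).
    have E := @probability_setC _ _ _ (normal_prob y n.+1%:R^-1) _ mI.
    have fI : normal_prob y n.+1%:R^-1 I \is a fin_num by exact: fin_num_measure.
    have aux (x : \bar R) : x \is a fin_num -> fine (1 - x)%E = 1 - fine x by case: x.
    by rewrite E /window aux.
  move=> t; rewrite /I /= in_itv/= => /negP; rewrite negb_and -!leNgt => /orP[ta|bt].
    rewrite ge_min (distrC t) [X in X || _](_ : _ = true)//.
    by rewrite !ger0_norm; lra.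
  rewrite ge_min (distrC y b) [X in _ || X](_ : _ = true) ?orbT//.
  by rewrite !ger0_norm; lra.
- rewrite indicE (negbTE yI) /=; apply: (squeeze_cvgr _ _ (tail_cvg d0)); last exact: cvg_cst.
  near=> n; rewrite fine_ge0//=.
  apply: normal_tail => // t; rewrite /I /= in_itv/= => /andP[at_ tb].
  move: yI; rewrite notin_setE /I /= in_itv/= => /negP.
  rewrite negb_and -!leNgt => /orP[ya'|by_].
    rewrite ge_min (distrC y) [X in X || _](_ : _ = true)//.
    by rewrite !ger0_norm; lra.
  rewrite ge_min (distrC t) [X in _ || X](_ : _ = true) ?orbT//.
  by rewrite !ger0_norm; lra.
Unshelve. all: by end_near. Qed.

Let window_le1 (s y : R) : `|window s y| <= 1.
Proof.
rewrite ger0_norm ?fine_ge0// -lee_fin /window fineK ?fin_num_measure//.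
exact: (@probability_le1 _ _ _ (normal_prob y _)).
Qed.

Lemma cvg_wmean_window :
  (fun n => wmean (window n.+1%:R^-1) -
     window n.+1%:R^-1 a * wmean \1_[set a] - window n.+1%:R^-1 b * wmean \1_[set b])
    @ \oo --> wmean \1_I.
Proof.
have s0 (n : nat) : n.+1%:R^-1 != 0 :> R by [].
pose g n y : R := window n.+1%:R^-1 y - window n.+1%:R^-1 a * \1_[set a] y -
    window n.+1%:R^-1 b * \1_[set b] y.
have m1 (c : R) : measurable_fun setT (\1_[set c] : R -> R).
  by apply: measurable_indic; exact: measurable_set1.
have mg n : measurable_fun setT (g n).
  apply: measurable_funB; last exact: measurable_funM.
  by apply: measurable_funB; [exact: measurable_window|exact: measurable_funM].
have gE n : wmean (window n.+1%:R^-1) -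
     window n.+1%:R^-1 a * wmean \1_[set a] - window n.+1%:R^-1 b * wmean \1_[set b] =
     wmean (g n).
  have i1 c : intg P (fun w => C w * \1_[set c] (Y w)) by exact: (@intg_wmean _ 1).
  have iw : intg P (fun w => C w * window n.+1%:R^-1 (Y w)).
    by apply: (@intg_wmean _ 1) => //; exact: measurable_window.
  rewrite /wmean -RintZ// -RintZ// -RintB//; last exact: intgZ.
  rewrite -RintB//; last 2 first.
  - by apply: intgB => //; exact: intgZ.
  - exact: intgZ.
  by apply: eq_Rintegral => w _; rewrite /g; ring.
rewrite (funext gE).
have gbd n y : `|g n y| <= 3.
  apply: le_trans (ler_normB _ _) _; apply: (@le_trans _ _ (2 + 1)); last by lra.
  apply: lerD; last by rewrite normrM mulr_ile1.
  apply: le_trans (ler_normB _ _) _; apply: (@le_trans _ _ (1 + 1)); last by lra.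
  by apply: lerD => //; rewrite normrM mulr_ile1.
apply: (@Rint_dct _ _ _ P (fun n w => C w * g n (Y w)) _ (fun w => K * 3)).
- by move=> n; apply: measurable_funM => //; exact: measurableT_comp.
- by apply: measurable_funM => //; apply: measurableT_comp => //; exact: measurable_indic.
- exact: finite_measure_integrable_cst.
- apply: aeW => w; apply: cvgM; first exact: cvg_cst.
  have aI : (a \in I) = false by apply/memNset; rewrite /I /= in_itv/= ltxx.
  have bI : (b \in I) = false by apply/memNset; rewrite /I /= in_itv/= ltxx andbF.
  have s1 (x y : R) : \1_[set x] y = (y == x)%:R :> R.
    rewrite indicE; congr (_%:R); congr nat_of_bool.
    by apply/idP/eqP => [/set_mem //|->]; exact: mem_set.
  have [ya|ya] := eqVneq (Y w) a.
    rewrite ya /g (indicE _ I) aI; under eq_fun do rewrite !s1 eqxx (lt_eqF ab) mulr1 subrr mulr0 subr0.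
    exact: cvg_cst.
  have [yb|yb] := eqVneq (Y w) b.
    rewrite yb /g (indicE _ I) bI; under eq_fun do rewrite !s1 eqxx (gt_eqF ab) mulr1 mulr0 subr0 subrr.
    exact: cvg_cst.
  rewrite /g; under eq_fun do rewrite !s1 (negbTE ya) (negbTE yb) !mulr0 !subr0.
  exact: cvg_window.
- by move=> n w; rewrite normrM ler_pM.
Qed.

End window.

End uniqueness_steps.


Section wmean_sets.
Context {R : realType} d (T : measurableType d) (P : probability T R).
Context d' (U : measurableType d').
Variables (C : T -> R) (Y : T -> U) (K : R).
Hypotheses (mC : measurable_fun setT C) (mY : measurable_fun setT Y).
Hypothesis CK : forall w, `|C w| <= K.
Local Notation wmean := (wmean P C Y).

Let ind_le (A : set U) (x : U) : `|\1_A x| <= 1 :> R.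
Proof. by rewrite indicE; case: (_ \in _); rewrite ?normr0 ?normr1. Qed.

Lemma intg_wmean_indic (A : set U) : measurable A ->
  intg P (fun w => C w * \1_A (Y w)).
Proof.
move=> mA; apply: (@intg_bounded _ _ _ P _ K).
  by apply: measurable_funM => //; apply: measurableT_comp => //; exact: measurable_indic.
by move=> w; rewrite normrM -[K]mulr1 ler_pM.
Qed.

Lemma wmean_setC (A : set U) : measurable A ->
  wmean \1_(~` A) = wmean (cst 1) - wmean \1_A.
Proof.
move=> mA; rewrite /wmean -RintB//; last exact: intg_wmean_indic.
  apply: eq_Rintegral => w _; rewrite -mulrBr; congr (_ * _).
  by rewrite !indicE in_setC; case: (_ \in _); rewrite /= ?subr0 ?subrr.
by apply: (@intg_bounded _ _ _ P _ K) => [|w]; rewrite ?mulr1//; under eq_fun do rewrite mulr1.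
Qed.

Lemma wmean_setU (A B : set U) : measurable A -> measurable B -> A `&` B = set0 ->
  wmean \1_(A `|` B) = wmean \1_A + wmean \1_B.
Proof.
move=> mA mB AB; rewrite /wmean -RintD//; [|exact: intg_wmean_indic..].
apply: eq_Rintegral => w _; rewrite -mulrDr; congr (_ * _).
rewrite !indicE in_setU.
have [wA|] := boolP (Y w \in A); have [wB|] := boolP (Y w \in B); rewrite ?addr0 ?add0r//.
have : (A `&` B) (Y w) by split; exact: set_mem.
by rewrite AB.
Qed.

Lemma cvg_wmean_bigcup (F : (set U)^nat) : (forall k, measurable (F k)) ->
  (fun n => wmean \1_(\big[setU/set0]_(k < n) F k)) @ \oo --> wmean \1_(\bigcup_k F k).
Proof.
move=> mF.
apply: (@Rint_dct _ _ _ P (fun n w => C w * \1_(\big[setU/set0]_(k < n) F k) (Y w))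
   _ (fun w => K)).
- move=> n; apply: measurable_funM => //; apply: measurableT_comp => //.
  by apply: measurable_indic; apply: bigsetU_measurable.
- apply: measurable_funM => //; apply: measurableT_comp => //.
  by apply: measurable_indic; exact: bigcupT_measurable.
- exact: finite_measure_integrable_cst.
- apply: aeW => w; apply: cvgM; first exact: cvg_cst.
  apply: cvg_near_cst; have [[k _ Fk]|nF] := pselect ((\bigcup_k F k) (Y w)).
    near=> n; rewrite !indicE mem_set; last first.
      rewrite -bigcup_mkord; exists k => //=.
      by near: n; exact: nbhs_infty_gt.
    by rewrite mem_set//; exists k.
  near=> n; rewrite !indicE memNset; last first.
    by rewrite -bigcup_mkord => -[j _ Fj]; apply: nF; exists j.
  by rewrite memNset.
- by move=> n w; rewrite normrM -[K]mulr1 ler_pM.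
Unshelve. all: by end_near. Qed.

End wmean_sets.

Section uniqueness.
Context {R : realType} d1 (T1 : measurableType d1) (P1 : probability T1 R).
Context d2 (T2 : measurableType d2) (P2 : probability T2 R).
Variables (C1 Y1 : T1 -> R) (C2 Y2 : T2 -> R) (K : R).
Hypotheses (mC1 : measurable_fun setT C1) (mY1 : measurable_fun setT Y1).
Hypotheses (mC2 : measurable_fun setT C2) (mY2 : measurable_fun setT Y2).
Hypotheses (C1K : forall w, `|C1 w| <= K) (C2K : forall w, `|C2 w| <= K).
Hypothesis charE : forall th t,
  wmean P1 C1 Y1 (fun y => cos (th + t * y)) = wmean P2 C2 Y2 (fun y => cos (th + t * y)).

Let bumpE s a : s != 0 ->
  wmean P1 C1 Y1 (fun y => expR (- ((y - a) ^+ 2 * s ^+ 2 / 2))) =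
  wmean P2 C2 Y2 (fun y => expR (- ((y - a) ^+ 2 * s ^+ 2 / 2))).
Proof.
move=> s0; rewrite (wmean_bump P1 mC1 mY1 C1K)// (wmean_bump P2 mC2 mY2 C2K)//.
by apply: eq_Rintegral => t _; exact: charE.
Qed.

Let set1E a : wmean P1 C1 Y1 \1_[set a] = wmean P2 C2 Y2 \1_[set a].
Proof.
have h1 := @wmean_set1 _ _ _ P1 _ _ _ mC1 mY1 C1K a.
have h2 := @wmean_set1 _ _ _ P2 _ _ _ mC2 mY2 C2K a.
have e n : wmean P1 C1 Y1 (fun y => expR (- ((y - a) ^+ 2 * n.+1%:R ^+ 2 / 2))) =
  wmean P2 C2 Y2 (fun y => expR (- ((y - a) ^+ 2 * n.+1%:R ^+ 2 / 2))) by exact: bumpE.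
by move: h1; rewrite (funext e) => h1; exact: (cvg_unique _ h1 h2).
Qed.

Let itvE a b : wmean P1 C1 Y1 \1_(`]a, b[%classic) = wmean P2 C2 Y2 \1_(`]a, b[%classic).
Proof.
have [ab|ba] := ltP a b; last first.
  rewrite set_itv_ge ?bnd_simp -?leNgt//.
  have h0 d (T : measurableType d) (P : probability T R) C (Y : T -> R) : wmean P C Y \1_set0 = 0.
    rewrite /wmean /Rintegral integral0_eq// => w _.
    by rewrite indic0 mulr0.
  by rewrite !h0.
have h1 := @cvg_wmean_window _ _ _ P1 _ _ _ mC1 mY1 C1K _ _ ab.
have h2 := @cvg_wmean_window _ _ _ P2 _ _ _ mC2 mY2 C2K _ _ ab.
suff e n : wmean P1 C1 Y1 (window a b n.+1%:R^-1) -
     window a b n.+1%:R^-1 a * wmean P1 C1 Y1 \1_[set a] -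
     window a b n.+1%:R^-1 b * wmean P1 C1 Y1 \1_[set b] =
     wmean P2 C2 Y2 (window a b n.+1%:R^-1) -
     window a b n.+1%:R^-1 a * wmean P2 C2 Y2 \1_[set a] -
     window a b n.+1%:R^-1 b * wmean P2 C2 Y2 \1_[set b].
  by move: h1; rewrite (funext e) => h1; exact: (cvg_unique _ h1 h2).
rewrite !set1E; congr (_ - _ - _).
have s0 : n.+1%:R^-1 != 0 :> R by [].
rewrite (wmean_window P1 mC1 mY1 C1K)// (wmean_window P2 mC2 mY2 C2K)//.
by apply: eq_Rintegral => t _; rewrite bumpE ?invr_neq0.
Qed.

Theorem wmean_unique (A : set R) : measurable A ->
  wmean P1 C1 Y1 \1_A = wmean P2 C2 Y2 \1_A.
Proof.
have cstE : wmean P1 C1 Y1 (cst 1) = wmean P2 C2 Y2 (cst 1).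
  have e d (T : measurableType d) (P : probability T R) C (Y : T -> R) :
      wmean P C Y (fun y => cos (0 + 0 * y)) = wmean P C Y (cst 1).
    by apply: eq_Rintegral => w _; rewrite mul0r addr0 cos0.
  by rewrite -!e charE.
move=> mA.
have mE : @measurable _ (measurableTypeR R) = <<s RGenOpens.G (R := R) >>.
  exact: RGenOpens.measurableE.
have {mA} : <<s RGenOpens.G (R := R) >> A by rewrite -mE.
move: A; apply: (@dynkin_induction _ (measurableTypeR R)) => //.
- move=> _ _ [a [b ->]] [a' [b' ->]]; exists (Num.max a a'), (Num.min b b').
  apply/seteqP; split => x /=; rewrite !in_itv/= gt_max lt_min.
    by move=> [/andP[-> ->] /andP[-> ->]].
  by move=> /andP[/andP[-> ->] /andP[-> ->]].
- have e d (T : measurableType d) (P : probability T R) C (Y : T -> R) :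
    wmean P C Y \1_setT = wmean P C Y (cst 1) by rewrite indicT.
  by rewrite !e.
- by move=> _ [a [b ->]]; exact: itvE.
- move=> S mS SE; rewrite (wmean_setC P1 mC1 mY1 C1K)// (wmean_setC P2 mC2 mY2 C2K)//.
  by rewrite SE cstE.
- move=> F mF tF FE.
  have h1 := @cvg_wmean_bigcup _ _ _ P1 _ _ _ _ _ mC1 mY1 C1K _ mF.
  have h2 := @cvg_wmean_bigcup _ _ _ P2 _ _ _ _ _ mC2 mY2 C2K _ mF.
  suff e n : wmean P1 C1 Y1 \1_(\big[setU/set0]_(k < n) F k) =
      wmean P2 C2 Y2 \1_(\big[setU/set0]_(k < n) F k).
    by move: h1; rewrite (funext e) => h1; exact: (cvg_unique _ h1 h2).
  elim: n => [|n IH].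
    have h0 d (T : measurableType d) (P : probability T R) C (Y : T -> R) : wmean P C Y \1_set0 = 0.
      rewrite /wmean /Rintegral integral0_eq// => w _.
      by rewrite indic0 mulr0.
    by rewrite !big_ord0 !h0.
  have mS : measurable (\big[setU/set0]_(k < n) F k) by apply: bigsetU_measurable.
  have D0 : \big[setU/set0]_(k < n) F k `&` F n = set0.
    by apply: (@trivIset_bigsetUI _ xpredT) => // i j _ _; exact: tF.
  rewrite !big_ord_recr/=.
  rewrite (wmean_setU P1 mC1 mY1 C1K mS (mF n) D0) (wmean_setU P2 mC2 mY2 C2K mS (mF n) D0).
  by rewrite IH FE.
Qed.

End uniqueness.


Section law.
Context d (T : measurableType d) {R : realType} (P : probability T R).
Context d' (U : measurableType d').
Variables (Y : T -> U) (nu : {measure set U -> \bar R}).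
Hypothesis mY : measurable_fun setT Y.
Hypothesis Ynu : forall A, measurable A -> P (Y @^-1` A) = nu A.

Lemma ge0_integral_law (f : U -> \bar R) : (forall x, 0 <= f x)%E ->
  measurable_fun setT f -> (\int[P]_w f (Y w) = \int[nu]_x f x)%E.
Proof.
move=> f0 mf.
rewrite -(@ge0_integral_pushforward _ _ _ _ _ _ mY P setT f)//.
by apply: eq_measure_integral => A mA _; exact: Ynu.
Qed.

Lemma intg_law (f : U -> R) : measurable_fun setT f -> intg nu f ->
  intg P (fun w => f (Y w)).
Proof.
move=> mf /integrableP[_ fi]; apply/integrableP; split.
  by apply/measurable_EFinP; exact: measurableT_comp.
rewrite (ge0_integral_law (f := abse \o (EFin \o f)))//.
  by move=> x; rewrite /= lee_fin.
by apply: measurableT_comp => //; exact/measurable_EFinP.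
Qed.

Lemma Rint_law (f : U -> R) : measurable_fun setT f ->
  \int[P]_w f (Y w) = \int[nu]_x f x.
Proof.
move=> mf; have mfE : measurable_fun setT (EFin \o f) by exact/measurable_EFinP.
rewrite /Rintegral; congr fine; rewrite integralE [RHS]integralE.
congr (_ - _)%E.
  rewrite -(ge0_integral_law (f := ((EFin \o f)^\+)%E))//; last exact: measurable_funepos.
  by apply: eq_integral => w _; rewrite !funeposE.
rewrite -(ge0_integral_law (f := ((EFin \o f)^\-)%E))//; last exact: measurable_funeneg.
by apply: eq_integral => w _; rewrite !funenegE.
Qed.

End law.

Section gaussian_variable.
Context d (T : measurableType d) {R : realType} (P : probability T R).
Implicit Types Y Z : T -> R.

Definition GV Y := L2 P Y /\ forall th t,
  \int[P]_w cos (th + t * Y w) =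
  cos th * expR (- (t ^+ 2 * \int[P]_w (Y w ^+ 2) / 2)).

Lemma GV_measurable Y : GV Y -> measurable_fun setT Y.
Proof. by case=> -[]. Qed.

Lemma measurable_cos (f : T -> R) : measurable_fun setT f ->
  measurable_fun setT (fun w => cos (f w)).
Proof.
by move=> mf; apply: measurableT_comp => //;
  apply: continuous_measurable_fun; exact: continuous_cos.
Qed.

Lemma norm_cos (x : R) : `|cos x| <= 1.
Proof. by rewrite ler_norml cos_le1 cos_geN1. Qed.

Lemma intg_cos (f : T -> R) : measurable_fun setT f -> intg P (fun w => cos (f w)).
Proof.
by move=> mf; apply: (@intg_bounded _ _ _ P _ 1) => [|w];
  [exact: measurable_cos|exact: norm_cos].
Qed.

Lemma GV0 Y : measurable_fun setT Y -> {ae P, forall w, Y w = 0} -> GV Y.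
Proof.
move=> mY Y0.
have mY2 : measurable_fun setT (fun w => Y w ^+ 2) by exact: measurable_funX.
have e : ae_eq P setT (fun w => Y w ^+ 2) (cst 0).
  by apply: filterS Y0 => w Yw _ /=; rewrite Yw expr0n.
have i2 : \int[P]_w (Y w ^+ 2) = 0.
  by rewrite (ae_eq_Rint mY2 _ e)// /Rintegral integral0.
split.
  split => //; apply/integrableP; split; first exact/measurable_EFinP.
  rewrite (ae_eq_integral (cst 0%E))//; first by rewrite integral0.
    by apply: measurableT_comp => //; exact/measurable_EFinP.
  by apply: filterS Y0 => w Yw _ /=; rewrite Yw /= expr0n normr0.
move=> th t; rewrite i2 mulr0 mul0r oppr0 expR0 mulr1.
have mc : measurable_fun setT (fun w => cos (th + t * Y w)).
  by apply: measurable_cos; apply: measurable_funD => //; exact: measurable_funM.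
rewrite (@ae_eq_Rint _ _ _ _ _ (cst (cos th)))//; last first.
  by apply: filterS Y0 => w Yw _ /=; rewrite Yw mulr0 addr0.
rewrite Rintegral_cst//. rewrite -[RHS]mulr1; congr (_ * _).
  by rewrite -[RHS]/(fine 1%E); congr fine; exact: probability_setT.
Qed.

Lemma GV_normal Y s : s != 0 -> measurable_fun setT Y ->
  (forall A, measurable A -> P (Y @^-1` A) = normal_prob 0 s A) -> GV Y.
Proof.
move=> s0 mY YN; have [i2 e2] := normal_sqr s0.
have mX2 : measurable_fun setT (fun x : R => x ^+ 2) by exact: measurable_funX.
split.
  by split => //; exact: (@intg_law _ _ _ P _ (measurableTypeR R) Y (normal_prob 0 s) mY YN _ mX2 i2).
move=> th t; rewrite (@Rint_law _ _ _ P _ (measurableTypeR R) Y (normal_prob 0 s) mY YN _ mX2) e2 -normal_cos//.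
rewrite -(@Rint_law _ _ _ P _ (measurableTypeR R) Y (normal_prob 0 s) mY YN (fun x => cos (th + t * x)))//.
apply: (measurableT_comp (continuous_measurable_fun (@continuous_cos R))).
by apply: measurable_funD => //; exact: measurable_funM.
Qed.

Lemma centered_gaussian_GV Y : centered_gaussian P Y -> GV Y.
Proof.
move=> [mY [s h]]; have [s0|s0] := eqVneq s 0.
  apply: GV0 => //; exists (Y @^-1` (~` [set 0])); split => //.
  - by rewrite -[X in measurable X]setTI; apply: mY => //; apply: measurableC; exact: measurable_set1.
  - rewrite -[LHS]/(pushforward P Y (~` [set 0])) h; last first.
      by apply: measurableC; exact: measurable_set1.
    by rewrite s0 eqxx diracE memNset//= => /(_ erefl).
apply: (GV_normal s0 mY) => A mA.
by have := h A mA; rewrite (negbTE s0).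
Qed.

Lemma wmean1 d' (U : measurableType d') (Y : T -> U) A : measurable_fun setT Y ->
  measurable A -> wmean P (cst 1) Y \1_A = fine (P (Y @^-1` A)).
Proof.
move=> mY mA; rewrite /wmean /Rintegral.
have mYA : measurable (Y @^-1` A) by rewrite -[X in measurable X]setTI; exact: mY.
rewrite -[in RHS](setIT (_ @^-1` _)) -integral_indic//; congr fine.
by apply: eq_integral => w _; rewrite mul1r !indicE.
Qed.

Lemma GV_law Y : GV Y -> 0 < \int[P]_w (Y w ^+ 2) ->
  forall A, measurable A ->
  P (Y @^-1` A) = normal_prob 0 (Num.sqrt (\int[P]_w (Y w ^+ 2))) A.
Proof.
move=> [[mY iY] cY] v0 A mA; set v := \int[P]_w _ in v0 cY *.
have s0 : Num.sqrt v != 0 by rewrite gt_eqF// sqrtr_gt0.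
pose N := normal_prob 0 (Num.sqrt v).
have mid : measurable_fun [set: measurableTypeR R] (fun x : R => x) by [].
have key : wmean P (cst 1) Y \1_A = wmean N (cst 1) (fun x : R => x) \1_A.
  apply: (@wmean_unique _ _ _ P _ _ N _ _ _ _ 1) => //.
  - by move=> w; rewrite normr1.
  - by move=> w; rewrite normr1.
  - move=> th t; rewrite /wmean.
    under eq_Rintegral do rewrite mul1r; under [RHS]eq_Rintegral do rewrite mul1r.
    by rewrite cY normal_cos// sqr_sqrtr// ltW.
move: key; rewrite wmean1//.
have -> : wmean N (cst 1) (fun x : R => x) \1_A = fine (N A).
  by rewrite /wmean /Rintegral; congr fine;
    under eq_integral do rewrite mul1r; rewrite integral_indic// setIT.
have f1 : P (Y @^-1` A) \is a fin_num.
  by apply: fin_num_measure; rewrite -[X in measurable X]setTI; exact: mY.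
have f2 : N A \is a fin_num by exact: fin_num_measure.
by move=> e; rewrite -(fineK f1) e fineK.
Qed.

End gaussian_variable.


Section boxes.
Context d (T : measurableType d) {R : realType} (P : probability T R).

Lemma cos_mul (a b : R) : cos a * cos b = (cos (a + b) + cos (a - b)) / 2.
Proof. by rewrite cosD cosB; field. Qed.

Lemma measurable_lincomb m (c : nat -> R) (Y : nat -> T -> R) :
  (forall i, measurable_fun setT (Y i)) ->
  measurable_fun setT (fun w => \sum_(i < m) c i * Y i w).
Proof. by move=> mY; apply: measurable_sum => i; exact: measurable_funM. Qed.

Let mind (Z : T -> R) A : measurable_fun setT Z -> measurable A ->
  measurable_fun setT (fun w => \1_A (Z w) : R).
Proof. by move=> mZ mA; apply: (measurableT_comp (measurable_indic mA)). Qed.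

Let ind_le (A : set R) (x : R) : `|\1_A x| <= 1 :> R.
Proof. by rewrite indicE; case: (_ \in _); rewrite ?normr0 ?normr1. Qed.

Lemma weight_eq0 (C Z : T -> R) K : measurable_fun setT C -> (forall w, `|C w| <= K) ->
  measurable_fun setT Z ->
  (forall th t, \int[P]_w (C w * cos (th + t * Z w)) = 0) ->
  forall A, measurable A -> \int[P]_w (C w * \1_A (Z w)) = 0.
Proof.
move=> mC CK mZ h A mA.
have K0 : forall w : T, `|cst (0 : R) w| <= K.
  by move=> w; rewrite normr0; exact: le_trans (CK w).
have e := @wmean_unique _ _ _ P _ _ P C Z (cst 0) Z K mC mZ (measurable_cst _) mZ CK K0 _ _ mA.
rewrite -[LHS]/(wmean P C Z \1_A) e.
  by rewrite /wmean; under eq_Rintegral do rewrite mul0r; rewrite /Rintegral integral0.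
move=> th t; rewrite /wmean h.
by under eq_Rintegral do rewrite mul0r; rewrite /Rintegral integral0.
Qed.

Lemma box_eq0 m (C : T -> R) (Y : nat -> T -> R) K :
  measurable_fun setT C -> (forall w, `|C w| <= K) ->
  (forall i, measurable_fun setT (Y i)) ->
  (forall th (c : nat -> R),
    \int[P]_w (C w * cos (th + \sum_(i < m) c i * Y i w)) = 0) ->
  forall B : nat -> set R, (forall i, measurable (B i)) ->
  \int[P]_w (C w * \prod_(i < m) \1_(B i) (Y i w)) = 0.
Proof.
elim: m C Y => [|m IH] C Y mC CK mY h B mB.
  rewrite -(h 0 (fun=> 0)); apply: eq_Rintegral => w _.
  by rewrite !big_ord0 addr0 cos0.
pose C' w := C w * \1_(B 0%N) (Y 0%N w).
have mC' : measurable_fun setT C' by apply: measurable_funM => //; exact: mind.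
have C'K w : `|C' w| <= K by rewrite normrM -[K]mulr1 ler_pM.
rewrite -[RHS](IH C' (fun i => Y i.+1) mC' C'K _ _ (fun i => B i.+1))//.
  by apply: eq_Rintegral => w _; rewrite big_ord_recl mulrA.
move=> th c; pose L w := th + \sum_(i < m) c i * Y i.+1 w.
have mL : measurable_fun setT L.
  by apply: measurable_funD => //; exact: (@measurable_lincomb m c (fun i => Y i.+1)).
rewrite -[RHS](@weight_eq0 (fun w => C w * cos (L w)) (Y 0%N) K _ _ _ _ (B 0%N))//.
- by apply: eq_Rintegral => w _; rewrite /C' -!mulrA [\1_ _ _ * _]mulrC.
- by apply: measurable_funM => //; exact: measurable_cos.
- by move=> w; rewrite normrM -[K]mulr1 ler_pM// norm_cos.
- move=> th' t.
  have mc (f : T -> R) : measurable_fun setT f -> intg P (fun w => C w * cos (f w)).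
    move=> mf; apply: (@intg_bounded _ _ _ P _ K).
      by apply: measurable_funM => //; exact: measurable_cos.
    by move=> w; rewrite normrM -[K]mulr1 ler_pM// norm_cos.
  pose cp (e : R) := (fun i : nat => if i is j.+1 then e * c j else t).
  have E (e : R) w : \sum_(i < m.+1) cp e i * Y i w = t * Y 0%N w + e * \sum_(i < m) c i * Y i.+1 w.
    rewrite big_ord_recl; congr (_ + _); rewrite mulr_sumr.
    by apply: eq_bigr => i _; rewrite /= mulrA.
  have hp := h (th' + th) (cp 1); have hm := h (th' - th) (cp (- 1)).
  have mf e u : measurable_fun setT (fun w => u + \sum_(i < m.+1) cp e i * Y i w).
    by apply: measurable_funD => //; exact: (@measurable_lincomb m.+1 (cp e) Y).
  transitivity (2^-1 * (\int[P]_w (C w * cos (th' + th + \sum_(i < m.+1) cp 1 i * Y i w)) +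
     \int[P]_w (C w * cos (th' - th + \sum_(i < m.+1) cp (- 1) i * Y i w)))); last first.
    by rewrite hp hm addr0 mulr0.
  rewrite -RintD; [|exact: mc|exact: mc].
  rewrite -RintZ; last by apply: intgD; exact: mc.
  apply: eq_Rintegral => w _; rewrite -mulrA [cos (L w) * _]mulrC cos_mul !E mul1r mulN1r.
  have -> : th' + t * Y 0%N w + L w = th' + th + (t * Y 0%N w + \sum_(i < m) c i * Y i.+1 w).
    by rewrite /L; ring.
  have -> : th' + t * Y 0%N w - L w = th' - th + (t * Y 0%N w - \sum_(i < m) c i * Y i.+1 w).
    by rewrite /L; ring.
  by field.
Qed.

End boxes.

Section vectors.
Context d (T : measurableType d) {R : realType} (P : probability T R).
Variable m : nat.

Definition vec (Y : 'I_m -> T -> R) (w : T) : 'rV[R]_m := \row_i Y i w.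

Lemma measurable_vec Y : (forall i, measurable_fun setT (Y i)) ->
  measurable_fun setT (vec Y).
Proof.
move=> mY; apply: measurable_fun_rV => i.
by under eq_fun do rewrite mxE; exact: mY.
Qed.

Definition box (B : nat -> set R) : set 'rV[R]_m := [set x | forall i : 'I_m, B i (x ord0 i)].

Lemma measurable_box B : (forall i, measurable (B i)) -> measurable (box B).
Proof.
move=> mB; rewrite (_ : box B = \big[setI/setT]_(i < m)
    ((fun x : 'rV[R]_m => x ord0 i) @^-1` B i)); last first.
  rewrite -bigcap_seq; apply/seteqP; split => [x /= h i _|x /= h i]; first exact: h.
  by apply: h; rewrite /= mem_index_enum.
apply: bigsetI_measurable => i _.
by rewrite -[X in measurable X]setTI; exact: measurable_coord.
Qed.

Definition boxes : set (set 'rV[R]_m) :=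
  [set S | exists2 B, forall i, measurable (B i) & S = box B].

Lemma measurable_rVE : @measurable _ 'rV[R]_m = <<s boxes >>.
Proof.
apply/seteqP; split; last first.
  apply: smallest_sub; first exact: sigma_algebra_measurable.
  by move=> _ [B mB ->]; exact: measurable_box.
apply: smallest_sub; first exact: smallest_sigma_algebra.
rewrite -bigcup_seq; apply: bigcup_sub => i _ _ [B mB <-].
apply: sub_sigma_algebra; exists (fun j => if j == i :> nat then B else setT).
  by move=> j; case: ifP.
rewrite setTI; apply/seteqP; split => x /=; rewrite /box/=.
  by move=> Bx j; case: ifPn => // /eqP /val_inj ->.
by move=> /(_ i); rewrite eqxx.
Qed.

Lemma setI_closed_boxes : setI_closed boxes.
Proof.
move=> _ _ [B mB ->] [B' mB' ->]; exists (fun i => B i `&` B' i).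
  by move=> i; exact: measurableI.
apply/seteqP; split => x /=.
  by move=> [h h'] i; split; [exact: h|exact: h'].
by move=> h; split => i; case: (h i).
Qed.

Lemma vec_eq0 (C : T -> R) (Y : 'I_m -> T -> R) K :
  measurable_fun setT C -> (forall w, `|C w| <= K) ->
  (forall i, measurable_fun setT (Y i)) ->
  (forall th c, \int[P]_w (C w * cos (th + \sum_(i < m) c i * Y i w)) = 0) ->
  forall S, measurable S -> wmean P C (vec Y) \1_S = 0.
Proof.
move=> mC CK mY h S.
pose Y' (j : nat) := oapp Y (cst 0) (insub j : option 'I_m).
have Y'E (i : 'I_m) : Y' i = Y i by rewrite /Y' valK.
have mY' i : measurable_fun setT (Y' i).
  by rewrite /Y'; case: insub => /= [j|//]; exact: mY.
have h' th (c : nat -> R) : \int[P]_w (C w * cos (th + \sum_(i < m) c i * Y' i w)) = 0.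
  rewrite -[RHS](h th (fun i => c i)); apply: eq_Rintegral => w _.
  by congr (_ * cos (_ + _)); apply: eq_bigr => i _; rewrite Y'E.
have hB := box_eq0 mC CK mY' h'.
have mv := measurable_vec mY.
have hbox B : (forall i, measurable (B i)) -> wmean P C (vec Y) \1_(box B) = 0.
  move=> mB; rewrite -[RHS](hB B mB); apply: eq_Rintegral => w _; congr (_ * _).
  have -> : \prod_(i < m) \1_(B i) (Y' i w) = \prod_(i < m) (Y i w \in B i)%:R :> R.
    by apply: eq_bigr => i _; rewrite indicE Y'E.
  rewrite indicE; have [bx|nbx] := pselect (box B (vec Y w)).
    rewrite mem_set// big1// => i _.
    by have := bx i; rewrite mxE => /mem_set ->.
  rewrite memNset//; move: nbx => /existsNP[i]; rewrite mxE => nB.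
  by rewrite (bigD1 i)//= memNset// mul0r.
move=> mS; have {mS} : <<s boxes >> S by rewrite -measurable_rVE.
move: S; apply: (@dynkin_induction _ 'rV[R]_m boxes (fun S => wmean P C (vec Y) \1_S = 0)).
- exact: measurable_rVE.
- exact: setI_closed_boxes.
- rewrite (_ : setT = box (fun=> setT)); first exact: hbox.
  by apply/seteqP; split.
- by move=> _ [B mB ->]; exact: hbox.
- move=> A mA A0; rewrite (wmean_setC P mC mv CK)// A0 subr0.
  rewrite -[RHS](hbox (fun=> setT))// (_ : box _ = setT) ?indicT//.
  by apply/seteqP; split.
- move=> F mF tF F0.
  have c1 := @cvg_wmean_bigcup _ _ _ P _ _ _ _ _ mC mv CK _ mF.
  have e n : wmean P C (vec Y) \1_(\big[setU/set0]_(k < n) F k) = 0.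
    elim: n => [|n IH].
      rewrite big_ord0 /wmean /Rintegral integral0_eq// => w _.
      by rewrite indic0 mulr0.
    have mS : measurable (\big[setU/set0]_(k < n) F k).
      by rewrite -bigcup_mkord; apply: bigcup_measurable => k _; exact: mF.
    have D0 : \big[setU/set0]_(k < n) F k `&` F n = set0.
      by apply: (@trivIset_bigsetUI _ xpredT) => // i j _ _; exact: tF.
    by rewrite big_ord_recr/= (wmean_setU P mC mv CK mS (mF n) D0) IH F0 addr0.
  move: c1; rewrite (funext e) => c1.
  by apply/esym/(cvg_unique _ (cvg_cst 0) c1).
Qed.

End vectors.


Section independence.
Context d (T : measurableType d) {R : realType} (P : probability T R).
Context d1 (U1 : measurableType d1) d2 (U2 : measurableType d2).
Variables (Z : T -> U1) (V : T -> U2).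

Definition independent := forall A B, measurable A -> measurable B ->
  P (Z @^-1` A `&` V @^-1` B) = (P (Z @^-1` A) * P (V @^-1` B))%E.

Hypotheses (mZ : measurable_fun setT Z) (mV : measurable_fun setT V).
Hypothesis indep : independent.

Lemma indep_fubini (f : U1 * U2 -> \bar R) : (forall x, 0 <= f x)%E ->
  measurable_fun setT f ->
  (\int[P]_w f (Z w, V w) = \int[P]_v \int[P]_w f (Z w, V v))%E.
Proof.
move=> f0 mf.
pose Zm : {mfun T >-> U1} := mfun_Sub (mem_set mZ).
pose Vm : {mfun T >-> U2} := mfun_Sub (mem_set mV).
have mZV : measurable_fun setT (fun w => (Z w, V w)) by exact: measurable_fun_pair.
pose ZVm : {mfun T >-> (U1 * U2)%type} := mfun_Sub (mem_set mZV).
have lawE X : measurable X -> (distribution P Zm \x distribution P Vm)%E X = distribution P ZVm X.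
  by apply: product_measure_unique => A B mA mB; exact: indep.
transitivity (\int[distribution P ZVm]_z f z)%E.
  by rewrite ge0_integral_pushforward.
transitivity (\int[distribution P Zm \x distribution P Vm]_z f z)%E.
  by apply: eq_measure_integral => A mA _; first [exact: lawE | exact: (esym (lawE _ mA))].
rewrite fubini_tonelli2// ge0_integral_pushforward//=.
- apply: eq_integral => v _; rewrite /fubini_G ge0_integral_pushforward//.
  exact: measurableT_comp.
- exact: measurable_fun_fubini_tonelli_G.
- by move=> y _; apply: integral_ge0 => x _; exact: f0.
Qed.

End independence.

Section gaussian_independence.
Context d (T : measurableType d) {R : realType} (P : probability T R).
Variables (m : nat) (Z : T -> R) (Y : 'I_m -> T -> R).
Hypothesis G : forall s c, GV P (fun w => s * Z w + \sum_(i < m) c i * Y i w).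
Hypothesis orth : forall i, \int[P]_w (Z w * Y i w) = 0.

Let GZ : GV P Z.
Proof.
have := G 1 (fun=> 0); congr GV; apply/funext => w.
by rewrite mul1r big1 ?addr0// => i _; rewrite mul0r.
Qed.

Let GS c : GV P (fun w => \sum_(i < m) c i * Y i w).
Proof. by have := G 0 c; congr GV; apply/funext => w; rewrite mul0r add0r. Qed.

Let GY i : GV P (Y i).
Proof.
have := GS (fun j => (j == i)%:R); congr GV; apply/funext => w.
by rewrite (bigD1 i)//= eqxx mul1r big1 ?addr0// => j /negbTE ->; rewrite mul0r.
Qed.

Lemma GV_independent : independent P Z (vec Y).
Proof.
have mZ := GV_measurable GZ; have mY i := GV_measurable (GY i).
have mS c := GV_measurable (GS c).
set v := \int[P]_w (Z w ^+ 2).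
have ZS c : \int[P]_w (Z w * \sum_(i < m) c i * Y i w) = 0.
  have -> : (fun w => Z w * \sum_(i < m) c i * Y i w) =
     (fun w => \sum_(i < m) (c i * (Z w * Y i w))).
    by apply/funext => w; rewrite mulr_sumr; apply: eq_bigr => i _; ring.
  have iZY i : intg P (fun w => Z w * Y i w) by apply: L2_mul; [case: GZ|case: (GY i)].
  rewrite Rint_sum => [|i]; last exact: intgZ.
  by rewrite big1// => i _; rewrite RintZ// orth mulr0.
have var s c : \int[P]_w ((s * Z w + \sum_(i < m) c i * Y i w) ^+ 2) =
    s ^+ 2 * v + \int[P]_w ((\sum_(i < m) c i * Y i w) ^+ 2).
  transitivity (\int[P]_w ((\sum_(i < m) c i * Y i w - - s * Z w) ^+ 2)).
    by apply: eq_Rintegral => w _; congr (_ ^+ 2); ring.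
  rewrite (Rint_sqrB (f := fun w => \sum_(i < m) c i * Y i w)); [|by case: (GS c)|by case: GZ].
  have -> : \int[P]_w ((\sum_(i < m) c i * Y i w) * Z w) = 0.
    by rewrite -[RHS](ZS c); apply: eq_Rintegral => w _; rewrite mulrC.
  by rewrite /v; ring.
have prodE th th' s c :
    \int[P]_w (cos (th + \sum_(i < m) c i * Y i w) * cos (th' + s * Z w)) =
    \int[P]_w cos (th + \sum_(i < m) c i * Y i w) * \int[P]_w cos (th' + s * Z w).
  set S := fun w => \sum_(i < m) c i * Y i w.
  have h e := (G e c).2.
  transitivity (2^-1 * (\int[P]_w cos ((th + th') + 1 * (s * Z w + S w)) +
      \int[P]_w cos ((th - th') + 1 * (- s * Z w + S w)))).
    rewrite -RintD; last 2 first.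
    - by apply: intg_cos; apply: measurable_funD => //; apply: measurable_funM => //;
        apply: measurable_funD; [exact: measurable_funM|exact: mS].
    - by apply: intg_cos; apply: measurable_funD => //; apply: measurable_funM => //;
        apply: measurable_funD; [exact: measurable_funM|exact: mS].
    rewrite -RintZ; last first.
      apply: intgD.
      - by apply: intg_cos; apply: measurable_funD => //; apply: measurable_funM => //;
          apply: measurable_funD; [exact: measurable_funM|exact: mS].
      - by apply: intg_cos; apply: measurable_funD => //; apply: measurable_funM => //;
          apply: measurable_funD; [exact: measurable_funM|exact: mS].
    apply: eq_Rintegral => w _; rewrite cos_mul mulrC; congr (_ * (cos _ + cos _)); rewrite /S; ring.
  rewrite !h !var.
  have := (GS c).2 th 1; under eq_Rintegral do rewrite mul1r; move=> ->.
  rewrite (GZ.2 th' s) -/v -/S !expr1n sqrrN !mul1r.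
  by rewrite mulrDl opprD expRD cosD cosB; field.
pose V := vec Y; have mV : measurable_fun setT V by exact: measurable_vec.
move=> A B mA mB.
have mZA : measurable (Z @^-1` A) by rewrite -[X in measurable X]setTI; exact: mZ.
have mVB : measurable (V @^-1` B) by rewrite -[X in measurable X]setTI; exact: mV.
pose p := fine (P (Z @^-1` A)).
have iA1 w : `|\1_A (Z w)| <= 1 :> R.
  by rewrite indicE; case: (_ \in _); rewrite ?normr0 ?normr1.
have mA1 : measurable_fun setT (fun w => \1_A (Z w) : R).
  exact: (measurableT_comp (measurable_indic mA)).
have pE : p = \int[P]_w \1_A (Z w).
  rewrite /p -(wmean1 P mZ mA) /wmean; apply: eq_Rintegral => w _.
  by rewrite /= mul1r.
have p1 : `|p| <= 1.
  rewrite ger0_norm ?fine_ge0// -lee_fin fineK ?fin_num_measure//.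
  exact: probability_le1.
pose C w := \1_A (Z w) - p.
have C2 w : `|C w| <= 2 by rewrite (le_trans (ler_normB _ _))// (le_trans (lerD (iA1 w) p1)).
have mC : measurable_fun setT C by exact: measurable_funB.
have key : wmean P C V \1_B = 0.
  apply: (vec_eq0 mC C2 mY) => // th c.
  pose K w := cos (th + \sum_(i < m) c i * Y i w).
  have mK : measurable_fun setT K by apply: measurable_cos; exact: measurable_funD.
  have iK : intg P K by apply: intg_cos; exact: measurable_funD.
  pose k := \int[P]_w K w.
  have := @weight_eq0 _ _ _ P (fun w => K w - k) Z (1 + `|k|) _ _ mZ _ A mA.
  have iKA : intg P (fun w => K w * \1_A (Z w)).
    apply: (@intg_bounded _ _ _ P _ 1); first exact: measurable_funM.
    by move=> w; rewrite normrM mulr_ile1// norm_cos.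
  have -> : (fun w => (K w - k) * \1_A (Z w)) = (fun w => K w * \1_A (Z w) - k * \1_A (Z w)).
    by apply/funext => w; rewrite mulrBl.
  have iA : intg P (fun w => \1_A (Z w)) by apply: (@intg_bounded _ _ _ P _ 1).
  rewrite RintB//; last exact: intgZ.
  rewrite RintZ// -pE => h.
  have -> : (fun w => C w * K w) = (fun w => K w * \1_A (Z w) - p * K w).
    by apply/funext => w; rewrite /C; ring.
  rewrite RintB//; last exact: intgZ.
  rewrite RintZ// -/k (mulrC p); apply: h.
  - exact: measurable_funB.
  - by move=> w; rewrite (le_trans (ler_normB _ _))// lerD2r norm_cos.
  - move=> th' t.
    have mcZ : measurable_fun setT (fun w => th' + t * Z w).
      by apply: measurable_funD => //; exact: measurable_funM.
    have -> : (fun w => (K w - k) * cos (th' + t * Z w)) =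
       (fun w => K w * cos (th' + t * Z w) - k * cos (th' + t * Z w)).
      by apply/funext => w; rewrite mulrBl.
    rewrite RintB; last 2 first.
    + apply: (@intg_bounded _ _ _ P _ 1).
        by apply: measurable_funM => //; exact: measurable_cos.
      by move=> w; rewrite normrM mulr_ile1// norm_cos.
    + by apply: intgZ; exact: intg_cos.
    rewrite RintZ; last exact: intg_cos.
    by rewrite prodE subrr.
have : fine (P (Z @^-1` A `&` V @^-1` B)) - p * fine (P (V @^-1` B)) = 0.
  rewrite -key -(wmean1 P mV mB) /wmean -RintZ; last first.
    apply: (@intg_bounded _ _ _ P _ 1).
      by apply: measurable_funM => //; apply: measurableT_comp => //; exact: measurable_indic.
    by move=> w; rewrite mul1r indicE; case: (_ \in _); rewrite ?normr0 ?normr1.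
  have -> : fine (P (Z @^-1` A `&` V @^-1` B)) = \int[P]_w (\1_A (Z w) * \1_B (V w)).
    rewrite /Rintegral -[in LHS](setIT (_ `&` _)) -integral_indic//; last exact: measurableI.
    by congr fine; apply: eq_integral => w _; rewrite !indicE in_setI -natrM mulnb.
  rewrite -RintB.
  - by apply: eq_Rintegral => w _; rewrite /C /=; ring.
  - apply: (@intg_bounded _ _ _ P _ 1).
      apply: measurable_funM => //; apply: measurableT_comp => //; exact: measurable_indic.
    by move=> w; rewrite !indicE normrM; do 2 case: (_ \in _); rewrite ?normr0 ?normr1 ?mulr0 ?mul0r ?mulr1.
  - apply: intgZ; apply: (@intg_bounded _ _ _ P _ 1).
      by apply: measurable_funM => //; apply: measurableT_comp => //; exact: measurable_indic.
    by move=> w; rewrite mul1r indicE; case: (_ \in _); rewrite ?normr0 ?normr1.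
move/eqP; rewrite subr_eq0 => /eqP e.
rewrite -(fineK (fin_num_measure P _ mZA)) -(fineK (fin_num_measure P _ mVB)).
rewrite -EFinM -/p -e fineK//; apply: fin_num_measure; exact: measurableI.
Qed.

End gaussian_independence.


Lemma le_measure_ae d (T : measurableType d) {R : realType}
    (m : {measure set T -> \bar R}) (A B : set T) : measurable A -> measurable B ->
  {ae m, forall x, A x -> B x} -> (m A <= m B)%E.
Proof.
move=> mA mB [N [mN N0 sub]].
have ABN : A `<=` B `|` N.
  move=> x Ax; have [Bx|nBx] := pselect (B x); first by left.
  by right; apply: sub => /= h; exact: nBx (h Ax).
apply: (@le_trans _ _ (m (B `|` N))).
  by apply: le_measure; rewrite ?inE//; exact: measurableU.
by rewrite -[leRHS]adde0 -N0; exact: measureU2.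
Qed.

Section scaling.
Context {R : realType}.
Implicit Types s x : R.

Definition tilt (v be x : R) : R := expR (- (x ^+ 2 / (2 * v) * (be ^- 2 - 1))).

Lemma measurable_tilt (v be : R) : measurable_fun setT (tilt v be).
Proof.
apply: measurableT_comp => //; apply: measurable_funN.
by apply: measurable_funM => //; apply: measurable_funM.
Qed.

Lemma tilt_ge0 (v be x : R) : 0 <= tilt v be x. Proof. exact: expR_ge0. Qed.

Lemma normal_peakM s (be : R) : be != 0 -> normal_peak (`|be| * s) = `|be|^-1 * normal_peak s.
Proof.
move=> b0; rewrite /normal_peak -invfM; congr (_^-1).
have -> : (`|be| * s) ^+ 2 * pi *+ 2 = `|be| ^+ 2 * (s ^+ 2 * pi *+ 2) :> R by ring.
by rewrite sqrtrM ?sqr_ge0// sqrtr_sqr normr_id.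
Qed.

Lemma normal_pdf_scale s (be : R) x : s != 0 -> be != 0 ->
  normal_pdf 0 (`|be| * s) x = (`|be|^-1 * tilt (s ^+ 2) be x) * normal_pdf 0 s x.
Proof.
move=> s0 b0; have bs0 : `|be| * s != 0 by rewrite mulf_neq0// normr_eq0.
rewrite (normal_pdfE _ bs0) (normal_pdfE _ s0)/= normal_peakM// /normal_fun subr0.
rewrite /tilt mulrACA -expRD; congr (_ * expR _).
rewrite exprMn real_normK ?num_real//; field.
by rewrite s0.
Qed.

Context d (T : measurableType d) (P : probability T R).

Lemma GVZ (Z : T -> R) (k : R) : GV P Z -> GV P (fun w => k * Z w).
Proof.
move=> [lZ cZ]; split; first exact: L2Z.
move=> th t; under eq_Rintegral do rewrite mulrA.
have e : \int[P]_w ((k * Z w) ^+ 2) = k ^+ 2 * \int[P]_w (Z w ^+ 2).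
  by under eq_Rintegral do rewrite exprMn; rewrite RintZ//; case: lZ.
by rewrite cZ e exprMn mulrA.
Qed.

Lemma GV_scale (Z : T -> R) (be : R) (h : R -> \bar R) : GV P Z ->
  0 < \int[P]_w (Z w ^+ 2) -> be != 0 ->
  (forall x, 0 <= h x)%E -> measurable_fun setT h ->
  (\int[P]_w h (be * Z w)%R =
   \int[P]_w ((`|be|^-1 * tilt (\int[P]_w (Z w ^+ 2)) be (Z w))%:E * h (Z w)))%E.
Proof.
move=> gZ v0 b0 h0 mh; set v := \int[P]_w _ in v0 *.
set s := Num.sqrt v.
have s0 : s != 0 by rewrite gt_eqF// sqrtr_gt0.
have s2 : s ^+ 2 = v by rewrite sqr_sqrtr// ltW.
have mZ := GV_measurable gZ; have gbZ := GVZ be gZ; have mbZ := GV_measurable gbZ.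
have e2 : \int[P]_w ((be * Z w) ^+ 2) = be ^+ 2 * v.
  under eq_Rintegral do rewrite exprMn.
  by rewrite RintZ//; case: gZ => -[].
have sE : Num.sqrt (be ^+ 2 * v) = `|be| * s by rewrite sqrtrM ?sqr_ge0// sqrtr_sqr.
have lbZ A : measurable A -> P ((fun w => be * Z w) @^-1` A) = normal_prob 0 (`|be| * s) A.
  move=> mA; rewrite -sE -e2; apply: GV_law => //.
  by rewrite e2 mulr_gt0// exprn_even_gt0.
have lZ A : measurable A -> P (Z @^-1` A) = normal_prob 0 s A by exact: GV_law.
pose k x := ((`|be|^-1 * tilt v be x)%:E * h x)%E.
have k0 x : (0 <= k x)%E by rewrite mule_ge0// lee_fin mulr_ge0// tilt_ge0.
have mk : measurable_fun setT k.
  apply: emeasurable_funM => //; apply/measurable_EFinP; apply: measurable_funM => //.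
  exact: measurable_tilt.
have den (s' : R) (f : R -> \bar R) : (forall x, 0 <= f x)%E -> measurable_fun setT f ->
    (\int[normal_prob 0 s']_x f x = \int[lebesgue_measure]_x (f x * (normal_pdf 0 s' x)%:E))%E.
  move=> f0 mf; apply: ge0_integral_density => //.
  - by move=> x; exact: normal_pdf_ge0.
  - exact: measurable_normal_pdf.
transitivity (\int[normal_prob 0 (`|be| * s)]_x h x)%E.
  exact: (@ge0_integral_law _ _ _ P _ (measurableTypeR R) (fun w => be * Z w)%R
    (normal_prob 0 (`|be| * s)) mbZ lbZ h h0 mh).
transitivity (\int[normal_prob 0 s]_x k x)%E; last first.
  apply/esym.
  exact: (@ge0_integral_law _ _ _ P _ (measurableTypeR R) Z (normal_prob 0 s) mZ lZ k k0 mk).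
rewrite (den _ h h0 mh) (den _ k k0 mk).
apply: eq_integral => x _; rewrite normal_pdf_scale// s2 EFinM muleA /k.
by rewrite [(h x * _)%E]muleC.
Qed.

End scaling.

Section anderson1.
Context {R : realType}.
Local Notation mu := (@lebesgue_measure R).

Lemma normal_pdf_le_norm (s x y : R) : s != 0 -> `|x| <= `|y| ->
  normal_pdf 0 s y <= normal_pdf 0 s x.
Proof.
move=> s0 xy; rewrite !normal_pdfE// ler_pM2l ?normal_peak_gt0//.
rewrite /normal_fun !subr0 ler_expR !mulNr lerN2 ler_pM2r ?invr_gt0; last first.
  by rewrite mulrn_wgt0// exprn_even_gt0.
by rewrite -(real_normK (num_real x)) -(real_normK (num_real y)) lerXn2r ?nnegrE.
Qed.

Variable s : R.
Hypothesis s0 : s != 0.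
Local Notation p := (normal_pdf 0 s).
Let Phi (x : R) := \int[mu]_(y in `]-oo, x]) p y.

Let ip : intg mu p. Proof. exact: integrable_normal_pdf. Qed.

Let iS (A : set (measurableTypeR R)) : measurable A -> mu.-integrable A (EFin \o p).
Proof. by move=> mA; exact: (integrableS measurableT). Qed.

Let dPhi (x : R) : is_derive x 1 Phi (p x).
Proof.
have x1 : x < x + 1 by rewrite ltrDl.
have h : mu.-integrable [set` Interval -oo%O (BRight (x + 1))] (EFin \o p) by exact: iS.
have cp : {for x, continuous p} by exact: continuous_normal_pdf.
have := @continuous_FTC1 _ p -oo%O x (x + 1) x1 h; case.
- by rewrite ltNyr.
- exact: cp.
move=> d1 d2.
by split => //; rewrite -derive1E.
Qed.

Let NE (a b : R) : a <= b -> fine (normal_prob 0 s `[a, b]%classic) = Phi b - Phi a.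
Proof.
move=> ab; rewrite -[LHS]/(\int[mu]_(x in `[a, b]) p x).
rewrite -Rintegral_itv_obnd_cbnd; last exact: iS.
by rewrite /Phi Rintegral_itvB//; exact: iS.
Qed.

Let window_pos (r t t' : R) : 0 <= r -> 0 <= t -> t <= t' ->
  Phi (r - t') - Phi (- r - t') <= Phi (r - t) - Phi (- r - t).
Proof.
move=> r0 t0 tt'.
pose f (x : R) := Phi (r - x) - Phi (- r - x).
have df (x : R) : is_derive x 1 f (p (- r - x) - p (r - x)).
  have d1 (a : R) : is_derive x 1 (fun y : R => Phi (a - y)) (- p (a - x)).
    have h1 : is_derive x 1 (fun y : R => a - y) (- 1).
      by apply: is_derive_eq; ring.
    have h2 := dPhi (a - x).
    have := @is_derive1_comp _ Phi (fun y : R => a - y) x _ _ h2 h1 => h3.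
    by apply: (is_derive_eq h3); rewrite mulrN1.
  have h1 := d1 r; have h2 := d1 (- r).
  by apply: is_derive_eq; rewrite opprK addrC.
rewrite -/(f t') -/(f t).
apply: (@ler0_derive1_nincr _ f t t') => //.
- move=> x; rewrite in_itv/= => /andP[tx _].
  rewrite derive1E (@derive_val _ _ _ _ _ _ _ (df x)) subr_le0.
  apply: normal_pdf_le_norm => //.
  have x0 : 0 <= x by rewrite (le_trans t0)// ltW.
  rewrite -opprD normrN (@ger0_norm _ (r + x)) ?addr_ge0//.
  by rewrite ler_norml; apply/andP; split; lra.
- apply: continuous_subspaceT => x; apply/differentiable_continuous/derivable1_diffP.
  by case: (df x).
Qed.

Definition ball1 (t c : R) : set (measurableTypeR R) := [set x | (x + t) ^+ 2 <= c].

Lemma measurable_ball1 (t c : R) : measurable (ball1 t c).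
Proof.
rewrite -[X in measurable X]setTI.
rewrite (_ : ball1 t c = (fun x : R => (x + t) ^+ 2) @^-1` `]-oo, c]).
  have : measurable_fun setT (fun x : R => (x + t) ^+ 2).
    by apply: measurable_funX; exact: measurable_funD.
  by apply => //; exact: measurable_itv.
by apply/seteqP; split => x /=; rewrite in_itv.
Qed.

Let ball1E (t c : R) : 0 <= c ->
  ball1 t c = `[- Num.sqrt c - t, Num.sqrt c - t]%classic.
Proof.
move=> c0; apply/seteqP; split => x; rewrite /ball1 /= in_itv/=;
  have e : ((x + t) ^+ 2 <= c) = (`|x + t| <= Num.sqrt c) by rewrite -sqrtr_sqr ler_sqrt.
  by rewrite e ler_norml => /andP[h1 h2]; apply/andP; split; lra.
by move=> /andP[h1 h2]; rewrite e ler_norml; apply/andP; split; lra.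
Qed.

Lemma normal_anderson_pos (t t' c : R) : 0 <= t -> t <= t' ->
  (normal_prob 0 s (ball1 t' c) <= normal_prob 0 s (ball1 t c))%E.
Proof.
move=> t0 tt'; have [c0|c0] := leP 0 c; last first.
  rewrite (_ : ball1 t' c = set0) ?measure0//.
  apply/seteqP; split => x //=; rewrite /ball1 /= => h.
  by have := sqr_ge0 (x + t'); lra.
have h (t1 : R) : normal_prob 0 s (ball1 t1 c) = (Phi (Num.sqrt c - t1) - Phi (- Num.sqrt c - t1))%:E.
  rewrite ball1E// -NE; first by rewrite fineK// fin_num_measure.
  by rewrite lerD2r; have := sqrtr_ge0 c; lra.
by rewrite !h lee_fin window_pos// sqrtr_ge0.
Qed.

End anderson1.

Section anderson_GV.
Context {R : realType} d (T : measurableType d) (P : probability T R).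

Lemma GV_anderson (U : T -> R) (t t' c : R) : GV P U -> `|t| <= `|t'| ->
  (P [set w | ((U w + t') ^+ 2 <= c)%R] <= P [set w | ((U w + t) ^+ 2 <= c)%R])%E.
Proof.
move=> gU tt'; have mU := GV_measurable gU.
have mB u : measurable [set w | (U w + u) ^+ 2 <= c].
  by rewrite -[X in measurable X]setTI; exact: (mU measurableT _ (measurable_ball1 u c)).
set v := \int[P]_w (U w ^+ 2).
have v0 : 0 <= v by apply: Rint_ge0 => w; exact: sqr_ge0.
have [v0'|vN] := eqVneq v 0.
  have U0 := eq0_Rint_sqr (gU.1) v0'.
  apply: le_measure_ae => //; apply: filterS U0 => w /= /(_ I) ->.
  rewrite !add0r; apply: le_trans.
  by rewrite -(real_normK (num_real t)) -(real_normK (num_real t')) lerXn2r ?nnegrE.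
have vp : 0 < v by rewrite lt_neqAle eq_sym vN.
set s := Num.sqrt v; have s0 : s != 0 by rewrite gt_eqF// sqrtr_gt0.
have absE u : P [set w | (U w + u) ^+ 2 <= c] = normal_prob 0 s (ball1 `|u| c).
  have [u0|u0] := leP 0 u.
    by rewrite (ger0_norm u0) -(GV_law gU vp (measurable_ball1 u c)).
  rewrite (ltr0_norm u0).
  have gN := GVZ (-1) gU.
  have e2 : \int[P]_w ((-1 * U w) ^+ 2) = v.
    by apply: eq_Rintegral => w _; rewrite mulN1r sqrrN.
  rewrite /s -e2 -(GV_law gN _ (measurable_ball1 (- u) c)) ?e2//.
  by congr (P _); apply/seteqP; split => w /=; rewrite /ball1/= mulN1r -opprD sqrrN.
by rewrite !absE; apply: normal_anderson_pos.
Qed.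

End anderson_GV.


Section sublevel.
Context d (T : measurableType d) {R : realType}.

Lemma measurable_sublevel (f : T -> R) c : measurable_fun setT f ->
  measurable [set w | f w <= c].
Proof.
move=> mf; rewrite -[X in measurable X]setTI.
rewrite (_ : [set w | f w <= c] = f @^-1` `]-oo, c]).
  by apply: mf => //; exact: measurable_itv.
by apply/seteqP; split => x /=; rewrite in_itv.
Qed.

Lemma measurable_sumsq m (f : 'I_m -> T -> R) : (forall i, measurable_fun setT (f i)) ->
  measurable_fun setT (fun w => \sum_(i < m) f i w ^+ 2).
Proof. by move=> mf; apply: measurable_sum => i; exact: measurable_funX. Qed.

Lemma prob_indicE (P : probability T R) (A : set T) : measurable A ->
  P A = (\int[P]_w (\1_A w)%:E)%E.
Proof. by move=> mA; rewrite integral_indic// setIT. Qed.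

End sublevel.

Section finite_gaussian.
Context d (T : measurableType d) {R : realType} (P : probability T R).

Section one_family.
Variables (m : nat) (V : 'I_m -> T -> R).
Hypothesis G : forall c, GV P (fun w => \sum_(i < m) c i * V i w).

Lemma GV_family i : GV P (V i).
Proof.
have := G (fun j => (j == i)%:R); congr GV; apply/funext => w.
by rewrite (bigD1 i)//= eqxx mul1r big1 ?addr0// => j /negbTE ->; rewrite mul0r.
Qed.

Let mV i : measurable_fun setT (V i). Proof. exact: GV_measurable (GV_family i). Qed.

Lemma anderson_coordinate (j : 'I_m) (r : 'I_m -> R) (u u' c : R) :
  (forall i, i != j -> \int[P]_w (V j w * V i w) = 0) -> `|u| <= `|u'| ->
  (P [set w | ((V j w + u') ^+ 2 + \sum_(i < m | i != j) (V i w + r i) ^+ 2 <= c)%R] <=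
   P [set w | ((V j w + u) ^+ 2 + \sum_(i < m | i != j) (V i w + r i) ^+ 2 <= c)%R])%E.
Proof.
move=> orth uu'.
pose Y i := if i == j then cst 0 else V i.
have GY s (a : 'I_m -> R) : GV P (fun w => s * V j w + \sum_(i < m) a i * Y i w).
  have := G (fun i => if i == j then s else a i); congr GV; apply/funext => w.
  rewrite (bigD1 j)//= eqxx [in RHS](bigD1 j)//= /Y eqxx mulr0 add0r.
  by congr (_ + _); apply: eq_bigr => i /negbTE ->.
have orthY i : \int[P]_w (V j w * Y i w) = 0.
  rewrite /Y; case: ifPn => [_|ij]; last exact: orth.
  by under eq_Rintegral do rewrite mulr0; rewrite /Rintegral integral0.
have ind := GV_independent GY orthY.
have mY i : measurable_fun setT (Y i) by rewrite /Y; case: ifP.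
have mvY := measurable_vec mY.
pose q (v : 'rV[R]_m) := \sum_(i < m | i != j) (v ord0 i + r i) ^+ 2.
have mq : measurable_fun setT q.
  rewrite /q; under eq_fun do rewrite big_mkcond/=.
  apply: measurable_sum => i; case: (i != j) => //.
  by apply: measurable_funX; apply: measurable_funD => //; exact: measurable_coord.
have qY w : q (vec Y w) = \sum_(i < m | i != j) (V i w + r i) ^+ 2.
  by apply: eq_bigr => i ij; rewrite mxE /Y (negbTE ij).
pose S (x : R) : set (R * 'rV[R]_m) := [set z | (z.1 + x) ^+ 2 + q z.2 <= c].
have mS x : measurable (S x).
  apply: measurable_sublevel; apply: measurable_funD; last exact: measurableT_comp.
  by apply: measurable_funX; exact: measurable_funD.
have E x : (P [set w | ((V j w + x) ^+ 2 + \sum_(i < m | i != j) (V i w + r i) ^+ 2 <= c)%R] =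
    \int[P]_v P [set w | ((V j w + x) ^+ 2 <= c - q (vec Y v))%R])%E.
  have mA : measurable [set w | (V j w + x) ^+ 2 + \sum_(i < m | i != j) (V i w + r i) ^+ 2 <= c].
    rewrite (_ : [set w | _] = [set w | (V j w + x) ^+ 2 + q (vec Y w) <= c]); last first.
      by apply/seteqP; split => w /=; rewrite qY.
    apply: measurable_sublevel; apply: measurable_funD; last exact: measurableT_comp.
    by apply: measurable_funX; exact: measurable_funD.
  rewrite prob_indicE//.
  transitivity (\int[P]_w (\1_(S x) (V j w, vec Y w))%:E)%E.
    apply: eq_integral => w _; congr EFin; rewrite !indicE; congr (_%:R); congr nat_of_bool.
    by apply/idP/idP; rewrite !inE /S /= qY.
  rewrite (@indep_fubini _ _ _ P _ _ _ _ (V j) (vec Y) (mV j) mvY ind (fun z => (\1_(S x) z)%:E))//; last first.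
    by apply/measurable_EFinP; exact: measurable_indic.
  apply: eq_integral => v _; rewrite prob_indicE.
    apply: eq_integral => w _; congr EFin; rewrite !indicE; congr (_%:R); congr nat_of_bool.
    by apply/idP/idP; rewrite !inE /S /= lerBrDr.
  by apply: measurable_sublevel; apply: measurable_funX; exact: measurable_funD.
have mE x : measurable_fun setT (fun v => P [set w | (V j w + x) ^+ 2 <= c - q (vec Y v)]).
  pose f (z : T * T) := ((V j z.1 + x) ^+ 2 + q (vec Y z.2)).
  have mf : measurable_fun setT f.
    apply: measurable_funD; last first.
      by apply: measurableT_comp => //; exact: measurableT_comp.
    by apply: measurable_funX; apply: measurable_funD => //; exact: measurableT_comp.
  have := measurable_fun_ysection P (measurable_sublevel c mf).
  congr measurable_fun; apply/funext => v /=; congr (P _).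
  by apply/seteqP; split => w; rewrite /ysection /= inE /f /= lerBrDr.
rewrite !E; apply: ge0_le_integral => //.
by move=> v _; apply: GV_anderson => //; exact: GV_family.
Qed.

End one_family.

Lemma anderson_uncorrelated m (U : 'I_m -> T -> R) (t t' : 'I_m -> R) (c : R) :
  (forall a, GV P (fun w => \sum_(i < m) a i * U i w)) ->
  (forall i j, i != j -> \int[P]_w (U i w * U j w) = 0) ->
  (forall i, `|t i| <= `|t' i|) ->
  (P [set w | (\sum_(i < m) (U i w + t' i) ^+ 2 <= c)%R] <=
   P [set w | (\sum_(i < m) (U i w + t i) ^+ 2 <= c)%R])%E.
Proof.
move=> G orth tt'.
pose r k (i : 'I_m) := if (i < k)%N then t i else t' i.
have step k : (P [set w | (\sum_(i < m) (U i w + r 0%N i) ^+ 2 <= c)%R] <=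
    P [set w | (\sum_(i < m) (U i w + r k i) ^+ 2 <= c)%R])%E.
  elim: k => [//|k IH]; apply: (le_trans IH) => {IH}.
  have [km|mk] := ltnP k m; last first.
    rewrite (_ : r k.+1 = r k)//; apply/funext => i.
    have ik : (i < k)%N := leq_trans (ltn_ord i) mk.
    by rewrite /r ltnS ik (ltnW ik).
  pose j := Ordinal km.
  have E k' : [set w | \sum_(i < m) (U i w + r k' i) ^+ 2 <= c] =
     [set w | (U j w + r k' j) ^+ 2 + \sum_(i < m | i != j) (U i w + r k' i) ^+ 2 <= c].
    have e w : \sum_(i < m) (U i w + r k' i) ^+ 2 =
        (U j w + r k' j) ^+ 2 + \sum_(i < m | i != j) (U i w + r k' i) ^+ 2.
      by rewrite (bigD1 j).
    by apply/seteqP; split => w /=; rewrite e.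
  have rE (i : 'I_m) : i != j -> r k.+1 i = r k i.
    by move=> ij; rewrite /r ltnS leq_eqVlt (negbTE (_ : i != k :> nat)).
  rewrite (E k) (E k.+1).
  have -> : [set w | (U j w + r k.+1 j) ^+ 2 + \sum_(i < m | i != j) (U i w + r k.+1 i) ^+ 2 <= c] =
     [set w | (U j w + t j) ^+ 2 + \sum_(i < m | i != j) (U i w + r k i) ^+ 2 <= c].
    have rj : r k.+1 j = t j by rewrite /r ltnSn.
    have e w : \sum_(i < m | i != j) (U i w + r k.+1 i) ^+ 2 =
        \sum_(i < m | i != j) (U i w + r k i) ^+ 2.
      by apply: eq_bigr => i ij; rewrite rE.
    by apply/seteqP; split => w /=; rewrite rj e.
  have -> : r k j = t' j by rewrite /r ltnn.
  apply: anderson_coordinate => // i ij; apply: orth; by rewrite eq_sym.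
have r0 : r 0%N = t' by apply/funext => i; rewrite /r ltn0.
have rm : r m = t by apply/funext => i; rewrite /r ltn_ord.
by have := step m; rewrite r0 rm.
Qed.

End finite_gaussian.


Section finite_anderson.
Context d (T : measurableType d) {R : realType} (P : probability T R).
Variables (m : nat) (V : 'I_m -> T -> R).
Hypothesis G : forall c, GV P (fun w => \sum_(i < m) c i * V i w).

Lemma isometry (Q : 'M[R]_m) (x : 'I_m -> R) : Q *m Q^T = 1%:M ->
  \sum_(k < m) (\sum_(i < m) Q k i * x i) ^+ 2 = \sum_(i < m) x i ^+ 2.
Proof.
move=> /mulmx1C QQ; pose X : 'cV[R]_m := \col_i x i.
have sq (y : 'cV[R]_m) : (y^T *m y) 0 0 = \sum_i y i 0 ^+ 2.
  by rewrite mxE; apply: eq_bigr => i _; rewrite mxE expr2.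
transitivity (((Q *m X)^T *m (Q *m X)) 0 0).
  rewrite sq; apply: eq_bigr => k _; rewrite mxE; congr (_ ^+ 2).
  by apply: eq_bigr => i _; rewrite mxE.
rewrite trmx_mul mulmxA -[_ *m Q^T *m Q]mulmxA QQ mulmx1 sq.
by apply: eq_bigr => i _; rewrite mxE.
Qed.

Theorem finite_anderson (b : 'I_m -> R) (s t c : R) : `|s| <= `|t| ->
  (P [set w | (\sum_(i < m) (V i w + t * b i) ^+ 2 <= c)%R] <=
   P [set w | (\sum_(i < m) (V i w + s * b i) ^+ 2 <= c)%R])%E.
Proof.
move=> st; pose C : 'M[R]_m := \matrix_(i, j) \int[P]_w (V i w * V j w).
have lV i : L2 P (V i) by case: (GV_family G i).
have CT : C^T = C.
  by apply/matrixP => i j; rewrite !mxE; apply: eq_Rintegral => w _; rewrite mulrC.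
have [Q QQ dQ] := real_spectral CT.
pose U k w := \sum_(i < m) Q k i * V i w.
pose b' k := \sum_(i < m) Q k i * b i.
have GU a : GV P (fun w => \sum_(k < m) a k * U k w).
  have := G (fun i => \sum_(k < m) a k * Q k i); congr GV; apply/funext => w.
  under eq_bigr do rewrite mulr_suml.
  rewrite exchange_big/=; apply: eq_bigr => k _; rewrite mulr_sumr.
  by apply: eq_bigr => i _; rewrite mulrA.
have orthU k l : k != l -> \int[P]_w (U k w * U l w) = 0.
  move=> kl; rewrite -(dQ k l kl) mxE.
  have iV i j : intg P (fun w => V i w * V j w) by exact: L2_mul.
  have -> : (fun w => U k w * U l w) =
      (fun w => \sum_(j < m) \sum_(i < m) (Q k i * Q l j) * (V i w * V j w)).
    apply/funext => w; rewrite /U mulr_sumr; apply: eq_bigr => j _.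
    rewrite mulr_suml; apply: eq_bigr => i _; ring.
  rewrite Rint_sum => [|j]; last by apply: intg_sum => i; exact: intgZ.
  apply: eq_bigr => j _; rewrite Rint_sum => [|i]; last exact: intgZ.
  rewrite !mxE mulr_suml; apply: eq_bigr => i _.
  by rewrite RintZ// mxE; ring.
have E u : [set w | \sum_(i < m) (V i w + u * b i) ^+ 2 <= c] =
    [set w | \sum_(k < m) (U k w + u * b' k) ^+ 2 <= c].
  have e w : \sum_(k < m) (U k w + u * b' k) ^+ 2 = \sum_(i < m) (V i w + u * b i) ^+ 2.
    rewrite -(isometry _ QQ); apply: eq_bigr => k _; congr (_ ^+ 2).
    rewrite /U /b' mulr_sumr -big_split/=; apply: eq_bigr => i _; ring.
  by apply/seteqP; split => w /=; rewrite e.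
rewrite !E; apply: anderson_uncorrelated => // k.
by rewrite !normrM ler_wpM2r.
Qed.

End finite_anderson.

Section finite_dilation.
Context d (T : measurableType d) {R : realType} (P : probability T R).
Variables (m : nat) (V : 'I_m -> T -> R) (Z : T -> R).
Hypothesis G : forall s c, GV P (fun w => s * Z w + \sum_(i < m) c i * V i w).

Let v := \int[P]_w (Z w ^+ 2).
Hypothesis v0 : 0 < v.

(* the regression coefficient of V i on Z *)
Let b i := \int[P]_w (V i w * Z w) / v.

Let GZ : GV P Z.
Proof.
have := G 1 (fun=> 0); congr GV; apply/funext => w.
by rewrite mul1r big1 ?addr0// => i _; rewrite mul0r.
Qed.

Let GS c : GV P (fun w => \sum_(i < m) c i * V i w).
Proof. by have := G 0 c; congr GV; apply/funext => w; rewrite mul0r add0r. Qed.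

Let GVi i : GV P (V i). Proof. exact: (GV_family GS). Qed.

Let Y i w := V i w - b i * Z w.

Let GY s c : GV P (fun w => s * Z w + \sum_(i < m) c i * Y i w).
Proof.
have := G (s - \sum_(i < m) c i * b i) c; congr GV; apply/funext => w.
rewrite mulrBl mulr_suml -addrA; congr (_ + _).
rewrite addrC -sumrN -big_split/=; apply: eq_bigr => i _; rewrite /Y; ring.
Qed.

Let orth i : \int[P]_w (Z w * Y i w) = 0.
Proof.
have lZ := GZ.1; have lV := (GVi i).1.
have -> : (fun w => Z w * Y i w) = (fun w => V i w * Z w - b i * Z w ^+ 2).
  by apply/funext => w; rewrite /Y; ring.
rewrite RintB; [|exact: L2_mul|by apply: intgZ; case: lZ].
rewrite RintZ; last by case: lZ.
by rewrite -/v /b divfK ?subrr// gt_eqF.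
Qed.

Let ind := GV_independent GY orth.
Let mZ := GV_measurable GZ.
Let mY i : measurable_fun setT (Y i).
Proof. by apply: measurable_funB; [exact: GV_measurable (GVi i)|exact: measurable_funM]. Qed.
Let mvY := measurable_vec mY.

Let S (c : R) : set (R * 'rV[R]_m) := [set z : R * 'rV[R]_m | \sum_(i < m) (z.2 ord0 i + z.1 * b i) ^+ 2 <= c].

Let mS c : measurable (S c).
Proof.
apply: measurable_sublevel.
apply: (measurable_sumsq (f := fun i (z : R * 'rV[R]_m) => z.2 ord0 i + z.1 * b i)) => i.
apply: measurable_funD.
  exact: (measurableT_comp (measurable_coord i) measurable_snd).
exact: measurable_funM.
Qed.

Let dilE be c : [set w | \sum_(i < m) (V i w + (be - 1) * b i * Z w) ^+ 2 <= c] =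
  [set w | S c (be * Z w, vec Y w)].
Proof.
have e w : \sum_(i < m) (V i w + (be - 1) * b i * Z w) ^+ 2 =
    \sum_(i < m) ((vec Y w) ord0 i + be * Z w * b i) ^+ 2.
  by apply: eq_bigr => i _; rewrite mxE /Y; congr (_ ^+ 2); ring.
by apply/seteqP; split => w /=; rewrite e.
Qed.

Let mdil be : measurable_fun setT (fun w => (be * Z w, vec Y w)).
Proof. by apply: measurable_fun_pair => //; exact: measurable_funM. Qed.

Let prob_dil be c : P [set w | S c (be * Z w, vec Y w)] =
  (\int[P]_y \int[P]_w (\1_(S c) (be * Z w, vec Y y))%:E)%E.
Proof.
have mA : measurable [set w | S c (be * Z w, vec Y w)].
  rewrite -[X in measurable X]setTI; have h := mdil be.
  by have := h measurableT _ (mS c).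
rewrite prob_indicE//.
pose f (z : R * 'rV[R]_m) := (\1_(S c) (be * z.1, z.2))%:E : \bar R.
have mf : measurable_fun setT f.
  apply/measurable_EFinP.
  apply: (measurableT_comp (measurable_indic (mS c))).
  apply: measurable_fun_pair => //; exact: measurable_funM.
have := @indep_fubini _ _ _ P _ _ _ _ Z (vec Y) mZ mvY ind f _ mf.
by rewrite /f/= => <-// [x y]; rewrite lee_fin.
Qed.

Theorem finite_dilation_density (be c : R) : be != 0 ->
  P [set w | \sum_(i < m) (V i w + (be - 1) * b i * Z w) ^+ 2 <= c] =
  (\int[P]_w (`|be|^-1 * tilt v be (Z w) * \1_[set w | (\sum_(i < m) V i w ^+ 2 <= c)%R] w)%:E)%E.
Proof.
move=> b0; rewrite dilE prob_dil.
have E1 : [set w | \sum_(i < m) V i w ^+ 2 <= c] = [set w | S c (Z w, vec Y w)].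
  have e w : \sum_(i < m) V i w ^+ 2 = \sum_(i < m) ((vec Y w) ord0 i + Z w * b i) ^+ 2.
    by apply: eq_bigr => i _; rewrite mxE /Y; congr (_ ^+ 2); ring.
  by apply/seteqP; split => w /=; rewrite e.
rewrite E1.
pose f (z : R * 'rV[R]_m) := (`|be|^-1 * tilt v be z.1 * \1_(S c) z)%:E : \bar R.
have mf : measurable_fun setT f.
  rewrite /f; apply/measurable_EFinP; apply: measurable_funM; last exact: measurable_indic.
  apply: measurable_funM => //; apply: measurableT_comp => //; exact: measurable_tilt.
have f0 z : (0 <= f z)%E by rewrite lee_fin !mulr_ge0// tilt_ge0.
transitivity (\int[P]_w f (Z w, vec Y w))%E; last first.
  by apply: eq_integral => w _; rewrite /f/= !indicE.
rewrite (@indep_fubini _ _ _ P _ _ _ _ Z (vec Y) mZ mvY ind f f0 mf).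
apply: eq_integral => y _.
pose h (x : R) := (\1_(S c) (x, vec Y y) : R)%:E.
have mh : measurable_fun setT h.
  have mp : measurable_fun setT (fun x : R => (x, vec Y y)) by exact: measurable_fun_pair.
  apply/measurable_EFinP; exact: (measurableT_comp (measurable_indic (mS c)) mp).
have h0 x : (0 <= h x)%E by rewrite lee_fin.
rewrite (GV_scale GZ v0 b0 h0 mh); apply: eq_integral => w _.
by rewrite /f /h -EFinM.
Qed.

Theorem finite_dilation_le (be c : R) : 1 <= `|be| ->
  (P [set w | (\sum_(i < m) (V i w + (be - 1) * b i * Z w) ^+ 2 <= c)%R] <=
   P [set w | (\sum_(i < m) V i w ^+ 2 <= c)%R])%E.
Proof.
move=> b1.
have -> : [set w | \sum_(i < m) V i w ^+ 2 <= c] =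
    [set w | \sum_(i < m) (V i w + (1 - 1) * b i * Z w) ^+ 2 <= c].
  have e w : \sum_(i < m) V i w ^+ 2 = \sum_(i < m) (V i w + (1 - 1) * b i * Z w) ^+ 2.
    by apply: eq_bigr => i _; rewrite subrr !mul0r addr0.
  by apply/seteqP; split => w /=; rewrite e.
have swap be' : P [set w | \sum_(i < m) (V i w + (be' - 1) * b i * Z w) ^+ 2 <= c] =
   (\int[P]_w P [set y | (\sum_(i < m) (Y i y + (be' * Z w) * b i) ^+ 2 <= c)%R])%E.
  rewrite dilE prob_dil.
  pose f (z : T * T) := (\1_(S c) (be' * Z z.2, vec Y z.1))%:E : \bar R.
  have mf : measurable_fun setT f.
    apply/measurable_EFinP; apply: (measurableT_comp (measurable_indic (mS c))).
    apply: measurable_fun_pair; last exact: measurableT_comp.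
    by apply: measurable_funM => //; exact: measurableT_comp.
  have f0 z : (0 <= f z)%E by rewrite lee_fin.
  rewrite (@fubini_tonelli _ _ _ _ _ P P f mf f0); apply: eq_integral => w _.
  rewrite prob_indicE; last first.
    apply: measurable_sublevel.
    apply: (measurable_sumsq (f := fun i y => Y i y + be' * Z w * b i)) => i.
    exact: measurable_funD.
  apply: eq_integral => y _; rewrite /f/=; congr EFin; rewrite !indicE.
  have e : \sum_(i < m) ((vec Y y) ord0 i + be' * Z w * b i) ^+ 2 =
      \sum_(i < m) (Y i y + be' * Z w * b i) ^+ 2.
    by apply: eq_bigr => i _; rewrite mxE.
  by congr (_%:R); congr nat_of_bool; apply/idP/idP; rewrite !inE /S /= e.
have mE (be' : R) : measurable_fun setT (fun w => P [set y | \sum_(i < m) (Y i y + (be' * Z w) * b i) ^+ 2 <= c]).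
  pose f (z : T * T) := \sum_(i < m) (Y i z.2 + be' * Z z.1 * b i) ^+ 2.
  have mf : measurable_fun setT f.
    apply: (measurable_sumsq (f := fun i (z : T * T) => Y i z.2 + be' * Z z.1 * b i)) => i.
    apply: measurable_funD; first exact: measurableT_comp.
    by apply: measurable_funM => //; apply: measurable_funM => //; exact: measurableT_comp.
  have := measurable_fun_xsection P (measurable_sublevel c mf).
  congr measurable_fun; apply/funext => v1 /=; congr (P _).
  by apply/seteqP; split => w; rewrite /xsection /= inE /f.
rewrite !swap; apply: ge0_le_integral => //.
move=> w _; apply: finite_anderson.
  by move=> a; have := GY 0 a; congr GV; apply/funext => y; rewrite mul0r add0r.
by rewrite mul1r normrM ler_peMl.
Qed.

End finite_dilation.


Section orthonormal_residual.
Context d (U : measurableType d) {R : realType} (mu : {finite_measure set U -> \bar R}).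
Variables (I : finType) (e : I -> U -> R).
Hypothesis Le : forall i, L2 mu (e i).
Hypothesis orth : forall i j, i != j -> \int[mu]_u (e i u * e j u) = 0.
(* the e i have norm 1, or vanish *)
Hypothesis norm1 : forall i, \int[mu]_u (e i u ^+ 2) = 1 \/ e i = cst 0.

Definition coef i (f : U -> R) := \int[mu]_u (f u * e i u).

Definition residual (f : U -> R) := \int[mu]_u (f u ^+ 2) - \sum_i coef i f ^+ 2.

Let proj f u := \sum_i coef i f * e i u.

Let Lproj f : L2 mu (proj f).
Proof. by apply: L2_sum => i; exact: L2Z. Qed.

Lemma coefD i f g : L2 mu f -> L2 mu g -> coef i (fun u => f u + g u) = coef i f + coef i g.
Proof.
move=> lf lg; rewrite /coef -RintD; [|exact: L2_mul..].
by apply: eq_Rintegral => u _; rewrite mulrDl.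
Qed.

Lemma coefZ i k f : L2 mu f -> coef i (fun u => k * f u) = k * coef i f.
Proof.
move=> lf; rewrite /coef -RintZ; last exact: L2_mul.
by apply: eq_Rintegral => u _; rewrite mulrA.
Qed.

Let projE f g : (\int[mu]_u (g u * proj f u) = \sum_i coef i f * coef i g) \/ ~ L2 mu g.
Proof.
have [lg|] := pselect (L2 mu g); [left|by right].
have -> : (fun u => g u * proj f u) = (fun u => \sum_i coef i f * (g u * e i u)).
  by apply/funext => u; rewrite /proj mulr_sumr; apply: eq_bigr => i _; ring.
rewrite Rint_sum => [|i]; last by apply: intgZ; exact: L2_mul.
by apply: eq_bigr => i _; rewrite RintZ; [|exact: L2_mul].
Qed.

Let coef_proj i f : coef i (proj f) = coef i f.
Proof.
rewrite {1}/coef.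
have -> : (fun u => proj f u * e i u) = (fun u => \sum_j coef j f * (e j u * e i u)).
  by apply/funext => u; rewrite /proj mulr_suml; apply: eq_bigr => j _; ring.
rewrite Rint_sum => [|j]; last by apply: intgZ; exact: L2_mul.
rewrite (eq_bigr (fun j => coef j f * \int[mu]_u (e j u * e i u))) => [|j _]; last first.
  by rewrite RintZ; [|exact: L2_mul].
rewrite (bigD1 i)//= big1 ?addr0 => [|j ji]; last by rewrite orth ?mulr0.
have -> : \int[mu]_u (e i u * e i u) = \int[mu]_u (e i u ^+ 2).
  by apply: eq_Rintegral => u _; rewrite expr2.
have [->|e0] := norm1 i; first by rewrite mulr1.
have -> : coef i f = 0; last by rewrite mul0r.
rewrite /coef e0; under eq_Rintegral do rewrite mulr0.
by rewrite /Rintegral integral0.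
Qed.

Lemma residualE f : L2 mu f -> residual f = \int[mu]_u ((f u - proj f u) ^+ 2).
Proof.
move=> lf; have lp := Lproj f.
transitivity (\int[mu]_u ((f u - 1 * proj f u) ^+ 2)); last first.
  by apply: eq_Rintegral => u _; rewrite mul1r.
rewrite Rint_sqrB// expr1n mulr1 mul1r.
have [->|//] := projE f f.
have -> : \int[mu]_u (proj f u ^+ 2) = \sum_i coef i f * coef i f.
  transitivity (\int[mu]_u (proj f u * proj f u)).
    by apply: eq_Rintegral => u _; rewrite expr2.
  by have [->|//] := projE f (proj f); apply: eq_bigr => i _; rewrite coef_proj.
rewrite /residual (eq_bigr (fun i => coef i f * coef i f)) => [|i _]; last by rewrite expr2.
by ring.
Qed.

Lemma residual_ge0 f : L2 mu f -> 0 <= residual f.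
Proof. by move=> lf; rewrite residualE//; apply: Rint_ge0 => u; exact: sqr_ge0. Qed.

Lemma residual_le f : residual f <= \int[mu]_u (f u ^+ 2).
Proof. by rewrite /residual gerBl; apply: sumr_ge0 => i _; exact: sqr_ge0. Qed.

Lemma residualD f g : L2 mu f -> L2 mu g ->
  residual (fun u => f u + g u) <= 2 * residual f + 2 * residual g.
Proof.
move=> lf lg; rewrite !residualE//; last exact: L2D.
have -> : (fun u => (f u + g u - proj (fun u => f u + g u) u) ^+ 2) =
    (fun u => ((f u - proj f u) + (g u - proj g u)) ^+ 2).
  apply/funext => u; congr (_ ^+ 2).
  have -> : proj (fun u => f u + g u) u = proj f u + proj g u.
    by rewrite /proj -big_split/=; apply: eq_bigr => i _; rewrite coefD// mulrDl.
  by ring.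
by apply: L2_sqrD_le; exact: L2B.
Qed.

Lemma residualZ k f : L2 mu f -> residual (fun u => k * f u) = k ^+ 2 * residual f.
Proof.
move=> lf; rewrite /residual mulrBr mulr_sumr -RintZ; last by case: lf.
congr (_ - _); first by apply: eq_Rintegral => u _; rewrite exprMn.
by apply: eq_bigr => i _; rewrite coefZ// exprMn.
Qed.

End orthonormal_residual.

Section atoms.
Context d (U : measurableType d) {R : realType} (mu : {finite_measure set U -> \bar R}).
Variable A : nat -> set U.
Hypothesis mA : forall j, measurable (A j).
Hypothesis genA : @measurable _ U = <<s range A >>.

Definition atom k (s : {ffun 'I_k -> bool}) : set U :=
  [set u | forall j : 'I_k, (u \in A j) = s j].

Definition type k u : {ffun 'I_k -> bool} := [ffun j : 'I_k => u \in A j].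

Lemma atomP k s u : atom s u <-> type k u = s.
Proof.
split; first by move=> h; apply/ffunP => j; rewrite ffunE.
by move=> <- j; rewrite ffunE.
Qed.

Lemma measurable_atom k (s : {ffun 'I_k -> bool}) : measurable (atom s).
Proof.
rewrite (_ : atom s = \big[setI/setT]_(j < k) (if s j then A j else ~` A j)); last first.
  rewrite -bigcap_seq; apply/seteqP; split => [u h j _|u h j] /=.
    by have := h j; case: (s j) => [/set_mem|/negbT/negP h1 /mem_set].
  have := h j (mem_index_enum _); rewrite /=; case: (s j) => [/mem_set ->//|h1].
  by apply/memNset.
by apply: bigsetI_measurable => j _; case: (s j) => //; exact: measurableC.
Qed.

Definition step k (s : {ffun 'I_k -> bool}) (u : U) : R :=
  (Num.sqrt (fine (mu (atom s))))^-1 * \1_(atom s) u.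

Let ind2 (B : set U) u : \1_B u * \1_B u = \1_B u :> R.
Proof. by rewrite indicE; case: (_ \in _); rewrite ?mulr1 ?mulr0. Qed.

Let ind_le (B : set U) u : `|\1_B u| <= 1 :> R.
Proof. by rewrite indicE; case: (_ \in _); rewrite ?normr0 ?normr1. Qed.

Lemma measurable_step k (s : {ffun 'I_k -> bool}) : measurable_fun setT (step s).
Proof. by apply: measurable_funM => //; apply: measurable_indic; exact: measurable_atom. Qed.

Lemma step_bounded k (s : {ffun 'I_k -> bool}) u :
  `|step s u| <= (Num.sqrt (fine (mu (atom s))))^-1.
Proof.
rewrite normrM ger0_norm ?invr_ge0 ?sqrtr_ge0//.
by rewrite ler_piMr ?invr_ge0 ?sqrtr_ge0.
Qed.

Lemma L2_step k (s : {ffun 'I_k -> bool}) : L2 mu (step s).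
Proof. exact: (L2_bounded mu (measurable_step s) (step_bounded s)). Qed.

Lemma Rint_indic (B : set U) : measurable B -> \int[mu]_u \1_B u = fine (mu B).
Proof. by move=> mB; rewrite /Rintegral integral_indic// setIT. Qed.

Lemma L2_indic (B : set U) : measurable B -> L2 mu (\1_B : U -> R).
Proof. by move=> mB; exact: (L2_bounded mu (measurable_indic mB) (ind_le B)). Qed.

Lemma step_orth k (s t : {ffun 'I_k -> bool}) : s != t ->
  \int[mu]_u (step s u * step t u) = 0.
Proof.
move=> st; rewrite /Rintegral integral0_eq// => u _.
have [su|su] := pselect (atom s u); last by rewrite /step indicE memNset// mulr0 mul0r.
have [tu|tu] := pselect (atom t u); last by rewrite /step (indicE _ (atom t)) memNset// !mulr0.
by move/eqP: st; move/atomP: su => <-; move/atomP: tu => <-.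
Qed.

Lemma step_norm k (s : {ffun 'I_k -> bool}) :
  \int[mu]_u (step s u ^+ 2) = 1 \/ step s = cst 0.
Proof.
set a := fine (mu (atom s)).
have a0 : 0 <= a by rewrite fine_ge0.
have [z|nz] := eqVneq a 0.
  by right; apply/funext => u; rewrite /step -/a z sqrtr0 invr0 mul0r.
left; under eq_Rintegral do rewrite exprMn (expr2 (\1_ _ _)) ind2 exprVn -/a sqr_sqrtr//.
by rewrite RintZ ?Rint_indic ?mulVf//; [exact: measurable_atom|exact/L2_intg/L2_indic/measurable_atom].
Qed.

Notation residual k := (@residual _ U R mu {ffun 'I_k -> bool} (@step k)).

Definition complete_for (f : U -> R) := (fun k => residual k f) @ \oo --> (0 : R).

Let res_ge0 k f : L2 mu f -> 0 <= residual k f.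
Proof. by move=> lf; apply: residual_ge0 => //; [exact: L2_step|exact: step_orth|exact: step_norm]. Qed.

Let resD k f g : L2 mu f -> L2 mu g ->
  residual k (fun u => f u + g u) <= 2 * residual k f + 2 * residual k g.
Proof. by move=> lf lg; apply: residualD => //; [exact: L2_step|exact: step_orth|exact: step_norm]. Qed.

Let resZ k c f : L2 mu f -> residual k (fun u => c * f u) = c ^+ 2 * residual k f.
Proof. by move=> lf; apply: residualZ => //; exact: L2_step. Qed.

Lemma complete_forD f g : L2 mu f -> L2 mu g -> complete_for f -> complete_for g ->
  complete_for (fun u => f u + g u).
Proof.
move=> lf lg cf cg.
have : (fun k => 2 * residual k f + 2 * residual k g) @ \oo --> (2 * 0 + 2 * 0 : R).
  by apply: cvgD; apply: cvgM => //; exact: cvg_cst.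
rewrite mulr0 addr0 => h; apply: (squeeze_cvgr _ _ h); last exact: cvg_cst.
by apply: nearW => k; rewrite res_ge0 ?resD//; exact: L2D.
Qed.

Lemma complete_forZ c f : L2 mu f -> complete_for f -> complete_for (fun u => c * f u).
Proof.
move=> lf cf; rewrite /complete_for.
under eq_fun do rewrite resZ//.
by rewrite -(mulr0 (c ^+ 2)); apply: cvgM => //; exact: cvg_cst.
Qed.

Lemma complete_for_closed f : L2 mu f ->
  (forall eps, 0 < eps -> exists g, [/\ L2 mu g, complete_for g &
    \int[mu]_u ((f u - g u) ^+ 2) <= eps]) -> complete_for f.
Proof.
move=> lf h; apply/cvgrPdist_le => eps eps0.
have [g [lg cg fg]] := h (eps / 4) (divr_gt0 eps0 (ltr0n _ 4)).
have eps4 : 0 < eps / 4 by rewrite divr_gt0.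
move/cvgrPdist_le : cg => /(_ _ eps4); apply: filterS => k.
rewrite !sub0r !normrN !ger0_norm ?res_ge0// => rg.
have lfg := L2B lf lg.
have := resD k lfg lg; have -> : (fun u => f u - g u + g u) = f.
  by apply/funext => u; rewrite subrK.
have := residual_le mu (@step k) (fun u => f u - g u).
lra.
Qed.

Lemma complete_for_type k0 (p : pred {ffun 'I_k0 -> bool}) :
  measurable [set u | p (type k0 u)] -> complete_for \1_[set u | p (type k0 u)].
Proof.
move=> mS; apply: cvg_near_cst; near=> k.
have k0k : (k0 <= k)%N by near: k; exact: nbhs_infty_ge.
set S := [set u | _]; pose restr (s : {ffun 'I_k -> bool}) : {ffun 'I_k0 -> bool} :=
  [ffun j => s (widen_ord k0k j)].
have rE u : restr (type k u) = type k0 u by apply/ffunP => j; rewrite !ffunE.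
have SE u : \1_S u = \sum_(s | p (restr s)) \1_(atom s) u :> R.
  have [pu|npu] := boolP (p (type k0 u)).
    rewrite indicE mem_set// (bigD1 (type k u))/= ?rE// big1 ?addr0.
      by rewrite indicE mem_set//; apply/atomP.
    move=> s /andP[_ sN]; rewrite indicE memNset// => /atomP us.
    by rewrite us eqxx in sN.
  rewrite indicE memNset/=; last exact/negP.
  rewrite big1// => s ps; rewrite indicE memNset// => /atomP us.
  by move: npu; rewrite -rE us ps.
have Satom s u : \1_S u * \1_(atom s) u = (p (restr s))%:R * \1_(atom s) u :> R.
  have [su|su] := pselect (atom s u); last by rewrite !indicE (memNset su) !mulr0.
  have <- : type k u = s by apply/atomP.
  rewrite rE !indicE; congr (_%:R * _); congr nat_of_bool.
  by apply/idP/idP => [/set_mem//|]; exact: mem_set.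
have ms (s : {ffun 'I_k -> bool}) := measurable_atom s.
have is_ (s : {ffun 'I_k -> bool}) : intg mu (\1_(atom s)) by exact/L2_intg/L2_indic.
rewrite /(residual _).
have -> : \int[mu]_u (\1_S u ^+ 2) = \sum_(s : {ffun 'I_k -> bool}) (p (restr s))%:R * fine (mu (atom s)).
  have -> : (fun u => \1_S u ^+ 2 : R) = (fun u => \sum_(s : {ffun 'I_k -> bool}) (p (restr s))%:R * \1_(atom s) u).
    apply/funext => u; rewrite expr2 ind2 SE big_mkcond/=; apply: eq_bigr => s _.
    by case: (p _); rewrite ?mul1r ?mul0r.
  rewrite Rint_sum => [|s]; last exact: intgZ.
  by apply: eq_bigr => s _; rewrite RintZ// Rint_indic.
rewrite -sumrB big1// => s _; rewrite /coef.
set a := fine (mu (atom s)).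
have a0 : 0 <= a by rewrite fine_ge0.
have -> : (fun u => \1_S u * step s u) =
    (fun u => ((Num.sqrt a)^-1 * (p (restr s))%:R) * \1_(atom s) u).
  by apply/funext => u; rewrite /step mulrCA Satom mulrA.
rewrite RintZ// Rint_indic// -/a; case: (p _); last by rewrite mulr0 !mul0r expr0n subrr.
rewrite mul1r mulr1; apply/eqP; rewrite subr_eq0; apply/eqP.
have [->|aN] := eqVneq a 0; first by rewrite mulr0 expr0n.
by rewrite exprMn exprVn sqr_sqrtr// expr2 mulKf.
Unshelve. all: by end_near. Qed.

Lemma complete_for_indic (S : set U) : measurable S -> complete_for \1_S.
Proof.
pose G : set (set U) := [set S | measurable S /\
  exists k, exists p : pred {ffun 'I_k -> bool}, S = [set u | p (type k u)]].
have GE : @measurable _ U = <<s G >>.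
  apply/seteqP; split; last first.
    by apply: smallest_sub; [exact: sigma_algebra_measurable|move=> S' []].
  rewrite genA; apply: smallest_sub; first exact: smallest_sigma_algebra.
  move=> _ [j _ <-]; apply: sub_sigma_algebra; split; first exact: mA.
  exists j.+1, (fun s => s ord_max); apply/seteqP; split => u /=; rewrite ffunE.
    exact: mem_set.
  exact: set_mem.
have GI : setI_closed G.
  move=> S1 S2 [m1 [k1 [p1 E1]]] [m2 [k2 [p2 E2]]]; split; first exact: measurableI.
  exists (maxn k1 k2), (fun s => p1 [ffun j => s (widen_ord (leq_maxl k1 k2) j)] &&
    p2 [ffun j => s (widen_ord (leq_maxr k1 k2) j)]).
  have h1 u : [ffun j => type (maxn k1 k2) u (widen_ord (leq_maxl k1 k2) j)] = type k1 u.
    by apply/ffunP => j; rewrite !ffunE.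
  have h2 u : [ffun j => type (maxn k1 k2) u (widen_ord (leq_maxr k1 k2) j)] = type k2 u.
    by apply/ffunP => j; rewrite !ffunE.
  rewrite E1 E2; apply/seteqP; split => u /=; rewrite h1 h2; first by move=> [-> ->].
  by move=> /andP[-> ->].
have cT : complete_for \1_[set: U].
  have -> : [set: U] = [set u | predT (type 0 u)] by apply/seteqP; split.
  by apply: complete_for_type; rewrite (_ : [set u | _] = setT)//; apply/seteqP; split.
move=> mS; have {mS} : <<s G >> S by rewrite -GE.
move: S; apply: (dynkin_induction (P := fun S => complete_for \1_S)) => //.
- by move=> S [mS [k [p E]]]; rewrite E in mS *; exact: complete_for_type.
- move=> S mS cS.
  have -> : \1_(~` S) = (fun u => \1_[set: U] u + (-1) * \1_S u) :> (U -> R).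
    apply/funext => u; rewrite !indicE in_setC in_setT mulN1r.
    by case: (_ \in _); rewrite /= ?subrr ?subr0.
  apply: complete_forD => //.
  + exact: L2_indic.
  + by apply: L2Z; exact: L2_indic.
  + by apply: complete_forZ => //; exact: L2_indic.
- move=> F mF tF cF.
  have mU : measurable (\bigcup_k F k) by exact: bigcupT_measurable.
  apply: complete_for_closed; first exact: L2_indic.
  pose S n := \big[setU/set0]_(k < n) F k.
  have mS n : measurable (S n) by rewrite /S -bigcup_mkord; apply: bigcup_measurable => k _; exact: mF.
  have cS n : complete_for \1_(S n).
    elim: n => [|n IH].
      have -> : \1_(S 0%N) = (fun u => 0 * \1_[set: U] u) :> (U -> R).
        by apply/funext => u; rewrite /S big_ord0 indic0 mul0r.
      by apply: complete_forZ => //; exact: L2_indic.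
    have D0 : S n `&` F n = set0.
      by apply: (@trivIset_bigsetUI _ xpredT) => // i j _ _; exact: tF.
    have -> : \1_(S n.+1) = (fun u => \1_(S n) u + \1_(F n) u) :> (U -> R).
      apply/funext => u; rewrite /S big_ord_recr/= -/(S n) !indicE in_setU.
      have [wA|] := boolP (u \in S n); have [wB|] := boolP (u \in F n); rewrite ?addr0 ?add0r//.
      have : (S n `&` F n) u by split; exact: set_mem.
      by rewrite D0.
    by apply: complete_forD => //; exact: L2_indic.
  have c1 : (fun n => \int[mu]_u ((\1_(\bigcup_k F k) u - \1_(S n) u) ^+ 2)) @ \oo --> \int[mu]_u (0 : R).
    apply: (@Rint_dct _ _ _ mu (fun n u => (\1_(\bigcup_k F k) u - \1_(S n) u) ^+ 2) _ (cst 4)) => //.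
    - by move=> n; apply: measurable_funX; apply: measurable_funB; exact: measurable_indic.
    - exact: finite_measure_integrable_cst.
    - apply: aeW => u; apply: cvg_near_cst.
      have [[k _ Fk]|nF] := pselect ((\bigcup_k F k) u).
        near=> n; rewrite !indicE mem_set; last by exists k.
        rewrite mem_set ?subrr ?expr0n//.
        rewrite /S -bigcup_mkord; exists k => //=.
        by near: n; exact: nbhs_infty_gt.
      near=> n; rewrite !indicE memNset// memNset ?subrr ?expr0n//.
      by rewrite /S -bigcup_mkord => -[j _ Fj]; apply: nF; exists j.
    - move=> n u; rewrite ger0_norm ?sqr_ge0//.
      have := ind_le (\bigcup_k F k) u; have := ind_le (S n) u.
      rewrite !ler_norml => /andP[? ?] /andP[? ?]; rewrite /cst; nra.
  move=> eps eps0; have I0 : \int[mu]_u (0 : R) = 0 by rewrite /Rintegral integral0.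
  move: c1; rewrite I0 => /cvgrPdist_le/(_ _ eps0)[n _ /(_ n (leqnn n))].
  rewrite /= sub0r normrN => h; exists (\1_(S n)); split => //; first exact: L2_indic.
  exact: le_trans (ler_norm _) h.
Unshelve. all: by end_near. Qed.

Lemma complete_for_sum (I : Type) (l : seq I) (F : I -> U -> R) :
  (forall i, L2 mu (F i)) -> (forall i, complete_for (F i)) ->
  complete_for (fun u => \sum_(i <- l) F i u).
Proof.
move=> LF cF; elim: l => [|i l IH].
  have -> : (fun u => \sum_(i <- [::]) F i u) = (fun u => 0 * \1_[set: U] u).
    by apply/funext => u; rewrite big_nil mul0r.
  apply: complete_forZ; first exact: L2_indic.
  exact: complete_for_indic.
under eq_fun do rewrite big_cons.
by apply: complete_forD => //; exact: L2_sum.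
Qed.

Import HBNNSimple.

Let nnsfun_sum (g : {nnsfun U >-> R}) : exists l : seq R, (g : U -> R) =
  (fun u => \sum_(r <- l) r * \1_(g @^-1` [set r]) u).
Proof. by eexists; apply/funext => u; rewrite fimfunE fsbig_finite. Qed.

Let complete_for_nnsfun (g : {nnsfun U >-> R}) : L2 mu g /\ complete_for g.
Proof.
have L r : L2 mu (fun u => r * \1_(g @^-1` [set r]) u).
  by apply: L2Z; apply: L2_indic.
have [l gE] := nnsfun_sum g.
split; first by rewrite gE; exact: L2_sum.
rewrite gE; apply: complete_for_sum => // r.
by apply: complete_forZ; [exact: L2_indic|exact: complete_for_indic].
Qed.

Let complete_for_nneg (f : U -> R) : L2 mu f -> (forall u, 0 <= f u) -> complete_for f.
Proof.
move=> lf f0; apply: complete_for_closed => // eps eps0.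
have mfE : measurable_fun setT (EFin \o f) by apply/measurable_EFinP; case: lf.
pose g := nnsfun_approx measurableT mfE.
have f0E u : setT u -> (0 <= (EFin \o f) u)%E by move=> _; rewrite lee_fin.
have gf u : g n u @[n --> \oo] --> f u.
  have := cvg_nnsfun_approx measurableT mfE f0E (x := u) I.
  by move/fine_cvg.
have gle n u : g n u <= f u.
  by rewrite -lee_fin /g nnsfun_approxE; exact: le_approx.
have c1 : (fun n => \int[mu]_u ((f u - g n u) ^+ 2)) @ \oo --> \int[mu]_u (0 : R).
  apply: (@Rint_dct _ _ _ mu (fun n u => (f u - g n u) ^+ 2) _ (fun u => f u ^+ 2)) => //.
  - by move=> n; apply: measurable_funX; apply: measurable_funB => //; case: lf.
  - by case: lf.
  - apply: aeW => u.
    have : f u - g n u @[n --> \oo] --> f u - f u by apply: cvgB => //; exact: cvg_cst.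
    rewrite subrr => h; rewrite -(mulr0 (0 : R)).
    by under eq_fun do rewrite expr2; exact: cvgM.
  - move=> n u; rewrite ger0_norm ?sqr_ge0// lerXn2r ?nnegrE ?subr_ge0 ?gle ?f0//.
    by rewrite gerBl.
have I0 : \int[mu]_u (0 : R) = 0 by rewrite /Rintegral integral0.
move: c1; rewrite I0 => /cvgrPdist_le/(_ _ eps0)[n _ /(_ n (leqnn n))].
rewrite /= sub0r normrN => h; exists (g n); split; [exact: (complete_for_nnsfun (g n)).1|exact: (complete_for_nnsfun (g n)).2|].
exact: le_trans (ler_norm _) h.
Qed.

Theorem complete_for_L2 (f : U -> R) : L2 mu f -> complete_for f.
Proof.
move=> lf; have mf := lf.1.
have mp : measurable_fun setT f^\+ by exact: measurable_funrpos.
have mn : measurable_fun setT f^\- by exact: measurable_funrneg.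
have p0 u : 0 <= f^\+ u by exact: funrpos_ge0.
have n0 u : 0 <= f^\- u by exact: funrneg_ge0.
have fE u : f u = f^\+ u - f^\- u by rewrite -[in LHS](funrposBneg f).
have fA u : `|f u| = f^\+ u + f^\- u.
  by rewrite -[LHS]/((Num.norm \o f) u) -funrposDneg.
have lp : L2 mu f^\+.
  by apply: (L2_le mp lf) => u; rewrite ger0_norm// fA lerDl.
have ln : L2 mu f^\-.
  by apply: (L2_le mn lf) => u; rewrite ger0_norm// fA lerDr.
have -> : f = (fun u => f^\+ u + (-1) * f^\- u) by apply/funext => u; rewrite mulN1r fE.
apply: complete_forD => //; first exact: L2Z; first exact: complete_for_nneg.
by apply: complete_forZ => //; exact: complete_for_nneg.
Qed.

Theorem bessel k (f : U -> R) : L2 mu f ->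
  \sum_(s : {ffun 'I_k -> bool}) coef mu (@step k) s f ^+ 2 <= \int[mu]_u (f u ^+ 2).
Proof. by move=> lf; rewrite -subr_ge0; exact: res_ge0. Qed.

Theorem parseval (f : U -> R) : L2 mu f ->
  (fun k => \sum_(s : {ffun 'I_k -> bool}) coef mu (@step k) s f ^+ 2) @ \oo --> \int[mu]_u (f u ^+ 2).
Proof.
move=> lf; have := complete_for_L2 lf; rewrite /complete_for => c.
have : (fun k => \int[mu]_u (f u ^+ 2) - residual k f) @ \oo --> (\int[mu]_u (f u ^+ 2) - 0).
  by apply: cvgB => //; exact: cvg_cst.
rewrite subr0; under eq_fun do rewrite /(residual _) subKr.
by [].
Qed.

End atoms.


Section parametric.
Context d (T : measurableType d) d' (U : measurableType d') {R : realType}.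
Variable mu : {sigma_finite_measure set U -> \bar R}.

Lemma measurable_Rint_param (f : T * U -> R) : measurable_fun setT f ->
  measurable_fun setT (fun w => \int[mu]_u f (w, u)).
Proof.
move=> mf; have mfE : measurable_fun setT (EFin \o f) by exact/measurable_EFinP.
rewrite /Rintegral; apply: (measurableT_comp (fine_measurable measurableT)).
rewrite (_ : (fun w => _) = (fun w => \int[mu]_u (EFin \o f)^\+ (w, u) -
    \int[mu]_u (EFin \o f)^\- (w, u))%E); last first.
  apply/funext => w; rewrite integralE; congr (_ - _)%E; apply: eq_integral => u _.
    by rewrite !funeposE.
  by rewrite !funenegE.
apply: emeasurable_funB.
  by apply: measurable_fun_fubini_tonelli_F => //; exact: measurable_funepos.
by apply: measurable_fun_fubini_tonelli_F => //; exact: measurable_funeneg.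
Qed.

Lemma measurable_section (f : T * U -> R) w : measurable_fun setT f ->
  measurable_fun setT (fun u => f (w, u)).
Proof.
by move=> mf; apply: (measurableT_comp mf); exact: measurable_fun_pair.
Qed.

End parametric.

Section ball_limit.
Context d (T : measurableType d) {R : realType} (P : probability T R).
Context d' (U : measurableType d') (mu : {finite_measure set U -> \bar R}).
Variable A : nat -> set U.
Hypothesis mA : forall j, measurable (A j).
Hypothesis genA : @measurable _ U = <<s range A >>.

Definition jointly_measurable (Y : U -> T -> R) :=
  measurable_fun setT (fun p : T * U => Y p.2 p.1).

Definition ball (Y : U -> T -> R) (c : R) : set T :=
  [set w | (\int[mu]_u (Y u w ^+ 2)%:E <= c%:E)%E].

Definition ae_L2 (Y : U -> T -> R) := {ae P, forall w, L2 mu (Y ^~ w)}.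

Definition coord k (s : {ffun 'I_k -> bool}) (Y : U -> T -> R) (w : T) : R :=
  coef mu (@step _ U R mu A k) s (Y ^~ w).

Lemma measurable_ball Y c : jointly_measurable Y -> measurable (ball Y c).
Proof.
move=> mY; rewrite -[X in measurable X]setTI.
apply: (emeasurable_fun_infty_c _ _ c%:E) => //.
apply: (@measurable_fun_fubini_tonelli_F _ _ _ _ _ mu (fun p : T * U => (Y p.2 p.1 ^+ 2)%:E)) => //.
- by apply/measurable_EFinP; exact: measurable_funX.
- by move=> p; rewrite lee_fin sqr_ge0.
Qed.

Lemma measurable_coord_proc k (s : {ffun 'I_k -> bool}) Y : jointly_measurable Y ->
  measurable_fun setT (coord s Y).
Proof.
move=> mY; rewrite /coord /coef.
apply: (@measurable_Rint_param _ _ _ _ _ mu (fun p : T * U => Y p.2 p.1 * step mu A s p.2)).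
apply: measurable_funM => //; apply: measurableT_comp => //.
exact: measurable_step.
Qed.

Lemma ballE (Y : U -> T -> R) c w : L2 mu (Y ^~ w) ->
  ball Y c w <-> \int[mu]_u (Y u w ^+ 2) <= c.
Proof. by case=> _ i2; rewrite /ball /= -EFin_Rint// lee_fin. Qed.

Lemma cvg_ball (Y : U -> T -> R) (c : R) (h : T -> R) :
  jointly_measurable Y -> ae_L2 Y -> intg P h -> (forall w, 0 <= h w) ->
  (fun k => \int[P]_w (h w * \1_[set w | \sum_(s : {ffun 'I_k -> bool}) coord s Y w ^+ 2 <= c] w))
    @ \oo --> \int[P]_w (h w * \1_(ball Y c) w).
Proof.
move=> mY LY ih h0; have mh := intgP ih.
apply: (@Rint_dct _ _ _ P (fun k w => h w * \1_[set w | \sum_(s : {ffun 'I_k -> bool}) coord s Y w ^+ 2 <= c] w) _ h) => //.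
- move=> k; apply: measurable_funM => //; apply: measurable_indic.
  apply: (@measurable_sublevel _ _ _ (fun w => \sum_(s : {ffun 'I_k -> bool}) coord s Y w ^+ 2)).
  by apply: measurable_sum => s; apply: measurable_funX; exact: measurable_coord_proc.
- by apply: measurable_funM => //; apply: measurable_indic; exact: measurable_ball.
- apply: filterS LY => w Lw; apply: cvgM; first exact: cvg_cst.
  have ps := parseval mA genA Lw; have bs k := bessel mA k Lw.
  apply: cvg_near_cst; have [Sc|Sc] := leP (\int[mu]_u (Y u w ^+ 2)) c.
    near=> k; rewrite !indicE mem_set; last exact: le_trans (bs k) Sc.
    by rewrite mem_set//; exact/ballE.
  near=> k; rewrite !indicE memNset; last first.
    apply/negP; rewrite -ltNge.
    by near: k; exact: (cvgr_gt _ ps).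
  by rewrite memNset// => /(ballE _ Lw); rewrite leNgt Sc.
- move=> k w; rewrite normrM ger0_norm// ler_piMr// indicE.
  by case: (_ \in _); rewrite ?normr0 ?normr1.
Unshelve. all: by end_near. Qed.

Lemma fine_prob_indic (B : set T) : measurable B -> fine (P B) = \int[P]_w (1 * \1_B w).
Proof.
move=> mB; under eq_Rintegral do rewrite mul1r.
by rewrite /Rintegral integral_indic// setIT.
Qed.

Lemma cvg_prob_ball (Y : U -> T -> R) (c : R) :
  jointly_measurable Y -> ae_L2 Y ->
  (fun k => fine (P [set w | \sum_(s : {ffun 'I_k -> bool}) coord s Y w ^+ 2 <= c]))
    @ \oo --> fine (P (ball Y c)).
Proof.
move=> mY LY; rewrite fine_prob_indic; last exact: measurable_ball.
have mS k : measurable [set w | \sum_(s : {ffun 'I_k -> bool}) coord s Y w ^+ 2 <= c].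
  apply: (@measurable_sublevel _ _ _ (fun w => \sum_(s : {ffun 'I_k -> bool}) coord s Y w ^+ 2)).
  by apply: measurable_sum => s; apply: measurable_funX; exact: measurable_coord_proc.
under eq_fun do rewrite fine_prob_indic//.
apply: (@cvg_ball _ _ (cst 1)) => //.
exact: finite_measure_integrable_cst.
Qed.

End ball_limit.


Section gaussian_process.
Context d (T : measurableType d) {R : realType} (P : probability T R).
Context d' (U : measurableType d') (mu : {finite_measure set U -> \bar R}).

Record gaussian_space (X : U -> T -> R) (G : (T -> R) -> Prop) : Prop := GaussianSpace {
  gaussian_space_lin : forall k Y Z, G Y -> G Z -> G (fun w => k * Y w + Z w);
  gaussian_space_GV : forall Y, G Y -> GV P Y;
  gaussian_space_int : forall (f : U -> R) (M : R), measurable_fun setT f -> (forall u, `|f u| <= M) ->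
    G (fun w => \int[mu]_u (X u w * f u));
  gaussian_space_cov : forall Z, G Z -> exists b, L2 mu b /\
    forall (f : U -> R) (M : R), measurable_fun setT f -> (forall u, `|f u| <= M) ->
    \int[mu]_u (b u * f u) = \int[P]_w ((\int[mu]_u (X u w * f u)) * Z w) }.

Variable A : nat -> set U.
Hypothesis mA : forall j, measurable (A j).
Hypothesis genA : @measurable _ U = <<s range A >>.
Variables (X : U -> T -> R) (G : (T -> R) -> Prop).
Hypothesis jX : jointly_measurable X.
Hypothesis LX : ae_L2 P mu X.
Hypothesis GX : gaussian_space X G.

Lemma gaussian_space0 : G (fun=> 0).
Proof.
have m0 : measurable_fun setT (cst 0 : U -> R) by [].
have b0 (u : U) : `|cst 0 u : R| <= 0 by rewrite normr0.
have g0 := gaussian_space_int GX m0 b0.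
have := gaussian_space_lin GX (-1) g0 g0; congr G; apply/funext => w.
by rewrite mulN1r addNr.
Qed.

Lemma gaussian_space_sum m (c : 'I_m -> R) (V : 'I_m -> T -> R) : (forall i, G (V i)) ->
  G (fun w => \sum_(i < m) c i * V i w).
Proof.
elim: m c V => [|m IH] c V GV.
  by have := gaussian_space0; congr G; apply/funext => w; rewrite big_ord0.
have := gaussian_space_lin GX (c ord0) (GV ord0) (IH (c \o lift ord0) _ (fun i => GV (lift ord0 i))).
by congr G; apply/funext => w; rewrite big_ord_recl.
Qed.

Definition shift (b : U -> R) (h : T -> R) (u : U) (w : T) : R := X u w + h w * b u.

Lemma measurable_shift b h : L2 mu b -> measurable_fun setT h -> jointly_measurable (shift b h).
Proof.
move=> Lb mh; apply: measurable_funD => //; apply: measurable_funM.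
  exact: (measurableT_comp mh measurable_fst).
exact: (measurableT_comp Lb.1 measurable_snd).
Qed.

Lemma ae_L2_shift b h : L2 mu b -> ae_L2 P mu (shift b h).
Proof. by move=> Lb; apply: filterS LX => w Lw; apply: L2D => //; exact: L2Z. Qed.

Let K k := #|{ffun 'I_k -> bool}|.

Let e k (i : 'I_(K k)) : U -> R := step mu A (enum_val i : {ffun 'I_k -> bool}).

Let V k i w := \int[mu]_u (X u w * @e k i u).

Let GVs k i : G (@V k i).
Proof. exact: (gaussian_space_int GX (measurable_step mu mA _) (step_bounded mu A _)). Qed.

Let mVs k i : measurable_fun setT (@V k i).
Proof. exact: GV_measurable (gaussian_space_GV GX (GVs i)). Qed.

Let sumE k (F : {ffun 'I_k -> bool} -> R) :
  \sum_s F s = \sum_(i < K k) F (enum_val i).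
Proof. by rewrite (reindex _ (onW_bij _ (enum_val_bij _))). Qed.

Let cvg_shift (b : U -> R) (h : T -> R) (c : R) : L2 mu b -> measurable_fun setT h ->
  (fun k => fine (P [set w | \sum_(i < K k) (V i w + h w * coef mu (@e k) i b) ^+ 2 <= c]))
    @ \oo --> fine (P (ball mu (shift b h) c)).
Proof.
move=> Lb mh.
have := cvg_prob_ball mA genA (c := c) (measurable_shift Lb mh) (ae_L2_shift h Lb).
have m1 k : measurable [set w | \sum_(i < K k) (V i w + h w * coef mu (@e k) i b) ^+ 2 <= c].
  apply: measurable_sublevel.
  apply: (measurable_sumsq (f := fun i w => V i w + h w * coef mu (@e k) i b)) => i.
  by apply: measurable_funD => //; exact: measurable_funM.
have m2 k : measurable [set w | \sum_(s : {ffun 'I_k -> bool}) coord mu A s (shift b h) w ^+ 2 <= c].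
  apply: (@measurable_sublevel _ _ _ (fun w => \sum_(s : {ffun 'I_k -> bool}) coord mu A s (shift b h) w ^+ 2)).
  apply: measurable_sum => s; apply: measurable_funX; apply: measurable_coord_proc => //.
  exact: measurable_shift.
have sE k w : L2 mu (X ^~ w) -> \sum_(s : {ffun 'I_k -> bool}) coord mu A s (shift b h) w ^+ 2 =
    \sum_(i < K k) (V i w + h w * coef mu (@e k) i b) ^+ 2.
  move=> Lw; rewrite sumE; apply: eq_bigr => i _; congr (_ ^+ 2).
  have Le (s : {ffun 'I_k -> bool}) := L2_step mu mA s.
  by rewrite /coord coefD//; [rewrite (coefZ Le)//|exact: L2Z].
suff H k : P [set w | \sum_(s : {ffun 'I_k -> bool}) coord mu A s (shift b h) w ^+ 2 <= c] =
    P [set w | \sum_(i < K k) (V i w + h w * coef mu (@e k) i b) ^+ 2 <= c].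
  by under eq_fun do rewrite H.
apply/eqP; rewrite eq_le; apply/andP; split.
  by apply: le_measure_ae => //; apply: filterS LX => w Lw /=; rewrite sE.
by apply: le_measure_ae => //; apply: filterS LX => w Lw /=; rewrite sE.
Qed.

(** ... *)
Theorem anderson (b : U -> R) (s t c : R) : L2 mu b -> `|s| <= `|t| ->
  fine (P (ball mu (shift b (cst t)) c)) <= fine (P (ball mu (shift b (cst s)) c)).
Proof.
move=> Lb st; have ht := cvg_shift (h := cst t) (c := c) Lb (measurable_cst _).
have hs := cvg_shift (h := cst s) (c := c) Lb (measurable_cst _).
apply: (ler_cvg_to ht hs).
apply: nearW => k; apply: fine_le; rewrite ?fin_num_measure//.
- apply: measurable_sublevel.
  apply: (measurable_sumsq (f := fun i (w : T) => V i w + cst t w * coef mu (@e k) i b)) => i.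
  by apply: measurable_funD => //; apply: measurable_funM.
- apply: measurable_sublevel.
  apply: (measurable_sumsq (f := fun i (w : T) => V i w + cst s w * coef mu (@e k) i b)) => i.
  by apply: measurable_funD => //; apply: measurable_funM.
- apply: (@finite_anderson _ _ _ P _ (@V k) _ (fun i => coef mu (@e k) i b)) => // a.
  by apply: (gaussian_space_GV GX); exact: gaussian_space_sum.
Qed.

(** ... *)
Theorem ball_gt0 (c : R) : 0 < c -> 0 < fine (P (ball mu X c)).
Proof.
move=> c0; rewrite lt_neqAle fine_ge0// andbT eq_sym; apply/negP => /eqP B0.
have null b : L2 mu b -> P.-negligible (ball mu (shift b (cst (-1))) c).
  move=> Lb; apply/negligibleP.
    by apply: measurable_ball; apply: measurable_shift.
  have : fine (P (ball mu (shift b (cst (-1))) c)) <= fine (P (ball mu (shift b (cst 0)) c)).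
    by apply: anderson => //; rewrite normr0.
  have -> : ball mu (shift b (cst 0)) c = ball mu X c.
    by congr ball; apply/funext => u; apply/funext => w; rewrite /shift mul0r addr0.
  rewrite B0 => h; apply/eqP; rewrite -fine_eq0 ?fin_num_measure//.
    by rewrite eq_le h fine_ge0.
  by apply: measurable_ball; apply: measurable_shift.
pose eta k : R := Num.sqrt (c / 2 / (K k).+1%:R).
have eta0 k : 0 < eta k by rewrite sqrtr_gt0 !divr_gt0.
pose r k := residual mu (@step _ U R mu A k).
pose E k (n : {ffun {ffun 'I_k -> bool} -> int}) := [set w | [/\ L2 mu (X ^~ w),
  r k (X ^~ w) <= c / 16 & forall s, Num.floor (coord mu A s X w / eta k) = n s]].
have Enull k n : P.-negligible (E k n).
  have [[w0 [L0 r0 n0]]|/set0P/negP/negPn/eqP ->] := pselect (E k n !=set0); last exact: negligible_set0.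
  apply: negligibleS (null _ L0) => w [Lw rw nw].
  rewrite /ball /= /shift.
  have Ld : L2 mu (fun u => X u w + cst (-1) w * X u w0) by apply: L2D => //; exact: L2Z.
  have Le (s : {ffun 'I_k -> bool}) := L2_step mu mA s.
  have rd : r k (fun u => X u w + -1 * X u w0) <= c / 4.
    have := residualD Le (@step_orth _ _ _ mu _ k) (@step_norm _ _ _ mu _ mA k) Lw (L2Z (-1) L0).
    rewrite (residualZ Le _ L0) sqrrN expr1n mul1r -/(r k) => h; apply: (le_trans h).
    by move: r0 rw; rewrite -/(r k); lra.
  have sd : \sum_(s : {ffun 'I_k -> bool}) coef mu (@step _ U R mu A k) s (fun u => X u w + -1 * X u w0) ^+ 2 <= c / 2.
    apply: (@le_trans _ _ (\sum_(s : {ffun 'I_k -> bool}) eta k ^+ 2)).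
      apply: ler_sum => s _; rewrite coefD//; last exact: L2Z.
      rewrite (coefZ Le)// mulN1r -/(coord mu A s X w) -/(coord mu A s X w0).
      set x := coord _ _ _ _ w; set y := coord _ _ _ _ w0.
      have xy : `|x / eta k - y / eta k| <= 1.
        have := real_floor_itv (num_real (x / eta k)); have := real_floor_itv (num_real (y / eta k)).
        rewrite (nw s) (n0 s) intrD => /andP[a1 a2] /andP[a3 a4].
        by rewrite ler_norml; apply/andP; split; lra.
      move: xy; rewrite -mulrBl normrM normfV (gtr0_norm (eta0 k)) ler_pdivrMr// mul1r => xy.
      by rewrite -(real_normK (num_real (x - y))) lerXn2r ?nnegrE// ltW.
    rewrite sumr_const -/(K k) -[X in X <= _]mulr_natr sqr_sqrtr; last by rewrite !divr_ge0// ltW.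
    rewrite -(mulrA (c / 2)) ler_piMr//; first by rewrite divr_ge0// ltW.
    by rewrite mulrC ler_pdivrMr// mul1r ler_nat.
  rewrite -EFin_Rint; last by case: Ld.
  rewrite lee_fin; move: rd sd; rewrite /r /residual /=; lra.
have cover : [set w | L2 mu (X ^~ w)] `<=` \bigcup_k \bigcup_j
    (if unpickle j is Some n then E k n else set0).
  move=> w Lw.
  have rk := complete_for_L2 mA genA Lw.
  have c16 : 0 < c / 16 by rewrite divr_gt0.
  move/cvgrPdist_le : rk => /(_ _ c16)[k _ /(_ k (leqnn k)) hk].
  exists k => //; exists (pickle [ffun s : {ffun 'I_k -> bool} => Num.floor (coord mu A s X w / eta k)]) => //.
  rewrite pickleK; split => //; last by move=> s; rewrite ffunE.
  by move: hk; rewrite /= sub0r normrN; apply: le_trans; exact: ler_norm.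
have N1 : P.-negligible [set w | L2 mu (X ^~ w)].
  apply: negligibleS cover _; apply: negligible_bigcup => k; apply: negligible_bigcup => j.
  by case: unpickle => [n|]; [exact: Enull|exact: negligible_set0].
have : P.-negligible setT.
  rewrite -(setvU [set w | L2 mu (X ^~ w)]) setUC; exact: negligibleU.
by move/negligibleP => /(_ measurableT); rewrite [LHS]probability_setT => /eqP; rewrite onee_eq0.
Qed.

Section dilation.
Variables (Z : T -> R) (b : U -> R).
Hypothesis GZ : G Z.
Hypothesis Lb : L2 mu b.
Hypothesis covb : forall (f : U -> R) (M : R), measurable_fun setT f -> (forall u, `|f u| <= M) ->
    \int[mu]_u (b u * f u) = \int[P]_w ((\int[mu]_u (X u w * f u)) * Z w).
Let v := \int[P]_w (Z w ^+ 2).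
Hypothesis v0 : 0 < v.

Definition dilated (be : R) := shift b (fun w => (be - 1) / v * Z w).

Let mZ : measurable_fun setT Z.
Proof. exact: GV_measurable (gaussian_space_GV GX GZ). Qed.

Let mh be : measurable_fun setT (fun w => (be - 1) / v * Z w).
Proof. exact: measurable_funM. Qed.

Let GZV k (s : R) (c : 'I_(K k) -> R) : GV P (fun w => s * Z w + \sum_(i < K k) c i * V i w).
Proof.
apply: (gaussian_space_GV GX); apply: (gaussian_space_lin GX) => //.
exact: gaussian_space_sum.
Qed.

Let setE k be c : [set w | \sum_(i < K k) (V i w + (be - 1) / v * Z w * coef mu (@e k) i b) ^+ 2 <= c] =
  [set w | \sum_(i < K k) (V i w + (be - 1) * ((\int[P]_w (V i w * Z w)) / v) * Z w) ^+ 2 <= c].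
Proof.
have H w : \sum_(i < K k) (V i w + (be - 1) / v * Z w * coef mu (@e k) i b) ^+ 2 =
  \sum_(i < K k) (V i w + (be - 1) * ((\int[P]_w (V i w * Z w)) / v) * Z w) ^+ 2.
  apply: eq_bigr => i _; congr ((_ + _) ^+ 2).
  rewrite /coef (covb (measurable_step mu mA _) (step_bounded mu A _)) -/(V i).
  by rewrite mulrAC -!mulrA; congr (_ * _); rewrite mulrC -mulrA; congr (_ * _); rewrite mulrC.
by apply/seteqP; split => w /=; rewrite H.
Qed.

Lemma intg_tilt be : be != 0 -> intg P (fun w => `|be|^-1 * tilt v be (Z w)).
Proof.
move=> be0.
have := GV_scale (gaussian_space_GV GX GZ) v0 be0 (h := cst 1%E) (fun=> lee01) (measurable_cst _).
rewrite integral_cst// [X in (1 * X)%E]probability_setT mul1e => /esym E.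
apply/integrableP; split.
  apply/measurable_EFinP; apply: measurable_funM => //.
  apply: measurableT_comp => //; exact: measurable_tilt.
rewrite (_ : (\int[_]_(_ in _) _)%E = 1%E) ?ltry// -[RHS]E; apply: eq_integral => w _ /=.
by rewrite mule1 ger0_norm// mulr_ge0 ?invr_ge0 ?tilt_ge0.
Qed.

Theorem dilation_density be c : be != 0 ->
  fine (P (ball mu (dilated be) c)) =
  \int[P]_w (`|be|^-1 * tilt v be (Z w) * \1_(ball mu X c) w).
Proof.
move=> be0.
have h1 := cvg_shift (c := c) Lb (mh be).
have t0 w : 0 <= `|be|^-1 * tilt v be (Z w) by rewrite mulr_ge0 ?tilt_ge0.
have h2 := cvg_ball mA genA (c := c) jX LX (intg_tilt be0) t0.
apply: (cvg_unique _ h1) => //; move: h2; apply: cvg_trans; apply: near_eq_cvg.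
apply: nearW => k; rewrite setE (finite_dilation_density (@GZV k) v0 c be0) /Rintegral.
congr fine; apply: eq_integral => w _; congr (_ * \1__ _)%:E.
by apply/seteqP; split => w' /=; rewrite sumE.
Qed.

Theorem dilation_le be c : 1 <= `|be| ->
  fine (P (ball mu (dilated be) c)) <= fine (P (ball mu X c)).
Proof.
move=> be1; have -> : ball mu X c = ball mu (shift b (cst 0)) c.
  by congr ball; apply/funext => u; apply/funext => w; rewrite /shift mul0r addr0.
have h0 := cvg_shift (h := cst 0) (c := c) Lb (measurable_cst _).
apply: (ler_cvg_to (cvg_shift (c := c) Lb (mh be)) h0).
have m0 k : measurable [set w | \sum_(i < K k) V i w ^+ 2 <= c].
  by apply: measurable_sublevel; exact: (measurable_sumsq (f := fun i w => V i w)).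
apply: nearW => k; rewrite setE.
rewrite [X in _ <= fine (P X)](_ : _ = [set w | \sum_(i < K k) V i w ^+ 2 <= c]); last first.
  have e0 w : \sum_(i < K k) (V i w + cst 0 w * coef mu (@e k) i b) ^+ 2 = \sum_(i < K k) V i w ^+ 2.
    by apply: eq_bigr => i _; rewrite mul0r addr0.
  by apply/seteqP; split => w /=; rewrite e0.
apply: fine_le; rewrite ?fin_num_measure//.
  apply: measurable_sublevel.
  apply: (measurable_sumsq (f := fun i w => V i w + (be - 1) * ((\int[P]_w (V i w * Z w)) / v) * Z w)) => i.
  by apply: measurable_funD => //; exact: measurable_funM.
exact: (finite_dilation_le (GZV (k := k))).
Qed.
End dilation.

End gaussian_process.


Section tilt_bounds.
Context {R : realType}.
Implicit Types v be z x y eta : R.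

Lemma tilt2_ge v z : 0 < v -> 3 / (8 * v) * z ^+ 2 <= tilt v 2 z.
Proof.
move=> v0; rewrite /tilt.
have -> : - (z ^+ 2 / (2 * v) * (2 ^- 2 - 1)) = 3 / (8 * v) * z ^+ 2.
  by field; rewrite gt_eqF.
by apply: le_trans (expR_ge1Dx _); rewrite lerDr.
Qed.

Lemma tilt_sub1 v be : 0 < v -> be != 0 -> exists be', 1 <= `|be'| /\
  forall eta, 0 < eta -> exists C, 0 <= C /\ forall z, `|tilt v be z - 1| <= C * z ^+ 2 + eta * tilt v be' z.
Proof.
move=> v0 be0.
have be2 : 0 < be ^- 2 by rewrite invr_gt0 exprn_even_gt0.
have tiltE be' z : tilt v be' z = expR ((1 - be' ^- 2) / (2 * v) * z ^+ 2).
  by rewrite /tilt; congr expR; move: (be' ^- 2) => k; field; rewrite gt_eqF.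
have [b1|b1] := leP 1 (be ^- 2).
  exists 1; split=> [|eta eta0]; first by rewrite normr1.
  exists ((be ^- 2 - 1) / (2 * v)); split; first by rewrite divr_ge0 ?subr_ge0// mulr_ge0// ltW.
  move=> z; set k := (be ^- 2 - 1) / (2 * v).
  have k0 : 0 <= k by rewrite divr_ge0 ?subr_ge0// mulr_ge0// ltW.
  have z2 := sqr_ge0 z.
  have E : (1 - be ^- 2) / (2 * v) * z ^+ 2 = - (k * z ^+ 2).
    by rewrite /k -mulNr -mulNr opprB.
  have kz : 0 <= k * z ^+ 2 by rewrite mulr_ge0.
  rewrite ler0_norm; last by rewrite subr_le0 tiltE E -expR0 ler_expR oppr_le0.
  have := tilt_ge0 v 1 z; have := expR_ge1Dx (- (k * z ^+ 2)).
  rewrite (tiltE be) E => h1 h2; rewrite -[X in X <= _]addr0; apply: lerD; last by rewrite mulr_ge0// ltW.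
  lra.
pose a := (1 - be ^- 2) / (2 * v).
have a0 : 0 <= a by rewrite divr_ge0 ?subr_ge0 ?mulr_ge0 // ltW.
pose s := 3 / 4 * be ^- 2 / (2 * v).
have s0 : 0 < s by rewrite divr_gt0// mulr_gt0.
exists (2 * be); split=> [|eta eta0].
  have : 1 < be ^+ 2 by move: b1; rewrite invf_lt1 ?exprn_even_gt0.
  rewrite -(real_normK (num_real be)) => h.
  rewrite normrM (gtr0_norm (ltr0n _ 2)).
  have : 1 < `|be| by rewrite -(@ltr_pXn2r _ 2)// ?nnegrE// expr1n.
  lra.
pose r := 4 * a / (eta * s ^+ 2).
exists (a * expR (a * r)); split; first by rewrite mulr_ge0 ?expR_ge0.
move=> z; set x := z ^+ 2; have x0 : 0 <= x := sqr_ge0 z.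
have g'E : tilt v (2 * be) z = tilt v be z * expR (s * x).
  rewrite !tiltE -expRD; congr expR; rewrite /s -/x; field.
  by rewrite be0 gt_eqF.
have gE : tilt v be z = expR (a * x) by rewrite tiltE.
have ax : 0 <= a * x by rewrite mulr_ge0.
rewrite ger0_norm; last by rewrite subr_ge0 gE -expR0 ler_expR.
(* 1 - e^(-y) <= y *)
have g1 : tilt v be z - 1 <= a * x * tilt v be z.
  have := expR_ge1Dx (- (a * x)); rewrite gE expRN => h.
  have e0 := expR_gt0 (a * x).
  have : (1 - a * x) * expR (a * x) <= 1 by rewrite -ler_pdivlMr// div1r.
  rewrite mulrBl mul1r; lra.
apply: (le_trans g1).
have g0 := tilt_ge0 v be z.
have [xr|xr] := leP x r.
  rewrite -[X in X <= _]addr0; apply: lerD; last by rewrite g'E !mulr_ge0 ?expR_ge0// ltW.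
  rewrite mulrAC; apply: ler_wpM2r => //; apply: ler_wpM2l => //.
  by rewrite gE ler_expR ler_wpM2l.
rewrite -[X in X <= _]add0r; apply: lerD; first by apply: mulr_ge0 => //; apply: mulr_ge0 => //; exact: expR_ge0.
rewrite g'E [X in _ <= X]mulrCA [X in X <= _]mulrC; apply: ler_wpM2l => //.
have es : (s * x) ^+ 2 / 4 <= expR (s * x).
  have -> : expR (s * x) = expR (s * x / 2) ^+ 2.
    by rewrite expr2 -expRD -splitr.
  have h := expR_ge1Dx (s * x / 2); have sx : 0 <= s * x / 2 by rewrite divr_ge0// mulr_ge0// ltW.
  have -> : (s * x) ^+ 2 / 4 = (s * x / 2) ^+ 2 by field.
  by rewrite lerXn2r ?nnegrE ?expR_ge0//; apply: le_trans h; rewrite lerDr.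
apply: (@le_trans _ _ (eta * ((s * x) ^+ 2 / 4))); last by rewrite ler_wpM2l// ltW.
have : 4 * a <= x * (eta * s ^+ 2).
  have es0 : 0 < eta * s ^+ 2 by apply: mulr_gt0 => //; exact: exprn_gt0.
  by rewrite -(ler_pdivrMr _ _ es0); exact: ltW.
move=> h; have := ler_wpM2r x0 h.
have -> : x * (eta * s ^+ 2) * x = 4 * (eta * ((s * x) ^+ 2 / 4)) by field.
lra.
Qed.

End tilt_bounds.

Section core.
Context d (T : measurableType d) {R : realType} (P : probability T R).
Context d' (U : measurableType d') (mu : {finite_measure set U -> \bar R}).
Variable A : nat -> set U.
Hypothesis mA : forall j, measurable (A j).
Hypothesis genA : @measurable _ U = <<s range A >>.
Variables (X : U -> T -> R) (G : (T -> R) -> Prop).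
Hypothesis jX : jointly_measurable X.
Hypothesis LX : ae_L2 P mu X.
Hypothesis GX : gaussian_space P mu X G.

Let p c := fine (P (ball mu X c)).

Let mB c : measurable (ball mu X c). Proof. exact: measurable_ball. Qed.

Let intg_ind h c : intg P h -> intg P (fun w => h w * \1_(ball mu X c) w).
Proof.
move=> ih; apply: (intg_le _ (intg_abs ih)).
  by apply: measurable_funM; [exact: intgP ih|exact: measurable_indic].
move=> w; rewrite normrM ler_piMr// indicE.
by case: (_ \in _); rewrite ?normr0 ?normr1.
Qed.

Let Rint_ind_le h k c : intg P h -> intg P k ->
  {ae P, forall w, ball mu X c w -> h w <= k w} ->
  \int[P]_w (h w * \1_(ball mu X c) w) <= \int[P]_w (k w * \1_(ball mu X c) w).
Proof.
move=> ih ik hk; have i1 := intg_ind c ih; have i2 := intg_ind c ik.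
pose m w := Num.min (h w * \1_(ball mu X c) w) (k w * \1_(ball mu X c) w).
have mm : measurable_fun setT m by apply: measurable_minr; [exact: intgP i1|exact: intgP i2].
rewrite (@ae_eq_Rint _ _ _ P _ m) => [|||]; [|exact: intgP i1|exact: mm|].
  apply: Rint_le => //.
    apply: (intg_le mm (intgD (intg_abs i1) (intg_abs i2))) => w.
    by rewrite /m minEle; case: ifP => _; rewrite ?lerDl ?lerDr.
  by move=> w; rewrite ge_min lexx orbT.
apply: filterS hk => w hk _; rewrite /m indicE.
have [Bw|] := boolP (w \in ball mu X c); last by rewrite !mulr0 minxx.
by rewrite !mulr1 min_l// hk//; exact: set_mem.
Qed.

Let pE c : p c = \int[P]_w \1_(ball mu X c) w.
Proof. by rewrite /Rintegral integral_indic// setIT. Qed.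

Let i1B c : intg P (\1_(ball mu X c)).
Proof. exact: (L2_intg (L2_indic P (mB c))). Qed.

Let intg_tiltZ Z be : G Z -> 0 < \int[P]_w (Z w ^+ 2) -> be != 0 ->
  intg P (fun w => tilt (\int[P]_w (Z w ^+ 2)) be (Z w)).
Proof.
move=> GZ v0 be0; have := intgZ `|be| (intg_tilt GX GZ v0 be0).
congr (intg P); apply/funext => w; by rewrite mulVKf// normr_eq0.
Qed.

Lemma tilt_moment Z be c : G Z -> 0 < \int[P]_w (Z w ^+ 2) -> 1 <= `|be| ->
  \int[P]_w (tilt (\int[P]_w (Z w ^+ 2)) be (Z w) * \1_(ball mu X c) w) <= `|be| * p c.
Proof.
move=> GZ v0 be1; have [b [Lb cb]] := gaussian_space_cov GX GZ.
have be0 : be != 0 by rewrite -normr_gt0; apply: lt_le_trans be1.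
have b0 : 0 < `|be| by rewrite normr_gt0.
have := dilation_le mA genA jX LX GX GZ Lb cb v0 c be1.
rewrite (dilation_density mA genA jX LX GX GZ Lb cb v0 c be0).
under eq_Rintegral do rewrite -mulrA.
rewrite RintZ; last by apply: intg_ind; exact: intg_tiltZ.
by rewrite mulrC ler_pdivrMr// mulrC.
Qed.

Lemma sqr_moment W c : G W ->
  \int[P]_w (W w ^+ 2 * \1_(ball mu X c) w) <= 16 / 3 * \int[P]_w (W w ^+ 2) * p c.
Proof.
move=> GW; set v := \int[P]_w (W w ^+ 2).
have LW := (gaussian_space_GV GX GW).1.
have v0 : 0 <= v by apply: Rint_ge0 => w; exact: sqr_ge0.
have : 0 < v \/ v = 0 by case: ltgtP v0 => //; [left|right].
case=> [{}v0|v0e]; last first.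
  rewrite v0e mulr0 mul0r (@ae_eq_Rint _ _ _ P _ (cst 0)); rewrite ?/Rintegral ?integral0//.
    by apply: measurable_funM; [exact: measurable_funX LW.1|exact: measurable_indic].
  have := eq0_Rint_sqr LW v0e; apply: filterS => w Hw _.
  by rewrite Hw//= expr0n mul0r.
have b2 : 1 <= `|2 : R| by rewrite ger0_norm// ler1n.
have h1 := tilt_moment c GW v0 b2.
have n2 : (2 : R) != 0 by [].
have h2 : \int[P]_w (3 / (8 * v) * W w ^+ 2 * \1_(ball mu X c) w) <=
    \int[P]_w (tilt v 2 (W w) * \1_(ball mu X c) w).
  apply: Rint_ind_le.
  - by apply: intgZ; case: LW.
  - exact: (intg_tiltZ GW v0 n2).
  - by apply: aeW => w _; exact: tilt2_ge.
have {h1 h2} := le_trans h2 h1.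
under eq_Rintegral do rewrite -mulrA.
rewrite RintZ; last by apply: intg_ind; case: LW.
rewrite mulrC (ger0_norm (ler0n _ 2)) => h.
have v3 : 0 < 3 / (8 * v) by rewrite divr_gt0// mulr_gt0.
move: h; rewrite -ler_pdivlMr// => h; apply: (le_trans h).
by rewrite le_eqVlt; apply/orP; left; apply/eqP; field; rewrite gt_eqF.
Qed.

Section concentration.
Variables (Z : T -> R).
Hypothesis GZ : G Z.
Hypothesis approxZ : forall del, 0 < del -> exists f : U -> R, exists M : R,
  [/\ measurable_fun setT f, forall u, `|f u| <= M &
      \int[P]_w ((Z w - \int[mu]_u (X u w * f u)) ^+ 2) <= del].

Lemma sqr_moment_small eps : 0 < eps -> exists c0, 0 < c0 /\ forall c, 0 < c -> c < c0 ->
  \int[P]_w (Z w ^+ 2 * \1_(ball mu X c) w) <= eps * p c.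
Proof.
move=> e0; have del0 : 0 < 3 / 64 * eps by rewrite mulr_gt0.
have [f [M [mf fM hf]]] := approxZ del0.
set Y := (fun w => \int[mu]_u (X u w * f u)).
have GY : G Y := gaussian_space_int GX mf fM.
have GW : G (fun w => Z w - Y w).
  by have := gaussian_space_lin GX (-1) GY GZ; congr G; apply/funext => w; rewrite mulN1r addrC.
have Lf : L2 mu f := L2_bounded mu mf fM.
pose F := \int[mu]_u (f u ^+ 2).
have F0 : 0 <= F by apply: Rint_ge0 => u; exact: sqr_ge0.
have LZ := (gaussian_space_GV GX GZ).1; have LY := (gaussian_space_GV GX GY).1.
have LW := (gaussian_space_GV GX GW).1.
exists (eps / (4 * F + 1)); split; first by rewrite divr_gt0// ltr_wpDl// mulr_ge0.
move=> c c0 cc.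
have p0 : 0 <= p c by rewrite fine_ge0.
have cF : 2 * (c * F) <= eps / 2.
  move: cc; rewrite ltr_pdivlMr ?ltr_wpDl ?mulr_ge0// => cc; nra.
have i1 : intg P (fun w => (2 * (c * F)) * 1) by apply: finite_measure_integrable_cst.
have i2 : intg P (fun w => 2 * (Z w - Y w) ^+ 2) by apply: intgZ; case: LW.
apply: (@le_trans _ _ (\int[P]_w ((2 * (c * F) * 1 + 2 * (Z w - Y w) ^+ 2) * \1_(ball mu X c) w))).
  apply: Rint_ind_le; [by case: LZ|exact: intgD|].
  apply: filterS LX => w Lw Bw.
  have h1 : Y w ^+ 2 <= c * F.
    apply: (le_trans (CauchySchwarz Lw Lf)); apply: ler_wpM2r => //.
    by apply/ballE.
  have := sqr_ge0 (Z w - 2 * Y w); nra.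
under eq_Rintegral do rewrite mulrDl mulr1 -(mulrA 2 (_ ^+ 2)).
rewrite RintD; [|by apply: intgZ; exact: i1B|by apply: intgZ; apply: intg_ind; case: LW].
rewrite RintZ; last by exact: i1B.
rewrite -pE RintZ; last by apply: intg_ind; case: LW.
have := sqr_moment c GW.
have := ler_wpM2r p0 cF; have := ler_wpM2r p0 hf.
rewrite -/Y; nra.
Qed.

Theorem dilated_ball_asymptotics b be eta : L2 mu b ->
  (forall (f : U -> R) (M : R), measurable_fun setT f -> (forall u, `|f u| <= M) ->
    \int[mu]_u (b u * f u) = \int[P]_w ((\int[mu]_u (X u w * f u)) * Z w)) ->
  0 < \int[P]_w (Z w ^+ 2) -> be != 0 -> 0 < eta ->
  exists c0, 0 < c0 /\ forall c, 0 < c -> c < c0 ->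
    `|fine (P (ball mu (dilated P X Z b be) c)) - `|be|^-1 * p c| <= eta * p c.
Proof.
move=> Lb cb v0 be0 eta0; set v := \int[P]_w (Z w ^+ 2) in v0.
have nb0 : 0 < `|be| by rewrite normr_gt0.
have [be' [be'1 hbe']] := tilt_sub1 v0 be0.
have nb' : 0 < `|be'| := lt_le_trans ltr01 be'1.
have be'0 : be' != 0 by rewrite -normr_gt0.
have eta2 : 0 < eta * `|be| / (2 * `|be'|) by rewrite divr_gt0 ?mulr_gt0.
have [C [C0 hC]] := hbe' _ eta2.
have eps0 : 0 < eta * `|be| / (2 * (C + 1)) by rewrite divr_gt0 ?mulr_gt0// ltr_wpDl.
have [c0 [c00 hc]] := sqr_moment_small eps0.
exists c0; split => // c cpos cc0; have {hc} hc := hc c cpos cc0.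
have p0 : 0 <= p c by rewrite fine_ge0.
rewrite (dilation_density mA genA jX LX GX GZ Lb cb v0 c be0) -/v.
have ig := intg_tiltZ GZ v0 be0; have ig' := intg_tiltZ GZ v0 be'0.
have LZ := (gaussian_space_GV GX GZ).1.
under eq_Rintegral do rewrite -mulrA.
rewrite RintZ; last exact: intg_ind.
rewrite -mulrBr normrM normfV normr_id mulrC ler_pdivrMr//.
rewrite pE -RintB; [|exact: intg_ind|exact: i1B].
apply: le_trans (Rint_abs _) _.
  by apply: intgB; [exact: intg_ind|exact: i1B].
have iZ : intg P (fun w => C * Z w ^+ 2) by apply: intgZ; case: LZ.
have it : intg P (fun w => eta * `|be| / (2 * `|be'|) * tilt v be' (Z w)) by exact: intgZ.
apply: (@le_trans _ _ (\int[P]_w ((C * Z w ^+ 2 + eta * `|be| / (2 * `|be'|) * tilt v be' (Z w)) * \1_(ball mu X c) w))).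
  apply: Rint_le.
  - by apply: intg_abs; apply: intgB; [exact: intg_ind|exact: i1B].
  - by apply: intg_ind; exact: intgD.
  - move=> w; rewrite -[X in _ - X]mul1r -mulrBl normrM (ger0_norm (_ : 0 <= \1_ _ _)) ?indicE//.
    by apply: ler_wpM2r => //; exact: hC.
under eq_Rintegral do rewrite mulrDl -mulrA -(mulrA (eta * `|be| / (2 * `|be'|))).
rewrite RintD; [|by apply: intgZ; apply: intg_ind; case: LZ|by apply: intgZ; exact: intg_ind].
rewrite RintZ; last by apply: intg_ind; case: LZ.
rewrite RintZ; last exact: intg_ind.
have t1 := tilt_moment c GZ v0 be'1.
rewrite -pE -/v in t1 *.
have t2 := ler_wpM2l (ltW eta2) t1.
have t3 := ler_wpM2l C0 hc.
apply: le_trans (lerD t3 t2) _.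
have -> : eta * `|be| / (2 * `|be'|) * (`|be'| * p c) = eta * `|be| / 2 * p c.
  by field; rewrite gt_eqF.
have -> : C * (eta * `|be| / (2 * (C + 1)) * p c) = C / (C + 1) * (eta * `|be| / 2 * p c).
  by field; rewrite gt_eqF// ltr_wpDl.
have C1 : C / (C + 1) <= 1 by rewrite ler_pdivrMr ?ltr_wpDl// mul1r lerDl.
have q0 : 0 <= eta * `|be| / 2 * p c by rewrite mulr_ge0// divr_ge0// mulr_ge0// ltW.
have := ler_wpM2r q0 C1; rewrite mul1r => h.
have -> : eta * p c * `|be| = eta * `|be| / 2 * p c + eta * `|be| / 2 * p c by field.
by rewrite lerD2r.
Qed.

End concentration.
End core.


Section L2_norm.
Context d (T : measurableType d) {R : realType} (P : {measure set T -> \bar R}).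
Implicit Types Y Z : T -> R.

Definition norm2 Y : R := Num.sqrt (\int[P]_w (Y w ^+ 2)).

Lemma norm2_ge0 Y : 0 <= norm2 Y. Proof. exact: sqrtr_ge0. Qed.

Lemma sqr_norm2 Y : norm2 Y ^+ 2 = \int[P]_w (Y w ^+ 2).
Proof. by rewrite sqr_sqrtr//; apply: Rint_ge0 => w; exact: sqr_ge0. Qed.

Lemma norm2_le Y r : 0 <= r -> \int[P]_w (Y w ^+ 2) <= r ^+ 2 -> norm2 Y <= r.
Proof. by move=> r0 h; rewrite -(ger0_norm r0) -sqrtr_sqr ler_wsqrtr. Qed.

Lemma Rint_mul_le Y Z : L2 P Y -> L2 P Z -> `|\int[P]_w (Y w * Z w)| <= norm2 Y * norm2 Z.
Proof.
move=> lY lZ; rewrite -(ler_pXn2r (n := 2))// ?nnegrE ?mulr_ge0 ?norm2_ge0//.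
by rewrite exprMn !sqr_norm2 real_normK ?num_real//; exact: CauchySchwarz.
Qed.

Lemma Rint_abs_mul_le Y Z : L2 P Y -> L2 P Z -> \int[P]_w `|Y w * Z w| <= norm2 Y * norm2 Z.
Proof.
move=> lY lZ.
have La Y' : L2 P Y' -> L2 P (fun w => `|Y' w|).
  move=> l; apply: (L2_le _ l) => [|w]; last by rewrite normr_id.
  by apply: measurableT_comp => //; case: l.
have na Y' : norm2 (fun w => `|Y' w|) = norm2 Y'.
  by rewrite /norm2; congr Num.sqrt; apply: eq_Rintegral => w _; rewrite real_normK ?num_real.
under eq_Rintegral do rewrite normrM.
by rewrite -(na Y) -(na Z); apply: le_trans (ler_norm _) _; apply: Rint_mul_le; exact: La.
Qed.

Lemma norm2D Y Z : L2 P Y -> L2 P Z -> norm2 (fun w => Y w + Z w) <= norm2 Y + norm2 Z.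
Proof.
move=> lY lZ; apply: norm2_le; first by rewrite addr_ge0 ?norm2_ge0.
have -> : \int[P]_w ((Y w + Z w) ^+ 2) = \int[P]_w ((Y w - (-1) * Z w) ^+ 2).
  by apply: eq_Rintegral => w _; rewrite mulN1r opprK.
rewrite Rint_sqrB// sqrrD !sqr_norm2.
have := Rint_mul_le lY lZ; have := ler_norm (\int[P]_w (Y w * Z w)); lra.
Qed.

Lemma norm2B Y Z : L2 P Y -> L2 P Z -> norm2 (fun w => Y w - Z w) = norm2 (fun w => Z w - Y w).
Proof.
move=> _ _; rewrite /norm2; congr Num.sqrt; apply: eq_Rintegral => w _.
by rewrite -opprB sqrrN.
Qed.

Definition L2_cvg (s : nat -> T -> R) Y := (fun m => norm2 (fun w => Y w - s m w)) @ \oo --> (0 : R).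

Lemma L2_cvg_mul (s : nat -> T -> R) Y Z : (forall m, L2 P (s m)) -> L2 P Y -> L2 P Z -> L2_cvg s Y ->
  (fun m => \int[P]_w (s m w * Z w)) @ \oo --> \int[P]_w (Y w * Z w).
Proof.
move=> ls lY lZ c; apply/subr_cvg0.
have h : (fun m => norm2 (fun w => Y w - s m w) * norm2 Z) @ \oo --> (0 : R).
  by rewrite -(mul0r (norm2 Z)); apply: cvgM => //; exact: cvg_cst.
apply: norm_cvg0; apply: (squeeze_cvgr _ _ h); last exact: cvg_cst.
apply: nearW => m; rewrite normr_ge0/= -RintB; [|exact: L2_mul..].
apply: le_trans (Rint_mul_le (L2B lY (ls m)) lZ).
rewrite -[X in X <= _]normrN le_eqVlt; apply/orP; left; apply/eqP; congr `|_|.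
have -> : \int[P]_w (s m w * Z w - Y w * Z w) = \int[P]_w ((-1) * ((Y w - s m w) * Z w)).
  by apply: eq_Rintegral => w _; ring.
by rewrite RintZ ?mulN1r ?opprK//; apply: L2_mul => //; exact: L2B.
Qed.

Lemma L2_cvg_norm (s : nat -> T -> R) Y : (forall m, L2 P (s m)) -> L2 P Y -> L2_cvg s Y ->
  (fun m => \int[P]_w (s m w ^+ 2)) @ \oo --> \int[P]_w (Y w ^+ 2).
Proof.
move=> ls lY c.
suff h : (fun m => norm2 (s m)) @ \oo --> norm2 Y.
  rewrite -sqr_norm2; under eq_fun do rewrite -sqr_norm2.
  by rewrite expr2; under eq_fun do rewrite expr2; exact: cvgM.
apply/subr_cvg0; apply: norm_cvg0; apply: (squeeze_cvgr _ _ c); last exact: cvg_cst.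
apply: nearW => m; rewrite normr_ge0/= ler_norml.
have h1 := norm2D (ls m) (L2B lY (ls m)).
have h2 := norm2D lY (L2B (ls m) lY).
have e1 : (fun w => s m w + (Y w - s m w)) = Y by apply/funext => w; ring.
have e2 : (fun w => Y w + (s m w - Y w)) = s m by apply/funext => w; ring.
rewrite e1 in h1; rewrite e2 (norm2B (ls m) lY) in h2.
by apply/andP; split; lra.
Qed.

End L2_norm.

Section gaussian_closure.
Context d (T : measurableType d) {R : realType} (P : probability T R).

Lemma lip1 (f f' : R -> R) (a b : R) : (forall x : R, is_derive x 1 f (f' x)) ->
  (forall x, `|f' x| <= 1) -> `|f a - f b| <= `|a - b|.
Proof.
move=> df f1; wlog ab : a b / a <= b => [h|].
  by have [/h//|/ltW/h] := leP a b; rewrite distrC (distrC b).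
have cf : {within `[a, b], continuous f}.
  by apply: derivable_within_continuous => x _; case: (df x).
have [c _ E] := MVT_segment ab (fun x _ => df x) cf.
by rewrite distrC E normrM (distrC a) ler_piMl.
Qed.

Lemma cos_lip (a b : R) : `|cos a - cos b| <= `|a - b|.
Proof.
apply: (@lip1 _ (fun x => - sin x)) => x.
by rewrite normrN ler_norml sin_le1 sin_geN1.
Qed.

Lemma one_sub_cos_le_abs (y : R) : 1 - cos y <= `|y|.
Proof. by rewrite -cos0 -[X in _ <= `|X|]subr0 distrC; apply: le_trans (ler_norm _) _; exact: cos_lip. Qed.

Lemma one_sub_cos_le_sqr (y : R) : 1 - cos y <= y ^+ 2 / 2.
Proof.
have -> : 1 - cos y = 2 * sin (y / 2) ^+ 2.
  have := cos2Dsin2 (y / 2); rewrite [in cos y](splitr y) cosD !expr2; lra.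
have h : `|sin (y / 2)| <= `|y / 2|.
  rewrite -[X in `|X| <= _]subr0 -[X in _ <= `|X|]subr0 -{1}sin0.
  by apply: (@lip1 _ cos) => x; rewrite ler_norml cos_le1 cos_geN1.
have -> : y ^+ 2 / 2 = 2 * (y / 2) ^+ 2 by field.
by rewrite ler_pM2l// -(real_normK (num_real (sin _))) -(real_normK (num_real (y / 2))) lerXn2r.
Qed.

Lemma GV_L2_cvg (s : nat -> T -> R) Y : (forall m, GV P (s m)) -> L2 P Y -> L2_cvg P s Y -> GV P Y.
Proof.
move=> gs lY c; split => // th t.
have ls m := (gs m).1.
have h1 : (fun m => \int[P]_w cos (th + t * s m w)) @ \oo --> \int[P]_w cos (th + t * Y w).
  have h : (fun m => `|t| * norm2 P (fun w => Y w - s m w)) @ \oo --> (0 : R).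
    by rewrite -(mulr0 `|t|); apply: cvgM => //; exact: cvg_cst.
  apply/subr_cvg0; apply: norm_cvg0; apply: (squeeze_cvgr _ _ h); last exact: cvg_cst.
  apply: nearW => m; rewrite normr_ge0/=.
  have mc Z : L2 P Z -> measurable_fun setT (fun w => th + t * Z w).
    by move=> lZ; apply: measurable_funD => //; apply: measurable_funM => //; case: lZ.
  have ic Z : L2 P Z -> intg P (fun w => cos (th + t * Z w)) by move=> /mc; exact: intg_cos.
  rewrite -RintB; [|exact: ic..].
  apply: le_trans (Rint_abs _) _; first by apply: intgB; exact: ic.
  have lD := L2B lY (ls m).
  have l1 : L2 P (cst 1) by apply: (@L2_bounded _ _ _ _ _ 1) => // x; rewrite normr1.
  apply: (@le_trans _ _ (\int[P]_w (`|t| * `|(Y w - s m w) * 1|))).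
    apply: Rint_le.
    - by apply: intg_abs; apply: intgB; exact: ic.
    - by apply: intgZ; apply: intg_abs; exact: (L2_mul lD l1).
    - move=> w; apply: le_trans (cos_lip _ _) _.
      have -> : th + t * s m w - (th + t * Y w) = - (t * (Y w - s m w)) by ring.
      by rewrite normrN normrM mulr1.
  rewrite RintZ; last by apply: intg_abs; exact: (L2_mul lD l1).
  apply: ler_wpM2l => //; apply: le_trans (Rint_abs_mul_le lD l1) _.
  rewrite [X in _ * X](_ : _ = 1) ?mulr1// /norm2.
  under eq_Rintegral do rewrite /= expr1n.
  rewrite /Rintegral integral_cst//= [X in (1 * X)%E]probability_setT mule1/=.
  by rewrite sqrtr1.
have h2 : (fun m => cos th * expR (- (t ^+ 2 * \int[P]_w (s m w ^+ 2) / 2))) @ \oo -->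
    cos th * expR (- (t ^+ 2 * \int[P]_w (Y w ^+ 2) / 2)).
  apply: cvgM; first exact: cvg_cst.
  apply: (@continuous_cvg _ _ _ _ _ _ expR); first exact: continuous_expR.
  apply: cvgN; apply: cvgM; last exact: cvg_cst.
  by apply: cvgM; [exact: cvg_cst|exact: L2_cvg_norm].
apply: (cvg_unique _ h1) => //.
have e : (fun m => \int[P]_w cos (th + t * s m w)) =
    (fun m => cos th * expR (- (t ^+ 2 * \int[P]_w (s m w ^+ 2) / 2))).
  by apply/funext => m; exact: (gs m).2.
by rewrite e.
Qed.

Variables (U : Type) (X : U -> T -> R).

Definition comb (l : seq (R * U)) (w : T) : R := \sum_(p <- l) p.1 * X p.2 w.

Definition L2_span (Y : T -> R) := L2 P Y /\
  exists l : nat -> seq (R * U), L2_cvg P (fun m => comb (l m)) Y.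

Hypothesis GVX : forall k (x : 'I_k -> U) (c : 'I_k -> R),
  GV P (fun w => \sum_(i < k) c i * X (x i) w).

Lemma GV_comb l : GV P (comb l).
Proof.
have := GVX (fun i => (tnth (in_tuple l) i).2) (fun i => (tnth (in_tuple l) i).1).
by congr GV; apply/funext => w; rewrite /comb (big_tnth _ _ l).
Qed.

Lemma L2_comb l : L2 P (comb l). Proof. by case: (GV_comb l). Qed.

Lemma L2_X u : L2 P (X u).
Proof.
have := L2_comb [:: (1, u)]; congr L2; apply/funext => w.
by rewrite /comb big_seq1 mul1r.
Qed.

Lemma comb_lin k l1 l2 w :
  comb ([seq (k * p.1, p.2) | p <- l1] ++ l2) w = k * comb l1 w + comb l2 w.
Proof.
rewrite /comb big_cat big_map/= mulr_sumr; congr (_ + _).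
by apply: eq_bigr => p _; rewrite mulrA.
Qed.

Lemma norm2Z k Y : L2 P Y -> norm2 P (fun w => k * Y w) = `|k| * norm2 P Y.
Proof.
move=> lY; rewrite /norm2 -(sqrtr_sqr k) -sqrtrM ?sqr_ge0// -RintZ; last by case: lY.
by congr Num.sqrt; apply: eq_Rintegral => w _; rewrite exprMn.
Qed.

Lemma L2_span_lin k Y Z : L2_span Y -> L2_span Z -> L2_span (fun w => k * Y w + Z w).
Proof.
move=> [lY [l1 c1]] [lZ [l2 c2]]; split; first by apply: L2D => //; exact: L2Z.
exists (fun m => [seq (k * p.1, p.2) | p <- l1 m] ++ l2 m).
have h : (fun m => `|k| * norm2 P (fun w => Y w - comb (l1 m) w) +
    norm2 P (fun w => Z w - comb (l2 m) w)) @ \oo --> (0 : R).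
  have h1 : (fun m => `|k| * norm2 P (fun w => Y w - comb (l1 m) w)) @ \oo --> `|k| * 0.
    by apply: cvgM => //; exact: cvg_cst.
  by have h2 := cvgD h1 c2; rewrite mulr0 addr0 in h2; exact: h2.
apply: (squeeze_cvgr _ _ h); last exact: cvg_cst.
apply: nearW => m; rewrite norm2_ge0/=.
have L1 := L2B lY (L2_comb (l1 m)); have L2' := L2B lZ (L2_comb (l2 m)).
rewrite -norm2Z//; apply: le_trans (norm2D (L2Z k L1) L2').
rewrite le_eqVlt; apply/orP; left; apply/eqP; congr (norm2 P _).
by apply/funext => w; rewrite comb_lin; ring.
Qed.

Lemma L2_span_GV Y : L2_span Y -> GV P Y.
Proof. by move=> [lY [l c]]; exact: (@GV_L2_cvg (fun m => comb (l m)) Y (fun m => GV_comb (l m)) lY c). Qed.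

Lemma L2_span_closed (s : nat -> T -> R) Y : (forall m, L2_span (s m)) -> L2 P Y ->
  L2_cvg P s Y -> L2_span Y.
Proof.
move=> ss lY c; split => //.
have H m : exists l, norm2 P (fun w => s m w - comb l w) <= m.+1%:R^-1.
  have [_ [l cl]] := ss m.
  have m0 : 0 < m.+1%:R^-1 :> R by rewrite invr_gt0.
  move/cvgrPdist_le : cl => /(_ _ m0)[k _ /(_ k (leqnn k))] /=.
  by rewrite sub0r normrN ger0_norm ?norm2_ge0// => h; exists (l k).
have [l hl] := choice H; exists l.
have h : (fun m => norm2 P (fun w => Y w - s m w) + m.+1%:R^-1) @ \oo --> (0 : R).
  by have h2 := cvgD c (@cvg_harmonic R); rewrite addr0 in h2; exact: h2.
apply: (squeeze_cvgr _ _ h); last exact: cvg_cst.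
apply: nearW => m; rewrite norm2_ge0/=.
have ls m := (ss m).1; apply: le_trans (lerD (lexx _) (hl m)).
apply: le_trans (norm2D (L2B lY (ls m)) (L2B (ls m) (L2_comb (l m)))).
rewrite le_eqVlt; apply/orP; left; apply/eqP; congr (norm2 P _).
by apply/funext => w; ring.
Qed.

(** ... near minimizer *)
Lemma near_orthogonal Y eta : L2 P Y -> 0 < eta -> exists l,
  norm2 P (comb l) <= 2 * norm2 P Y + eta /\ forall l', `|\int[P]_w ((Y w - comb l w) * comb l' w)| <= eta * norm2 P (comb l').
Proof.
move=> lY eta0; pose S : set R := [set x | exists l, x = \int[P]_w ((Y w - comb l w) ^+ 2)].
have S0 : S !=set0 by exists (\int[P]_w ((Y w - comb [::] w) ^+ 2)), [::].
have Slb : has_inf S.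
  by split => //; exists 0 => _ [l ->]; apply: Rint_ge0 => w; exact: sqr_ge0.
have eta2 : 0 < eta ^+ 2 by rewrite exprn_gt0.
have [_ [l ->] hl] := inf_adherent eta2 Slb.
have lR := L2B lY (L2_comb l).
have infS l' : inf S <= \int[P]_w ((Y w - comb l' w) ^+ 2) by apply: ge_inf; [case: Slb|exists l'].
exists l; split.
  have h1 : norm2 P (fun w => Y w - comb l w) <= norm2 P Y + eta.
    apply: norm2_le; first by rewrite addr_ge0 ?norm2_ge0// ltW.
    rewrite sqrrD sqr_norm2; apply: (le_trans (ltW hl)).
    have := infS [::]; under eq_Rintegral do rewrite /comb big_nil subr0.
    have : 0 <= norm2 P Y * eta *+ 2 by rewrite mulrn_wge0// mulr_ge0 ?norm2_ge0// ltW.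
    lra.
  have h2 := norm2D lY (L2B (L2_comb l) lY).
  rewrite (norm2B (L2_comb l) lY) in h2.
  have e2 : (fun w => Y w + (comb l w - Y w)) = comb l by apply/funext => w; ring.
  by rewrite e2 in h2; lra.
move=> l'; rewrite -(ler_pXn2r (n := 2))// ?nnegrE ?mulr_ge0 ?norm2_ge0 ?(ltW eta0)//.
rewrite exprMn sqr_norm2 real_normK ?num_real// -[eta ^+ 2]addr0.
apply: discr_le; first by apply: Rint_ge0 => w; exact: sqr_ge0.
move=> t; rewrite addr0.
have := infS ([seq (t * p.1, p.2) | p <- l'] ++ l).
have -> : (fun w => (Y w - comb ([seq (t * p.1, p.2) | p <- l'] ++ l) w) ^+ 2) =
    (fun w => ((Y w - comb l w) - t * comb l' w) ^+ 2).
  by apply/funext => w; rewrite comb_lin; congr (_ ^+ 2); ring.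
rewrite Rint_sqrB//; last exact: L2_comb.
lra.
Qed.

End gaussian_closure.


Section large_events.
Context d (T : measurableType d) {R : realType} (P : probability T R).

Lemma cos2_bound (Y : T -> R) (A : set T) (t : R) : GV P Y -> measurable A ->
  \int[P]_w \1_(~` A) w <= 1 / 8 -> t ^+ 2 * \int[P]_w (Y w ^+ 2) = 4 ->
  5 / 12 <= \int[P]_w ((1 - cos (t * Y w)) * \1_A w).
Proof.
move=> GY mA A8 t4; have mY := GV_measurable GY.
have mc : measurable_fun setT (fun w => t * Y w) by exact: measurable_funM.
have i1 : intg P (cst 1) by exact: finite_measure_integrable_cst.
have ic := intg_cos P mc.
have id := intgB i1 ic.
have mcA := measurableC mA.
have iA B : measurable B -> intg P (\1_B : T -> R) by move=> mB; exact/L2_intg/L2_indic.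
have id2 : intg P (fun w => (1 - cos (t * Y w)) - 2 * \1_(~` A) w).
  by apply: intgB => //; apply: intgZ; exact: iA.
have h : \int[P]_w ((1 - cos (t * Y w)) - 2 * \1_(~` A) w) <=
    \int[P]_w ((1 - cos (t * Y w)) * \1_A w).
  apply: Rint_le => //.
    apply: (intg_le _ (intg_abs id)); first by apply: measurable_funM; [exact: intgP id|exact: measurable_indic].
    by move=> w; rewrite normrM ler_piMr// indicE; case: (_ \in _); rewrite ?normr0 ?normr1.
  move=> w; rewrite !indicE in_setC; have := cos_geN1 (t * Y w).
  by case: (_ \in _); rewrite /=; lra.
apply: le_trans h; rewrite RintB//; last by apply: intgZ; exact: iA.
rewrite RintZ; last exact: iA.
rewrite RintB//.
have -> : \int[P]_w cos (t * Y w) = expR (- 2).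
  transitivity (\int[P]_w cos (0 + t * Y w)); first by apply: eq_Rintegral => w _; rewrite add0r.
  by rewrite GY.2 cos0 mul1r t4; congr expR; field.
have -> : \int[P]_w (1 : R) = 1.
  by rewrite /Rintegral integral_cst//= [X in (1 * X)%E]probability_setT mule1.
have : expR (- 2) <= 1 / 3 :> R.
  have := expR_ge1Dx (2 : R); rewrite expRN div1r => h; rewrite lef_pV2 ?posrE ?expR_gt0//; lra.
move: A8; lra.
Qed.

Lemma norm2_large_event (Y : T -> R) (A : set T) : GV P Y -> measurable A ->
  \int[P]_w \1_(~` A) w <= 1 / 8 ->
  norm2 P Y ^+ 2 <= 8 * \int[P]_w (Y w ^+ 2 * \1_A w) /\
  norm2 P Y <= 8 * \int[P]_w (`|Y w| * \1_A w).
Proof.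
move=> GY mA A8; have lY := GY.1.
have mI : measurable_fun setT (\1_A : T -> R) by exact: measurable_indic.
have bI w : `|\1_A w| <= 1 :> R by rewrite indicE; case: (_ \in _); rewrite ?normr0 ?normr1.
have lI : L2 P (\1_A : T -> R) by exact: L2_indic.
have i2 : intg P (fun w => Y w ^+ 2 * \1_A w).
  apply: (intg_le _ (intg_abs lY.2)); first by apply: measurable_funM => //; exact: intgP lY.2.
  by move=> w; rewrite normrM ler_piMr.
have i1 : intg P (fun w => `|Y w| * \1_A w).
  have mY := lY.1.
  apply: (intg_le _ (intg_abs (L2_intg lY))).
    by apply: measurable_funM => //; apply: measurableT_comp.
  by move=> w; rewrite normrM normr_id ler_piMr.
have s0 := norm2_ge0 P Y; have [s0'|sN] := eqVneq (norm2 P Y) 0.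
  rewrite s0' expr0n/=; split; rewrite mulr_ge0//; apply: Rint_ge0 => w; rewrite mulr_ge0 ?sqr_ge0//.
have {}s0 : 0 < norm2 P Y by rewrite lt_neqAle eq_sym sN.
set s := norm2 P Y in s0 sN *.
have := @cos2_bound Y A (2 / s) GY mA A8.
rewrite -sqr_norm2 -/s; have -> : (2 / s) ^+ 2 * s ^+ 2 = 4 by field.
move=> /(_ erefl) h.
have ii : intg P (fun w => (1 - cos (2 / s * Y w)) * \1_A w).
  have mY := lY.1.
  apply: (@intg_bounded _ _ _ P _ 2).
    apply: measurable_funM => //; apply: measurable_funB => //; apply: measurable_cos.
    exact: measurable_funM.
  move=> w; rewrite normrM; apply: le_trans (ler_piMr _ (bI w)) _ => //.
  by have := cos_le1 (2 / s * Y w); have := cos_geN1 (2 / s * Y w); rewrite ler_norml; lra.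
split.
  have : \int[P]_w ((1 - cos (2 / s * Y w)) * \1_A w) <= \int[P]_w (2 / s ^+ 2 * (Y w ^+ 2 * \1_A w)).
    apply: Rint_le => //; first exact: intgZ.
    move=> w; rewrite mulrA; apply: ler_wpM2r => //; apply: le_trans (one_sub_cos_le_sqr _) _.
    by rewrite le_eqVlt; apply/orP; left; apply/eqP; field.
  rewrite RintZ// => h2; have {h h2} := le_trans h h2.
  have s20 : 0 < s ^+ 2 by rewrite exprn_gt0.
  rewrite mulrAC ler_pdivlMr// => h3; have := ltW s20; lra.
have : \int[P]_w ((1 - cos (2 / s * Y w)) * \1_A w) <= \int[P]_w (2 / s * (`|Y w| * \1_A w)).
  apply: Rint_le => //; first exact: intgZ.
  move=> w; rewrite mulrA; apply: ler_wpM2r => //; apply: le_trans (one_sub_cos_le_abs _) _.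
  by rewrite normrM ger0_norm// divr_ge0// ltW.
rewrite RintZ// => h2; have {h h2} := le_trans h h2.
rewrite mulrAC ler_pdivlMr// => h3; lra.
Qed.

Lemma ae_finite_tight (N : T -> \bar R) : measurable_fun setT N -> (forall w, 0 <= N w)%E ->
  {ae P, forall w, (N w < +oo)%E} ->
  exists M : nat, \int[P]_w \1_(~` [set w | (N w <= M%:R%:E)%E]) w <= 1 / 8 :> R.
Proof.
move=> mN N0 fN; pose F (k : nat) := ~` [set w | (N w <= k%:R%:E)%E].
have mF k : measurable (F k).
  apply: measurableC; rewrite -[X in measurable X]setTI.
  exact: (emeasurable_fun_infty_c _ mN).
have h : (fun k => \int[P]_w (\1_(F k) w : R)) @ \oo --> \int[P]_w (0 : R).
  apply: (@Rint_dct _ _ _ P (fun k w => \1_(F k) w) (cst 0) (cst 1)) => //.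
  - by move=> k; apply: measurable_indic.
  - exact: finite_measure_integrable_cst.
  - apply: filterS fN => w fw; apply: cvg_near_cst.
    have : (N w \is a fin_num) by rewrite ge0_fin_numE.
    move=> /fineK Nw; near=> k; rewrite indicE memNset// /F /=.
    apply; rewrite -Nw lee_fin.
    by near: k; exact: nbhs_infty_ger.
  - by move=> k w; rewrite indicE; case: (_ \in _); rewrite ?normr0 ?normr1.
rewrite [X in _ --> X]/Rintegral integral0/= in h.
have e8 : 0 < 1 / 8 :> R by rewrite divr_gt0.
move/cvgrPdist_le : h => /(_ _ e8)[k _ /(_ k (leqnn k))] /=.
by rewrite sub0r normrN => h; exists k; exact: le_trans (ler_norm _) h.
Unshelve. all: by end_near. Qed.

(** ... *)
Lemma intg_of_ae_finite d' (U : measurableType d') (mu : {sigma_finite_measure set U -> \bar R})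
    (a : T * U -> R) (g : U -> R) :
  measurable_fun setT a -> (forall z, 0 <= a z) -> measurable_fun setT g -> (forall u, 0 <= g u) ->
  {ae P, forall w, (\int[mu]_u (a (w, u))%:E < +oo)%E} ->
  (forall u A, measurable A -> \int[P]_w \1_(~` A) w <= 1 / 8 :> R ->
    ((g u)%:E <= \int[P]_w (8 * (a (w, u) * \1_A w))%:E)%E) -> intg mu g.
Proof.
move=> ma a0 mg g0 fa ga.
have maE : measurable_fun setT (EFin \o a) by exact/measurable_EFinP.
have mN : measurable_fun setT (fun w => \int[mu]_u (a (w, u))%:E)%E.
  exact: (@measurable_fun_fubini_tonelli_F _ _ _ _ _ mu (EFin \o a)).
have N0 w : (0 <= \int[mu]_u (a (w, u))%:E)%E by apply: integral_ge0 => u _; rewrite lee_fin.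
have [M hM] := ae_finite_tight mN N0 fa.
set A := [set w | _] in hM.
have mA : measurable A.
  rewrite -[X in measurable X]setTI; exact: (emeasurable_fun_infty_c _ mN).
pose b (z : T * U) : R := 8 * (a z * \1_A z.1).
have mb : measurable_fun setT (EFin \o b).
  apply/measurable_EFinP; apply: measurable_funM => //; apply: measurable_funM => //.
  by apply: measurableT_comp => //; exact: measurable_indic.
have I0 w : 0 <= \1_A w :> R by rewrite indicE.
have b0 z : (0 <= (EFin \o b) z)%E by rewrite lee_fin !mulr_ge0.
apply/integrableP; split; first exact/measurable_EFinP.
apply: (@le_lt_trans _ _ (\int[mu]_u \int[P]_w (b (w, u))%:E)%E).
  apply: ge0_le_integral => //.
  - by apply: measurableT_comp => //; exact/measurable_EFinP.
  - exact: (@measurable_fun_fubini_tonelli_G _ _ _ _ _ P (EFin \o b)).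
  - by move=> u _; rewrite /= ger0_norm//; exact: ga.
rewrite -(@fubini_tonelli _ _ _ _ _ P mu (EFin \o b) mb b0).
apply: (@le_lt_trans _ _ (\int[P]_w (8 * M%:R)%:E)%E).
  apply: ge0_le_integral => //.
  - by move=> w _; apply: integral_ge0.
  - exact: (@measurable_fun_fubini_tonelli_F _ _ _ _ _ mu (EFin \o b)).
  move=> w _; rewrite /= (_ : (fun u => _) = (fun u => (8 * \1_A w)%:E * (a (w, u))%:E)%E); last first.
    by apply/funext => u; rewrite -EFinM /b; congr EFin; rewrite /=; ring.
  rewrite ge0_integralZl_EFin//; last 2 first.
  - by move=> u _; rewrite lee_fin.
  - by apply/measurable_EFinP; exact: (measurable_section w ma).
  have [Aw|Aw] := boolP (w \in A); last by rewrite indicE (negbTE Aw) mulr0 mul0e lee_fin mulr_ge0.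
  rewrite indicE Aw mulr1 EFinM; apply: lee_pmul => //.
  exact: set_mem Aw.
by rewrite integral_cst//= [X in (_ * X)%E]probability_setT mule1 ltry.
Qed.

End large_events.


Section process_integral.
Context d (T : measurableType d) {R : realType} (P : probability T R).
Context d' (U : measurableType d') (mu : {finite_measure set U -> \bar R}).
Variable X : U -> T -> R.
Hypothesis jX : jointly_measurable X.
Hypothesis GVX : forall k (x : 'I_k -> U) (c : 'I_k -> R),
  GV P (fun w => \sum_(i < k) c i * X (x i) w).

Let LX u : L2 P (X u) := L2_X GVX u.

Definition stdev u := norm2 P (X u).
Definition pairing (Z : T -> R) u := \int[P]_w (X u w * Z w).
Definition Xint (f : U -> R) w := \int[mu]_u (X u w * f u).

Let jX' : measurable_fun setT (fun p : U * T => X p.1 p.2).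
Proof. exact: (measurableT_comp jX (measurable_swap (T1 := U) (T2 := T))). Qed.

Lemma measurable_pairing Z : measurable_fun setT Z -> measurable_fun setT (pairing Z).
Proof.
move=> mZ; apply: (@measurable_Rint_param _ _ _ _ _ P (fun p : U * T => X p.1 p.2 * Z p.2)).
by apply: measurable_funM => //; exact: measurableT_comp.
Qed.

Lemma measurable_stdev : measurable_fun setT stdev.
Proof.
apply: measurableT_comp; first by apply: continuous_measurable_fun; exact: sqrt_continuous.
apply: (@measurable_Rint_param _ _ _ _ _ P (fun p : U * T => X p.1 p.2 ^+ 2)).
exact: measurable_funX.
Qed.

Lemma pairing_le Z u : L2 P Z -> `|pairing Z u| <= stdev u * norm2 P Z.
Proof. by move=> lZ; exact: Rint_mul_le. Qed.

Lemma measurable_Xint f : measurable_fun setT f -> measurable_fun setT (Xint f).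
Proof.
move=> mf; apply: (@measurable_Rint_param _ _ _ _ _ mu (fun p : T * U => X p.2 p.1 * f p.2)).
by apply: measurable_funM => //; exact: measurableT_comp.
Qed.

Section one_weight.
Variable f : U -> R.
Hypothesis mf : measurable_fun setT f.
Hypothesis sf : intg mu (fun u => stdev u * `|f u|).
Let C := \int[mu]_u (stdev u * `|f u|).

Lemma intg_prod_process Z : L2 P Z -> intg (P \x mu)%E (fun z => X z.2 z.1 * f z.2 * Z z.1).
Proof.
move=> lZ; have mZ := lZ.1.
have mh : measurable_fun setT (fun z : T * U => X z.2 z.1 * f z.2 * Z z.1).
  by apply: measurable_funM; [apply: measurable_funM => //|]; exact: measurableT_comp.
have mhE : measurable_fun setT (EFin \o (fun z : T * U => X z.2 z.1 * f z.2 * Z z.1)).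
  exact/measurable_EFinP.
apply/(integrable21ltyP P mu mhE) => /=.
have h := intgZ (norm2 P Z) sf.
move/integrableP : (h) => [_]; apply: le_lt_trans; apply: ge0_le_integral => //.
- by move=> u _; apply: integral_ge0.
- pose h2 (z : T * U) := (`|X z.2 z.1 * f z.2 * Z z.1|)%:E.
  have mh2 : measurable_fun setT h2 by apply/measurable_EFinP; exact: measurableT_comp.
  have h20 z : (0 <= h2 z)%E by rewrite lee_fin.
  exact: (@measurable_fun_fubini_tonelli_G _ _ _ _ _ P h2 mh2 h20).
- by apply: measurableT_comp => //; apply/measurable_EFinP; exact: intgP h.
move=> u _.
have i1 : intg P (fun w => `|X u w * Z w|) by apply: intg_abs; exact: L2_mul.
rewrite (_ : (fun w => _) = (fun w => (`|f u| * `|X u w * Z w|)%:E)); last first.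
  by apply/funext => w /=; rewrite !normrM; congr EFin; ring.
rewrite -EFin_Rint; last exact: intgZ.
rewrite RintZ// /= lee_fin; apply: le_trans (ler_norm _).
rewrite [X in _ <= X]mulrCA (mulrC `|f u|) mulrA; apply: ler_wpM2r => //.
exact: Rint_abs_mul_le.
Qed.

Lemma ae_intg_section : {ae P, forall w, intg mu (fun u => X u w * f u)}.
Proof.
have l1 : L2 P (cst 1) by apply: (@L2_bounded _ _ _ _ _ 1) => // x; rewrite normr1.
have := @ae_integrable1 _ _ _ _ _ P mu _ (intg_prod_process l1).
apply: filterS => w; congr (intg mu); apply/funext => u.
by rewrite /= mulr1.
Qed.

Lemma Xint_pairing Z : L2 P Z ->
  \int[P]_w (Xint f w * Z w) = \int[mu]_u (pairing Z u * f u).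
Proof.
move=> lZ; have h := intg_prod_process lZ; have mZ := lZ.1.
transitivity (\int[P]_w \int[mu]_u (X u w * f u * Z w)).
  apply: ae_eq_Rint.
  - by apply: measurable_funM => //; exact: measurable_Xint.
  - apply: (@measurable_Rint_param _ _ _ _ _ mu (fun z : T * U => X z.2 z.1 * f z.2 * Z z.1)).
    by apply: measurable_funM; [apply: measurable_funM => //|]; exact: measurableT_comp.
  - apply: filterS ae_intg_section => w iw _; rewrite mulrC -RintZ//.
    by apply: eq_Rintegral => u _; rewrite mulrC.
rewrite (Rint_fubini h); apply: eq_Rintegral => u _.
rewrite mulrC -RintZ; last exact: L2_mul.
by apply: eq_Rintegral => w _ /=; ring.
Qed.

Lemma Xint_pairing_le Z eta : L2 P Z -> (forall u, `|pairing Z u| <= eta * stdev u) ->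
  `|\int[P]_w (Xint f w * Z w)| <= eta * C.
Proof.
move=> lZ hZ; rewrite Xint_pairing//.
have mp := measurable_pairing lZ.1.
have h u : `|pairing Z u * f u| <= eta * (stdev u * `|f u|).
  by rewrite normrM mulrA ler_wpM2r.
have ip : intg mu (fun u => pairing Z u * f u).
  by apply: (intg_le _ (intgZ eta sf) h); exact: measurable_funM.
by apply: le_trans (Rint_abs ip) _; rewrite -RintZ//; apply: Rint_le => //;
  [exact: intg_abs|exact: intgZ].
Qed.

Let C0 : 0 <= C. Proof. by apply: Rint_ge0 => u; rewrite mulr_ge0 ?norm2_ge0. Qed.

Lemma L2_Xint : L2 P (Xint f).
Proof.
have mJ := measurable_Xint mf; split => //.
pose A N := [set w | `|Xint f w| <= N%:R].
have mA N : measurable (A N) by apply: measurable_sublevel; exact: measurableT_comp.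
pose Z N w := Xint f w * \1_(A N) w.
have mZ N : measurable_fun setT (Z N) by apply: measurable_funM => //; exact: measurable_indic.
have Zb (N : nat) w : `|Z N w| <= N%:R.
  rewrite /Z indicE; have [Aw|_] := boolP (w \in A N); last by rewrite mulr0 normr0.
  by rewrite mulr1; exact: (set_mem Aw).
have lZ N : L2 P (Z N) := L2_bounded P (mZ N) (Zb N).
have JZ N w : Xint f w * Z N w = Z N w ^+ 2.
  by rewrite /Z indicE; case: (_ \in _); rewrite ?mulr1// !mulr0 expr0n.
have Zle N : \int[P]_w (Z N w ^+ 2) <= C ^+ 2.
  have h := @Xint_pairing_le (Z N) (norm2 P (Z N)) (lZ N) _.
  have {}h := h (fun u => eq_ind _ (fun x => _ <= x) (pairing_le u (lZ N)) _ (mulrC _ _)).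
  move: h; under eq_Rintegral do rewrite JZ.
  rewrite -sqr_norm2 ger0_norm ?sqr_ge0// expr2.
  have := norm2_ge0 P (Z N); rewrite le_eqVlt => /orP[/eqP <-|n0].
    by rewrite mulr0 sqr_ge0.
  rewrite ler_pM2l// => h; rewrite -expr2.
  by rewrite lerXn2r ?nnegrE ?norm2_ge0.
pose g (N : nat) w := (Z N w ^+ 2)%:E.
have mg N : measurable_fun setT (g N) by apply/measurable_EFinP; exact: measurable_funX.
have g0 N w : (setT w -> 0 <= g N w)%E by move=> _; rewrite lee_fin sqr_ge0.
have ndg w : setT w -> nondecreasing_seq (g ^~ w).
  move=> _ m n mn; rewrite lee_fin /Z !exprMn; apply: ler_wpM2l; first exact: sqr_ge0.
  rewrite !indicE; have [/set_mem Am|_] := boolP (w \in A m); last by rewrite expr0n sqr_ge0.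
  by rewrite mem_set//; apply: le_trans Am _; rewrite ler_nat.
have h := @cvg_monotone_convergence _ _ _ P setT measurableT g mg g0 ndg.
have limg w : limn (g ^~ w) = (Xint f w ^+ 2)%:E.
  apply: lim_near_cst => //; near=> N.
  rewrite /g /Z indicE mem_set ?mulr1//.
  by near: N; exact: nbhs_infty_ger.
rewrite (eq_integral (fun w => (Xint f w ^+ 2)%:E)) in h; last by move=> w _; exact: limg.
apply/integrableP; split; first by apply/measurable_EFinP; exact: measurable_funX.
apply: (@le_lt_trans _ _ (C ^+ 2)%:E); last exact: ltry.
rewrite (_ : (\int[_]_(_ in _) _)%E = (\int[P]_w (Xint f w ^+ 2)%:E)%E); last first.
  by apply: eq_integral => w _; rewrite /= ger0_norm ?sqr_ge0.
rewrite -(cvg_lim _ h)//; apply: lime_le; first by apply/cvg_ex; eexists; exact: h.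
by apply: nearW => N; rewrite /g -EFin_Rint ?lee_fin//; case: (lZ N).
Unshelve. all: by end_near. Qed.

Lemma norm2_Xint_le : norm2 P (Xint f) <= C.
Proof.
have lJ := L2_Xint.
have h : `|\int[P]_w (Xint f w * Xint f w)| <= norm2 P (Xint f) * C.
  by apply: Xint_pairing_le => // u; rewrite mulrC; exact: pairing_le.
move: h; under eq_Rintegral do rewrite -expr2.
rewrite -sqr_norm2 ger0_norm ?sqr_ge0// expr2.
have := norm2_ge0 P (Xint f); rewrite le_eqVlt => /orP[/eqP <-//|n0].
by rewrite ler_pM2l.
Qed.

Lemma L2_span_Xint : L2_span P X (Xint f).
Proof.
have lJ := L2_Xint; split => //.
have e0 m : 0 < m.+1%:R^-1 :> R by rewrite invr_gt0.
have [l hl] := choice (fun m => near_orthogonal GVX lJ (e0 m)).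
exists l.
have H m : norm2 P (fun w => Xint f w - comb X (l m) w) ^+ 2 <= m.+1%:R^-1 * (3 * C + 1).
  have [h1 h2] := hl m; set e := m.+1%:R^-1 in h1 h2 *.
  have e1 : e <= 1 by rewrite invf_le1// ler1n.
  have ep := e0 m; rewrite -/e in ep.
  have ll := L2_comb GVX (l m); have lR := L2B lJ ll.
  rewrite sqr_norm2.
  have -> : \int[P]_w ((Xint f w - comb X (l m) w) ^+ 2) =
      \int[P]_w (Xint f w * (Xint f w - comb X (l m) w)) -
      \int[P]_w ((Xint f w - comb X (l m) w) * comb X (l m) w).
    rewrite -RintB; [|exact: L2_mul..].
    by apply: eq_Rintegral => w _; ring.
  have b1 : `|\int[P]_w (Xint f w * (Xint f w - comb X (l m) w))| <= e * C.
    apply: Xint_pairing_le => // u; have := h2 [:: (1, u)].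
    have -> : comb X [:: (1, u)] = X u by apply/funext => w; rewrite /comb big_seq1 mul1r.
    by apply: le_trans; rewrite /pairing; under eq_Rintegral do rewrite mulrC.
  have b2 := h2 (l m).
  have nC := norm2_Xint_le.
  have : e * norm2 P (comb X (l m)) <= e * (2 * C + 1) by rewrite ler_wpM2l ?(ltW ep)//; lra.
  move: b1 b2; rewrite !ler_norml; lra.
have h : (fun m => Num.sqrt (m.+1%:R^-1 * (3 * C + 1))) @ \oo --> (0 : R).
  have h0 : (fun m => m.+1%:R^-1 * (3 * C + 1)) @ \oo --> (0 * (3 * C + 1) : R).
    by apply: cvgM; [exact: cvg_harmonic|exact: cvg_cst].
  rewrite mul0r in h0; have h1 := cvg_comp _ _ h0 (@sqrt_continuous R 0).
  by rewrite sqrtr0 in h1; exact: h1.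
apply: (squeeze_cvgr _ _ h); last exact: cvg_cst.
apply: nearW => m; rewrite norm2_ge0/= -(ger0_norm (norm2_ge0 _ _)) -sqrtr_sqr.
by rewrite ler_wsqrtr.
Qed.

End one_weight.
End process_integral.


Section process_space.
Context d (T : measurableType d) {R : realType} (P : probability T R).
Context d' (U : measurableType d') (mu : {finite_measure set U -> \bar R}).
Variable X : U -> T -> R.
Hypothesis jX : jointly_measurable X.
Hypothesis GVX : forall k (x : 'I_k -> U) (c : 'I_k -> R),
  GV P (fun w => \sum_(i < k) c i * X (x i) w).

Let LX u : L2 P (X u) := L2_X GVX u.

Let GX u : GV P (X u).
Proof.
have := GV_comb GVX [:: (1, u)]; congr GV; apply/funext => w.
by rewrite /comb big_seq1 mul1r.
Qed.

Local Notation stdev := (stdev P X).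
Local Notation pairing := (pairing P X).
Local Notation Xint := (Xint mu X).

Let bI (A : set T) w : `|\1_A w| <= 1 :> R.
Proof. by rewrite indicE; case: (_ \in _); rewrite ?normr0 ?normr1. Qed.

Lemma intg_stdev_weight f : measurable_fun setT f ->
  {ae P, forall w, (\int[mu]_u `|X u w * f u|%:E < +oo)%E} ->
  intg mu (fun u => stdev u * `|f u|).
Proof.
move=> mf hf; have ms := measurable_stdev P jX.
apply: (@intg_of_ae_finite _ _ _ P _ _ mu (fun z : T * U => `|X z.2 z.1 * f z.2|)) => //.
- by apply: measurableT_comp => //; apply: measurable_funM => //; exact: measurableT_comp.
- by apply: measurable_funM => //; exact: measurableT_comp.
- by move=> u; rewrite mulr_ge0 ?norm2_ge0.
- move=> u A mA A8 /=.
  have [_ h] := norm2_large_event (GX u) mA A8.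
  have i1 : intg P (fun w => `|X u w| * \1_A w).
    have mX := (LX u).1.
    apply: (intg_le _ (intg_abs (L2_intg (LX u)))).
      apply: measurable_funM; last exact: measurable_indic.
      exact: measurableT_comp.
    by move=> w; rewrite normrM normr_id ler_piMr.
  rewrite (_ : (fun w => _) = (fun w => (8 * `|f u| * (`|X u w| * \1_A w))%:E)); last first.
    by apply/funext => w; rewrite normrM; congr EFin; ring.
  rewrite -EFin_Rint; last exact: intgZ.
  rewrite RintZ// lee_fin -mulrA mulrCA mulrC; apply: ler_wpM2l => //.
Qed.

Hypothesis X2 : {ae P, forall w, (\int[mu]_u (X u w ^+ 2)%:E < +oo)%E}.

Lemma ae_L2_process : ae_L2 P mu X.
Proof.
apply: filterS X2 => w Xw.
have mX : measurable_fun setT (X ^~ w).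
  exact: (measurable_section w jX).
split => //; apply/integrableP; split; first by apply/measurable_EFinP; exact: measurable_funX.
by under eq_integral do rewrite /= ger0_norm ?sqr_ge0//.
Qed.

Lemma L2_stdev : L2 mu stdev.
Proof.
have ms := measurable_stdev P jX; split => //.
apply: (@intg_of_ae_finite _ _ _ P _ _ mu (fun z : T * U => X z.2 z.1 ^+ 2)) => //.
- exact: measurable_funX.
- by move=> z; exact: sqr_ge0.
- exact: measurable_funX.
- by move=> u; exact: sqr_ge0.
- move=> u A mA A8 /=.
  have [h _] := norm2_large_event (GX u) mA A8.
  have i1 : intg P (fun w => X u w ^+ 2 * \1_A w).
    apply: (intg_le _ (intg_abs (LX u).2)).
      by apply: measurable_funM; [exact: intgP (LX u).2|exact: measurable_indic].
    by move=> w; rewrite normrM ler_piMr.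
  by rewrite -EFin_Rint ?RintZ//; exact: intgZ.
Qed.

Lemma intg_stdev_bounded (f : U -> R) (M : R) : measurable_fun setT f -> (forall u, `|f u| <= M) ->
  intg mu (fun u => stdev u * `|f u|).
Proof.
move=> mf fM; have ls := L2_stdev; have ms := ls.1.
apply: (intg_le _ (intgZ M (L2_intg ls))).
  by apply: measurable_funM => //; exact: measurableT_comp.
move=> u; rewrite normrM normr_id ger0_norm ?norm2_ge0// mulrC.
by apply: ler_wpM2r => //; exact: norm2_ge0.
Qed.

Lemma L2_pairing Z : L2 P Z -> L2 mu (pairing Z).
Proof.
move=> lZ; apply: (@L2_le _ _ _ mu _ (fun u => norm2 P Z * stdev u)).
- exact: (measurable_pairing P jX lZ.1).
- exact: L2Z L2_stdev.
move=> u; apply: le_trans (pairing_le GVX u lZ) _.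
by rewrite mulrC ler_norm.
Qed.

Theorem gaussian_space_span : gaussian_space P mu X (L2_span P X).
Proof.
split.
- by move=> k Y Z; exact: (L2_span_lin GVX).
- by move=> Y; exact: (L2_span_GV GVX).
- by move=> f M mf fM; apply: (L2_span_Xint jX GVX mf); exact: intg_stdev_bounded fM.
- move=> Z [lZ _]; exists (pairing Z); split; first exact: L2_pairing.
  move=> f M mf fM; have := Xint_pairing jX GVX mf (intg_stdev_bounded mf fM) lZ.
  by move=> <-.
Qed.

Section random_integral.
Variables (f : nat -> U -> R) (phi : U -> R) (I : T -> R).
Hypothesis mf : forall k, measurable_fun setT (f k).
Hypothesis mphi : measurable_fun setT phi.
Hypothesis fphi : forall u, (f ^~ u) @ \oo --> phi u.
Hypothesis fle : forall k u, `|f k u| <= `|phi u|.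
Hypothesis Xf : forall k, {ae P, forall w, (\int[mu]_u `|X u w * f k u|%:E < +oo)%E}.
Hypothesis mI : measurable_fun setT I.
Hypothesis XfI : (fun k => \int[P]_w ((Xint (f k) w - I w) ^+ 2)%:E)%E @ \oo --> 0%E.

Let sf k : intg mu (fun u => stdev u * `|f k u|) := intg_stdev_weight (mf k) (Xf k).
Let LJ k : L2 P (Xint (f k)) := L2_Xint jX GVX (mf k) (sf k).

Let spanJ k : L2_span P X (Xint (f k)) := L2_span_Xint jX GVX (mf k) (sf k).

Lemma L2_random_integral : L2 P I.
Proof.
move/fine_cvgP : XfI => [[k _ /(_ k (leqnn k)) hk] _].
have lD : L2 P (fun w => Xint (f k) w - I w).
  have mD : measurable_fun setT (fun w => Xint (f k) w - I w).
    by apply: measurable_funB => //; exact: (LJ k).1.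
  split => //; apply/integrableP; split; first by apply/measurable_EFinP; exact: measurable_funX.
  rewrite (eq_integral (fun w => ((Xint (f k) w - I w) ^+ 2)%:E)) => [|w _]; last first.
    by rewrite /= ger0_norm ?sqr_ge0.
  by move: hk; rewrite ge0_fin_numE//; apply: integral_ge0 => w _; rewrite lee_fin sqr_ge0.
have := L2B (LJ k) lD; congr L2; apply/funext => w; ring.
Qed.
Let LI := L2_random_integral.

Let cvgJ : L2_cvg P (fun k => Xint (f k)) I.
Proof.
move/fine_cvgP : XfI => [_ h].
have h1 := cvg_comp _ _ h (@sqrt_continuous R 0).
rewrite sqrtr0 in h1; move: h1; apply: cvg_trans; apply: near_eq_cvg.
apply: nearW => k; rewrite (norm2B LI (LJ k)) /norm2 /=.
by congr Num.sqrt.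
Qed.

Lemma span_random_integral : L2_span P X I.
Proof. exact: (L2_span_closed GVX spanJ LI cvgJ). Qed.

Let cvg_weighted (h : U -> R) : measurable_fun setT h -> intg mu (fun u => h u * phi u) ->
  (fun k => \int[mu]_u (h u * f k u)) @ \oo --> \int[mu]_u (h u * phi u).
Proof.
move=> mh ih.
apply: (@Rint_dct _ _ _ mu (fun k u => h u * f k u) _ (fun u => `|h u * phi u|)) => //.
- by move=> k; exact: measurable_funM.
- exact: measurable_funM.
- exact: intg_abs.
- by apply: aeW => u; apply: cvgM => //; exact: cvg_cst.
- by move=> k u; rewrite !normrM ler_wpM2l.
Qed.

Lemma pairing_random_integral u : intg mu (fun y => pairing (X u) y * phi y) ->
  pairing I u = \int[mu]_y (pairing (X u) y * phi y).
Proof.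
move=> ih; have h1 := cvg_weighted (measurable_pairing P jX (LX u).1) ih.
have h2 := L2_cvg_mul LJ LI (LX u) cvgJ.
have e : (fun k => \int[P]_w (Xint (f k) w * X u w)) =
    (fun k => \int[mu]_y (pairing (X u) y * f k y)).
  by apply/funext => k; exact: (Xint_pairing jX GVX (mf k) (sf k) (LX u)).
rewrite e in h2; rewrite (cvg_unique _ h1 h2)// /pairing.
by apply: eq_Rintegral => w _; rewrite mulrC.
Qed.

Lemma variance_random_integral : intg mu (fun u => pairing I u * phi u) ->
  \int[P]_w (I w ^+ 2) = \int[mu]_u (pairing I u * phi u).
Proof.
move=> ih; have h1 := cvg_weighted (measurable_pairing P jX mI) ih.
have h2 := L2_cvg_mul LJ LI LI cvgJ.
have e : (fun k => \int[P]_w (Xint (f k) w * I w)) =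
    (fun k => \int[mu]_y (pairing I y * f k y)).
  by apply/funext => k; exact: (Xint_pairing jX GVX (mf k) (sf k) LI).
rewrite e in h2; by rewrite -(cvg_unique _ h2 h1)//.
Qed.

Let truncate k : exists h : nat -> U -> R, [/\ forall j, measurable_fun setT (h j),
  forall j u, `|h j u| <= j%:R & (fun j => norm2 P (fun w => Xint (f k) w - Xint (h j) w)) @ \oo --> (0 : R)].
Proof.
pose A (j : nat) := [set u | `|f k u| <= j%:R].
have mA j : measurable (A j) by apply: measurable_sublevel; exact: measurableT_comp.
pose h j u := f k u * \1_(A j) u.
have mh j : measurable_fun setT (h j) by apply: measurable_funM => //; exact: measurable_indic.
have hb (j : nat) u : `|h j u| <= j%:R.
  rewrite /h indicE; have [Au|_] := boolP (u \in A j); last by rewrite mulr0 normr0.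
  by rewrite mulr1; exact: (set_mem Au).
exists h; split => //.
have ms := measurable_stdev P jX.
pose r j u := f k u - h j u.
have mr j : measurable_fun setT (r j) by exact: measurable_funB.
have rle j u : `|r j u| <= `|f k u|.
  by rewrite /r /h indicE; case: (_ \in _); rewrite ?mulr1 ?mulr0 ?subrr ?subr0 ?normr0.
have mnr j : measurable_fun setT (fun u => stdev u * `|r j u|).
  by apply: measurable_funM => //; exact: measurableT_comp.
have dle j u : `|stdev u * `|r j u| | <= stdev u * `|f k u|.
  by rewrite normrM normr_id ger0_norm ?norm2_ge0// ler_wpM2l ?norm2_ge0.
have sr j : intg mu (fun u => stdev u * `|r j u|) := intg_le (mnr j) (sf k) (dle j).
have c0 : (fun j => \int[mu]_u (stdev u * `|r j u|)) @ \oo --> \int[mu]_u (0 : R).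
  apply: (@Rint_dct _ _ _ mu (fun j u => stdev u * `|r j u|) (cst 0) _ _ _ (sf k)) => //.
  apply: aeW => u; apply: cvg_near_cst; near=> j.
  rewrite /r /h indicE mem_set ?mulr1 ?subrr ?normr0 ?mulr0//.
  by near: j; exact: nbhs_infty_ger.
rewrite [X in _ --> X]/Rintegral integral0/= in c0.
apply: (squeeze_cvgr _ _ c0); last exact: cvg_cst.
apply: nearW => j; rewrite norm2_ge0/=.
apply: le_trans (norm2_Xint_le jX GVX (mr j) (sr j)).
have sh := intg_stdev_bounded (mh j) (hb j).
have mJ g : measurable_fun setT g -> measurable_fun setT (Xint g) by exact: measurable_Xint.
rewrite le_eqVlt; apply/orP; left; apply/eqP; rewrite /norm2; congr Num.sqrt.
apply: ae_eq_Rint.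
- by apply: measurable_funX; apply: measurable_funB; exact: mJ.
- by apply: measurable_funX; exact: mJ.
have a1 := ae_intg_section jX GVX (mf k) (sf k).
have a2 := ae_intg_section jX GVX (mh j) sh.
apply: filterS2 a1 a2 => w w1 w2 _; congr (_ ^+ 2).
rewrite /Xint -RintB//; apply: eq_Rintegral => u _.
by rewrite /r mulrBr.
Unshelve. all: by end_near. Qed.

Lemma bounded_approximation del : 0 < del -> exists h : U -> R, exists M : R,
  [/\ measurable_fun setT h, forall u, `|h u| <= M &
      \int[P]_w ((I w - \int[mu]_u (X u w * h u)) ^+ 2) <= del].
Proof.
move=> d0; pose r := Num.min 1 (del / 4).
have r0 : 0 < r by rewrite lt_min ltr01 divr_gt0.
have r1 : r <= 1 by rewrite ge_min lexx.
have rd : r <= del / 4 by rewrite ge_min lexx orbT.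
move/cvgrPdist_le : cvgJ => /(_ _ r0)[k _ /(_ k (leqnn k))] /=.
rewrite sub0r normrN ger0_norm ?norm2_ge0// => hk.
have [h [mh hb ch]] := truncate k.
move/cvgrPdist_le : ch => /(_ _ r0)[j _ /(_ j (leqnn j))] /=.
rewrite sub0r normrN ger0_norm ?norm2_ge0// => hj.
exists (h j), j%:R; split => //.
have lh : L2 P (Xint (h j)) := L2_Xint jX GVX (mh j) (intg_stdev_bounded (mh j) (hb j)).
have := norm2D (L2B LI (LJ k)) (L2B (LJ k) lh).
have -> : (fun w => I w - Xint (f k) w + (Xint (f k) w - Xint (h j) w)) =
   (fun w => I w - Xint (h j) w) by apply/funext => w; ring.
rewrite -[X in X <= del](sqr_norm2 P (fun w => I w - Xint (h j) w)) => h1.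
have := norm2_ge0 P (fun w => I w - Xint (h j) w); nra.
Qed.

End random_integral.
End process_space.


Section euclidean_facts.
Context {R : realType} (n : nat).

Definition rational_halfspace (j : nat) : set 'rV[R]_n :=
  if unpickle j is Some (i, q) then [set x | ratr (q : rat) < x ord0 (i : 'I_n)] else set0.

Lemma measurable_rational_halfspace j : measurable (rational_halfspace j).
Proof.
rewrite /rational_halfspace; case: unpickle => [[i q]|]; last exact: measurable0.
have := measurable_coord i measurableT (@measurable_itv R `]ratr q, +oo[).
by rewrite setTI; congr measurable; apply/seteqP; split => x /=; rewrite in_itv/= andbT.
Qed.

Lemma rational_halfspace_generate : @measurable _ 'rV[R]_n = <<s range rational_halfspace >>.
Proof.
apply/seteqP; split; last first.
  apply: smallest_sub; first exact: sigma_algebra_measurable.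
  by move=> _ [j _ <-]; exact: measurable_rational_halfspace.
pose V := g_sigma_algebraType (range rational_halfspace).
suff h : measurable_fun [set: V] (id : V -> 'rV[R]_n).
  by move=> S mS; have := h measurableT _ mS; rewrite setTI.
apply: measurable_fun_rV => i.
apply: (@measurability _ _ V (measurableTypeR R) setT _ (@RGenOInfty.G R) (RGenOInfty.measurableE R)).
move=> _ [_ [a ->] <-].
rewrite setTI.
have -> : (fun x : V => (id x : 'rV[R]_n) ord0 i) @^-1` `]a, +oo[%classic =
    \bigcup_(q : rat) (if a < ratr q then rational_halfspace (pickle (i, q)) else set0).
  apply/seteqP; split => x /=; rewrite in_itv/= andbT.
    move=> /rat_in_itvoo[q]; rewrite in_itv/= => /andP[aq qx].
    by exists q => //; rewrite aq /rational_halfspace pickleK.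
  move=> [q _]; case: ifP => // aq; rewrite /rational_halfspace pickleK /=.
  exact: lt_trans.
apply: bigcupT_measurable_rat => q; case: ifP => _; last exact: measurable0.
by apply: sub_sigma_algebra; exists (pickle (i, q)).
Qed.

Lemma lebesgue_rV_bounded (D : set 'rV[R]_n) : measurable D -> bounded_set D ->
  (lebesgue_rV n D < +oo)%E.
Proof.
move=> mD [M [_ hM]]; pose b := `|M| + 1.
have b0 : 0 <= b by rewrite addr_ge0.
have Mb : M < b by apply: (le_lt_trans (ler_norm M)); rewrite ltrDl.
pose B : set 'rV[R]_n := [set x | forall i, x ord0 i \in `](- (b + 1)), b]].
have DB : D `<=` B.
  move=> x Dx i; have hx := hM _ Mb _ Dx.
  have : `|x ord0 i| <= b.
    apply: le_trans hx.
    have /mapP[j Hj ->] : `|x ord0 i| \in [seq `|x x0.1 x0.2| | x0 : 'I_1 * 'I_n].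
      by apply/mapP; exists (ord0, i) => //=; rewrite mem_enum.
    by rewrite [leRHS]/Num.norm /= mx_normrE; apply/bigmax_geP; right => /=; exists j.
  by rewrite in_itv/= ler_norml => /andP[h1 ->]; rewrite andbT; lra.
have mB : measurable B.
  have -> : B = \bigcap_(i in [set: 'I_n]) ((fun x : 'rV[R]_n => x ord0 i) @^-1` `](- (b + 1)), b]%classic).
    by apply/seteqP; split => [x h i _|x h i]; [exact: h|exact: h].
  apply: fin_bigcap_measurable => [|i _]; first exact: finite_finset.
  by rewrite -[X in measurable X]setTI; exact: measurable_coord.
apply: (@le_lt_trans _ _ (lebesgue_rV n B)); first by apply: le_measure; rewrite ?inE.
rewrite /B (lebesgue_rV_box (a := fun=> - (b + 1)) (b := fun=> b)) ?ltry// => i.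
lra.
Qed.

Lemma L2norm_ball (D : set 'rV[R]_n) (mD : measurable D) (Doo : (lebesgue_rV n D < +oo)%E)
    (f g : 'rV[R]_n -> R) (e : R) : 0 < e -> measurable_fun setT g ->
  (forall u, D u -> f u = g u) ->
  (L2norm D f <= e%:E)%E = (\int[mfrestr mD Doo]_u (g u ^+ 2)%:E <= (e ^+ 2)%:E)%E.
Proof.
move=> e0 mg fg.
have mg2 : measurable_fun setT (fun u => (g u ^+ 2)%:E).
  by apply/measurable_EFinP; exact: measurable_funX.
have g20 u : (0 <= (g u ^+ 2)%:E)%E by rewrite lee_fin sqr_ge0.
rewrite (ge0_integral_mfrestr mD Doo g20 mg2) integral_mkcond.
have -> : (\int[lebesgue_rV n]_x ((fun u => (g u ^+ 2)%:E) \_ D) x =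
    \int[lebesgue_rV n]_x (`|(EFin \o (f \_ D)) x| `^ 2))%E.
  apply: eq_integral => u _; rewrite /patch/=; case: ifPn => uD.
    rewrite (fg _ (set_mem uD)) -(real_normK (num_real (g u))).
    by rewrite -powR_mulrn.
  by rewrite normr0 powR0 ?pnatr_eq0.
rewrite /L2norm -(poweR_Lnorm _ (EFin \o (f \_ D)) (r := 2)) ?pnatr_eq0//.
have N0 := Lnorm_ge0 (lebesgue_rV n) 2%:E (EFin \o (f \_ D)).
move: ('N[_]_2%:E[_])%E N0 => [x| |]//=; last first.
  by move=> _; rewrite pnatr_eq0/= !leye_eq.
rewrite !lee_fin => x0; rewrite powR_mulrn//.
by rewrite ler_sqr ?nnegrE// ltW.
Qed.

End euclidean_facts.


Section field_on_domain.
Context d (T : measurableType d) {R : realType} (P : probability T R) (n : nat).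
Variables (D : set 'rV[R]_n) (X : 'rV[R]_n -> T -> R).
Hypothesis mD : measurable D.
Hypothesis Doo : (lebesgue_rV n D < +oo)%E.
Local Notation mu := (lebesgue_rV n).
Local Notation mu0 := (mfrestr mD Doo).

Definition zero_extension (u : 'rV[R]_n) (w : T) : R := if u \in D then X u w else 0.
Local Notation X0 := zero_extension.

Lemma zero_extension_in u : D u -> X0 u = X u.
Proof. by move=> Du; apply/funext => w; rewrite /X0 mem_set. Qed.

Lemma zero_extension_out u : ~ D u -> X0 u = fun=> 0.
Proof. by move=> Du; apply/funext => w; rewrite /X0 memNset. Qed.

Lemma jointly_measurable_zero_extension :
  measurable_fun ([set: T] `*` D) (fun p : T * 'rV[R]_n => X p.2 p.1) -> jointly_measurable X0.
Proof.
move=> mX; have mTD : measurable ([set: T] `*` D) by exact: measurableX.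
have := (measurable_restrictT _ mTD).1 mX; congr measurable_fun.
apply/funext => -[w u]; rewrite /patch /X0 /=.
by rewrite in_setX in_setT.
Qed.

Lemma zero_extension_GV : D !=set0 -> centered_gaussian_function P (closure D) X ->
  forall k (x : 'I_k -> 'rV[R]_n) (c : 'I_k -> R), GV P (fun w => \sum_(i < k) c i * X0 (x i) w).
Proof.
move=> [u0 Du0] GX k x c; apply: centered_gaussian_GV.
have := GX k (fun i => if x i \in D then x i else u0) (fun i => if x i \in D then c i else 0).
have H i : closure D (if x i \in D then x i else u0).
  by apply: subset_closure; case: ifPn => // /set_mem.
move=> /(_ H); congr centered_gaussian; apply/funext => w; apply: eq_bigr => i _.
by rewrite /X0; case: ifPn => _; rewrite ?mul0r ?mulr0.
Qed.

Lemma ge0_integral_support (E : set 'rV[R]_n) (g h : 'rV[R]_n -> \bar R) : E `<=` D ->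
  measurable_fun setT g -> (forall u, 0 <= g u)%E ->
  (forall u, E u -> g u = h u) -> (forall u, ~ E u -> g u = 0%E) ->
  (\int[mu0]_u g u = \int[mu]_(u in E) h u)%E.
Proof.
move=> ED mg g0 gh gE; rewrite (ge0_integral_mfrestr mD Doo g0 mg) integral_mkcond [RHS]integral_mkcond.
apply: eq_integral => u _; rewrite /patch.
have [Eu|nEu] := boolP (u \in E).
  by rewrite mem_set ?gh//; [exact: set_mem|apply: ED; exact: set_mem].
case: ifPn => // _; apply: gE => Eu; by rewrite mem_set in nEu.
Qed.

Lemma Rint_support (E : set 'rV[R]_n) (g h : 'rV[R]_n -> R) : E `<=` D ->
  measurable_fun setT g -> (forall u, E u -> g u = h u) -> (forall u, ~ E u -> g u = 0) ->
  \int[mu0]_u g u = \int[mu]_(u in E) h u.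
Proof.
move=> ED mg gh gE; rewrite (Rint_mfrestr mD Doo mg) Rintegral_mkcond [RHS]Rintegral_mkcond.
apply: eq_Rintegral => u _; rewrite /patch.
have [Eu|nEu] := boolP (u \in E).
  by rewrite mem_set ?gh//; [exact: set_mem|apply: ED; exact: set_mem].
case: ifPn => // _; apply: gE => Eu; by rewrite mem_set in nEu.
Qed.

Lemma ae_mfrestr (Q : 'rV[R]_n -> Prop) : {ae mu, forall u, Q u} -> {ae mu0, forall u, Q u}.
Proof.
move=> [N [mN N0 NQ]]; exists N; split => //.
apply/eqP; rewrite eq_le measure_ge0 andbT -N0 /= /mfrestr /mrestr.
by apply: le_measure => //; rewrite inE//; exact: measurableI.
Qed.

Lemma intg_ae_eq (g h : 'rV[R]_n -> R) : measurable_fun setT h -> intg mu0 g ->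
  {ae mu0, forall u, g u = h u} -> intg mu0 h.
Proof.
move=> mh ig gh; have mg := intgP ig; move/integrableP : ig => [_ fg].
apply/integrableP; split; first exact/measurable_EFinP.
rewrite (@ge0_ae_eq_integral _ _ _ _ _ _ (fun u => `|(EFin \o g) u|%E))//.
- by apply: measurableT_comp => //; exact/measurable_EFinP.
- by apply: measurableT_comp => //; exact/measurable_EFinP.
- by apply: filterS gh => u guh _ /=; rewrite guh.
Qed.

Hypothesis D0 : D !=set0.
Hypothesis GX : centered_gaussian_function P (closure D) X.
Hypothesis mX : measurable_fun ([set: T] `*` D) (fun p : T * 'rV[R]_n => X p.2 p.1).
Hypothesis X2 : {ae P, forall w, (\int[mu]_(x in D) (X x w ^+ 2)%:E < +oo)%E}.

Let jX := jointly_measurable_zero_extension mX.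
Let GVX := zero_extension_GV D0 GX.

Let mX0 w : measurable_fun setT (X0 ^~ w).
Proof. exact: (measurable_section w jX). Qed.

Lemma zero_extension_sqr : {ae P, forall w, (\int[mu0]_u (X0 u w ^+ 2)%:E < +oo)%E}.
Proof.
apply: filterS X2 => w; congr (_ < _)%E; apply/esym.
apply: (ge0_integral_support (E := D)) => //.
- by apply/measurable_EFinP; exact: measurable_funX.
- by move=> u; rewrite lee_fin sqr_ge0.
- by move=> u Du; rewrite zero_extension_in.
- by move=> u Du; rewrite zero_extension_out// expr0n.
Qed.
Let X20 := zero_extension_sqr.

Lemma small_ball_zero_extension (e : R) : 0 < e ->
  small_ball P D X e = fine (P (ball mu0 X0 (e ^+ 2))).
Proof.
move=> e0; rewrite /small_ball; congr (fine (P _)); apply/seteqP.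
have H w : (L2norm D (X^~ w) <= e%:E)%E = (\int[mu0]_u (X0 u w ^+ 2)%:E <= (e ^+ 2)%:E)%E.
  by apply: L2norm_ball => // u Du; rewrite zero_extension_in.
by split => w; rewrite /ball /= H.
Qed.

Variable phi : 'rV[R]_n -> R.
Hypothesis mphi : measurable_fun D phi.
Local Notation phi0 := (phi \_ D).

Definition psi_ext u := \int[mu0]_y (pairing P X0 (X0 u) y * phi0 y).

Let mphi0 : measurable_fun setT phi0.
Proof. exact: (measurable_restrictT _ mD).1. Qed.

Lemma measurable_psi_ext : measurable_fun setT psi_ext.
Proof.
pose g (z : 'rV[R]_n * 'rV[R]_n) := pairing P X0 (X0 z.1) z.2 * phi0 z.2.
apply: (@measurable_Rint_param _ _ _ _ _ mu0 g).
apply: measurable_funM; last exact: (measurableT_comp mphi0 measurable_snd).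
pose h (z : ('rV[R]_n * 'rV[R]_n) * T) := X0 z.1.2 z.2 * X0 z.1.1 z.2.
apply: (@measurable_Rint_param _ _ _ _ _ P h).
have m1 : measurable_fun setT (fun z : ('rV[R]_n * 'rV[R]_n) * T => (z.2, z.1.2)).
  by apply: measurable_fun_pair => //; exact: measurableT_comp.
have m2 : measurable_fun setT (fun z : ('rV[R]_n * 'rV[R]_n) * T => (z.2, z.1.1)).
  by apply: measurable_fun_pair => //; exact: measurableT_comp.
by apply: measurable_funM; [exact: (measurableT_comp jX m1)|exact: (measurableT_comp jX m2)].
Qed.

Let mpair u : measurable_fun setT (pairing P X0 (X0 u)).
Proof. exact: (measurable_pairing P jX (L2_X GVX u).1). Qed.

Lemma cov_fun_pairing x y : D x -> D y -> cov_fun P X x y = pairing P X0 (X0 x) y.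
Proof.
move=> Dx Dy; rewrite /cov_fun unlock /pairing /Rintegral; congr fine.
apply: eq_integral => w _; rewrite (zero_extension_in Dx) (zero_extension_in Dy).
by rewrite mulrC.
Qed.

Lemma psiE x : D x -> psi P D X phi x = psi_ext x.
Proof.
move=> Dx; apply/esym; apply: (Rint_support (E := D)) => //.
- exact: measurable_funM.
- by move=> y Dy; rewrite /patch mem_set// cov_fun_pairing.
- by move=> y Dy; rewrite /patch memNset// mulr0.
Qed.

Variable E : (set 'rV[R]_n)^nat.
Variable I : T -> R.
Hypothesis mE : forall k, measurable (E k).
Hypothesis ndE : forall j k, (j <= k)%N -> E j `<=` E k.
Hypothesis UE : \bigcup_k E k = D.
Hypothesis intE : forall k, {ae P, forall w, mu.-integrable (E k) (fun u => (X u w * phi u)%:E)}.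
Hypothesis mI : measurable_fun setT I.
Hypothesis cvgI : (fun k => 'E_P[fun w =>
          ((\int[mu]_(u in E k) (X u w * phi u) - I w) ^+ 2)%R]%E) @ \oo --> 0%E.

Let f k := phi \_ (E k).

Let ED k : E k `<=` D. Proof. by rewrite -UE => u Eu; exists k. Qed.

Let mf k : measurable_fun setT (f k).
Proof.
by apply: (measurable_restrictT _ (mE k)).1; exact: (measurable_funS mD (@ED k)).
Qed.

Let fphi u : (f ^~ u) @ \oo --> phi0 u.
Proof.
apply: cvg_near_cst; have [Du|Du] := pselect (D u).
  have [k _ Eu] : (\bigcup_k E k) u by rewrite UE.
  near=> j; rewrite /f /patch !mem_set//.
  by apply: ndE Eu; near: j; exact: nbhs_infty_ge.
by near=> j; rewrite /f /patch !memNset// => /ED.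
Unshelve. all: by end_near. Qed.

Let fle k u : `|f k u| <= `|phi0 u|.
Proof.
rewrite /f /patch; case: ifPn => [Eu|_]; last by rewrite normr0.
by rewrite mem_set//; apply: ED; exact: set_mem Eu.
Qed.

Let Xf k : {ae P, forall w, (\int[mu0]_u `|X0 u w * f k u|%:E < +oo)%E}.
Proof.
apply: filterS (intE k) => w /integrableP[_]; congr (_ < _)%E; apply/esym.
apply: (ge0_integral_support (E := E k)) => //.
- apply/measurable_EFinP; apply: measurableT_comp => //; exact: measurable_funM.
- by move=> u Eu; rewrite (zero_extension_in (ED Eu)) /f /patch mem_set.
- by move=> u Eu; rewrite /f /patch memNset// mulr0 normr0.
Qed.

Let XintE k w : Xint mu0 X0 (f k) w = \int[mu]_(u in E k) (X u w * phi u).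
Proof.
apply: Rint_support => //.
- exact: measurable_funM.
- by move=> u Eu; rewrite (zero_extension_in (ED Eu)) /f /patch mem_set.
- by move=> u Eu; rewrite /f /patch memNset// mulr0.
Qed.

Let XfI : (fun k => \int[P]_w ((Xint mu0 X0 (f k) w - I w) ^+ 2)%:E)%E @ \oo --> 0%E.
Proof.
move: cvgI; apply: cvg_trans; apply: near_eq_cvg; apply: nearW => k.
by rewrite unlock; apply: eq_integral => w _; rewrite XintE.
Qed.

Lemma ext_span : L2_span P X0 I.
Proof. exact: (span_random_integral jX GVX mf Xf mI XfI). Qed.

Lemma ext_approximation del : 0 < del -> exists h : 'rV[R]_n -> R, exists M : R,
  [/\ measurable_fun setT h, forall u, `|h u| <= M &
      \int[P]_w ((I w - \int[mu0]_u (X0 u w * h u)) ^+ 2) <= del].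
Proof. exact: (bounded_approximation jX GVX X20 mf Xf mI XfI). Qed.

Hypothesis covphi : {ae mu, forall x, D x ->
    mu.-integrable D (fun y => (cov_fun P X x y * phi y)%:E)}.

Lemma psi_ext_pairing : {ae mu0, forall u, psi_ext u = pairing P X0 I u}.
Proof.
apply: filterS (ae_mfrestr covphi) => u hu; apply/esym.
apply: (pairing_random_integral jX GVX mf mphi0 fphi fle Xf mI XfI).
have [Du|Du] := pselect (D u); last first.
  rewrite (_ : (fun y => _) = fun=> 0); first exact: intg0.
  apply/funext => y; rewrite /pairing (zero_extension_out Du).
  under eq_Rintegral do rewrite mulr0.
  by rewrite /Rintegral integral0 mul0r.
apply: intg_mfrestr; first exact: measurable_funM.
apply: eq_integrable (hu Du) => // y yD.
by rewrite /= /patch yD cov_fun_pairing//; exact: set_mem.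
Qed.

Hypothesis psiphi : mu.-integrable D (fun u => (psi P D X phi u * phi u)%:E).

Lemma qE : q P D X phi = \int[P]_w (I w ^+ 2).
Proof.
have mpI : measurable_fun setT (pairing P X0 I) by exact: (measurable_pairing P jX mI).
have mpsi := measurable_psi_ext.
have m1 : measurable_fun setT (fun u => psi_ext u * phi0 u) by exact: measurable_funM.
have m2 : measurable_fun setT (fun u => pairing P X0 I u * phi0 u) by exact: measurable_funM.
have i1 : intg mu0 (fun u => psi_ext u * phi0 u).
  apply: intg_mfrestr => //; apply: eq_integrable psiphi => // u uD.
  by rewrite /= /patch uD psiE//; exact: set_mem.
have ae12 : {ae mu0, forall u, psi_ext u * phi0 u = pairing P X0 I u * phi0 u}.
  by apply: filterS psi_ext_pairing => u ->.
have i2 := intg_ae_eq m2 i1 ae12.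
rewrite (variance_random_integral jX GVX mf mphi0 fphi fle Xf mI XfI i2).
rewrite -(@ae_eq_Rint _ _ _ mu0 _ _ m1 m2); last by apply: filterS ae12 => u h _.
apply/esym; apply: (Rint_support (E := D)) => //.
- by move=> u Du; rewrite /patch mem_set// psiE.
- by move=> u Du; rewrite /patch memNset// mulr0.
Qed.

Hypothesis psi_neq0 : ~ {ae mu, forall x, D x -> psi P D X phi x = 0}.

Lemma q_gt0 : 0 < q P D X phi.
Proof.
have LI : L2 P I := ext_span.1.
rewrite lt_neqAle {2}qE Rint_ge0 ?andbT => [|w]; last exact: sqr_ge0.
apply/negP => /eqP /esym q0; apply: psi_neq0; rewrite qE in q0.
have aI := eq0_Rint_sqr LI q0.
have p0 u : pairing P X0 I u = 0.
  rewrite /pairing (@ae_eq_Rint _ _ _ P _ (cst 0)) //.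
  - by rewrite /Rintegral integral0.
  - by apply: measurable_funM => //; exact: (L2_X GVX u).1.
  - by apply: filterS aI => w h _; rewrite h//= mulr0.
have [N [mN N0 hN]] := psi_ext_pairing.
exists (N `&` D); split => //; first exact: measurableI.
move=> u /= hu; have Du : D u by apply: contrapT => nDu; apply: hu.
split => //; apply: hN => /= h; apply: hu => _.
by rewrite psiE// h p0.
Qed.

Lemma small_ball_transformed (alpha e : R) : 0 < e ->
  small_ball P D (transformed P D X phi I alpha) e =
  fine (P (ball mu0 (dilated P X0 I (pairing P X0 I) (1 - alpha * q P D X phi)) (e ^+ 2))).
Proof.
move=> e0; have q0 := q_gt0; rewrite /small_ball; congr (fine (P _)); apply/seteqP.
have mpI : measurable_fun setT (pairing P X0 I) by exact: (measurable_pairing P jX mI).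
have mpsi := measurable_psi_ext.
have H w : (L2norm D (transformed P D X phi I alpha ^~ w) <= e%:E)%E =
    (\int[mu0]_u (dilated P X0 I (pairing P X0 I) (1 - alpha * q P D X phi) u w ^+ 2)%:E <= (e ^+ 2)%:E)%E.
  pose g u := X0 u w - alpha * psi_ext u * I w.
  have mg : measurable_fun setT g.
    by apply: measurable_funB => //; apply: measurable_funM => //; exact: measurable_funM.
  have mdil : measurable_fun setT (fun u => dilated P X0 I (pairing P X0 I) (1 - alpha * q P D X phi) u w).
    by apply: measurable_funD => //; exact: measurable_funM.
  rewrite (@L2norm_ball _ _ _ mD Doo _ g)//; last first.
    by move=> u Du; rewrite /transformed /g (zero_extension_in Du) psiE.
  congr (_ <= _)%E; apply: ge0_ae_eq_integral => //.
  - by apply/measurable_EFinP; exact: measurable_funX.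
  - by apply/measurable_EFinP; exact: measurable_funX.
  - by move=> u _; rewrite lee_fin sqr_ge0.
  - by move=> u _; rewrite lee_fin sqr_ge0.
  - apply: filterS psi_ext_pairing => u hu _; congr (_ ^+ 2)%:E.
    rewrite /g /dilated /shift hu -qE; field.
    by rewrite gt_eqF.
by split => w; rewrite /ball /= H.
Qed.

Theorem small_ball_ratio alpha : alpha != (q P D X phi)^-1 ->
  (fun e : R =>
     small_ball P D (transformed P D X phi I alpha) e /
     (`|1 - alpha * q P D X phi|^-1 * small_ball P D X e)) @ 0^'+ --> (1 : R).
Proof.
move=> aq; have q0 := q_gt0; set be := 1 - alpha * q P D X phi.
have be0 : be != 0.
  rewrite subr_eq0 eq_sym; apply: contra aq => /eqP h.
  by apply/eqP; rewrite -[RHS]mul1r -h mulfK// gt_eqF.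
have nb0 : 0 < `|be| by rewrite normr_gt0.
have LX := ae_L2_process jX X20.
have GS := gaussian_space_span jX GVX X20.
have mA := @measurable_rational_halfspace R n.
have gA := @rational_halfspace_generate R n.
have v0 : 0 < \int[P]_w (I w ^+ 2) by rewrite -qE.
have LI : L2 P I := ext_span.1.
have Lb := L2_pairing jX GVX X20 LI.
have cb (h : 'rV[R]_n -> R) (M : R) : measurable_fun setT h -> (forall u, `|h u| <= M) ->
    \int[mu0]_u (pairing P X0 I u * h u) = \int[P]_w ((\int[mu0]_u (X0 u w * h u)) * I w).
  move=> mh hM.
  have := Xint_pairing jX GVX mh (intg_stdev_bounded jX GVX X20 mh hM) LI.
  by move=> <-.
apply/cvgrPdist_le => eta eta0.
have eta2 : 0 < eta / `|be| by rewrite divr_gt0.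
have [c0 [c00 hc]] := dilated_ball_asymptotics mA gA jX LX GS ext_span ext_approximation Lb cb v0 be0 eta2.
near=> e.
have e0 : 0 < e by near: e; exact: nbhs_right_gt.
have e1 : e < 1 by near: e; apply: nbhs_right_lt.
have ec : e < c0 by near: e; exact: nbhs_right_lt.
have e2 : 0 < e ^+ 2 by rewrite exprn_gt0.
have e2c : e ^+ 2 < c0 by apply: le_lt_trans ec; rewrite expr2 ger_pMl// ltW.
have := hc _ e2 e2c.
have := ball_gt0 mA gA jX LX GS e2.
rewrite small_ball_transformed// small_ball_zero_extension// -/be.
set p := fine (P (ball mu0 X0 _)); set p' := fine _ => p0 h.
have -> : 1 - p' / (`|be|^-1 * p) = - ((p' - `|be|^-1 * p) * (`|be| / p)).
  by field; rewrite !gt_eqF.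
have bp : 0 <= `|be| / p by rewrite divr_ge0// ltW.
rewrite normrN normrM (ger0_norm bp).
apply: (le_trans (ler_wpM2r bp h)); rewrite le_eqVlt; apply/orP; left; apply/eqP.
by field; rewrite !gt_eqF.
Unshelve. all: by end_near. Qed.

End field_on_domain.
Theorem theorem1 (R : realType) (d : measure_display) (T : measurableType d)
    (P : probability T R) (n : nat) (D : set 'rV[R]_n)
    (X : 'rV[R]_n -> T -> R) (phi : 'rV[R]_n -> R) (I : {RV P >-> R})
    (alpha : R) :
  (0 < n)%N ->
  is_domain D -> bounded_set D ->
  centered_gaussian_function P (closure D) X ->
  measurable_fun ([set: T] `*` D) (fun p : T * 'rV[R]_n => X p.2 p.1) ->
  {ae P, forall w, (\int[lebesgue_rV n]_(x in D) (X x w ^+ 2)%:E < +oo)%E} ->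
  locally_summable D phi ->
  {ae lebesgue_rV n, forall x, D x ->
    (lebesgue_rV n).-integrable D (fun y => (cov_fun P X x y * phi y)%:E)} ->
  ~ {ae lebesgue_rV n, forall x, D x -> psi P D X phi x = 0} ->
  (lebesgue_rV n).-integrable D (fun u => (psi P D X phi u * phi u)%:E) ->
  is_random_integral P D X phi I ->
  alpha != (q P D X phi)^-1 ->
  (fun e : R =>
     small_ball P D (transformed P D X phi I alpha) e /
     (`|1 - alpha * q P D X phi|^-1 * small_ball P D X e)) @ 0^'+ --> (1 : R).
Proof.
  (* your proof *)
Proof.
move=> _ [_ _ D0] bD GX mX X2 [mphi _ _] covphi psi0 psiphi [E [mE ndE UE intE cvgI]] aq.
have mD : measurable D by rewrite -UE; exact: bigcupT_measurable.
have Doo := lebesgue_rV_bounded mD bD.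
exact: (small_ball_ratio mD Doo D0 GX mX X2 mphi mE ndE UE intE (measurable_funPT I) cvgI
  covphi psiphi psi0 aq).
Qed.
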